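(* Let $\mathbf{k}$ be a field with $\mathrm{char}(\mathbf{k})\neq 2$. Let $r$ be the cardinality of the square class group $\mathbf{k}^*/(\mathbf{k}^* )^2$ and let $s$ be the number of isomorphism classes of quaternion algebras over $\mathbf{k}$. Then there are exactly $10+2r+s$ isomorphism classes of minimal algebras over $\mathbf{k}$ of dimension 7, generated in degree 1, whose characteristic filtration has length 2. In particular, when $\mathbf{k}$ is algebraically closed, $r=s=1$ and there are 13 such minimal algebras up to isomorphism; when $\mathbf{k}=\mathbb{R}$, $r=s=2$ and there are 16.
   Context: A commutative differential graded algebra (CDGA) over $\mathbf{k}$ is a graded-commutative graded $\mathbf{k}$-algebra $A=\oplus_{k\ge0}A^k$ with a differential $d:A^k\to A^{k+1}$, $d^2=0$, satisfying the graded Leibniz rule; isomorphisms are degree-preserving algebra isomorphisms commuting with $d$. A minimal algebra is a CDGA $(\wedge V,d)$, free graded-commutative on a graded vector space $V$, admitting a well-ordered set of generators $x_\tau$ with non-decreasing degrees such that each $dx_\tau$ is expressed in terms of preceding generators (so $dx_\tau$ has no linear part). Its dimension is $\dim_{\mathbf{k}} V$; it is generated in degree 1 if $V=V^1$. For such an algebra define $W_0=\ker(d)\cap V$ and $W_k=d^{-1}(\wedge^2 W_{k-1})\cap V$ for $k\ge1$; this gives an increasing filtration $W_0\subset W_1\subset\cdots$ of $V$ (the characteristic filtration), and its length is the least $k$ such that $W_{k-1}=V$. Thus length 2 means $W_0\neq V$ and $W_1=V$. A quaternion algebra $(a,b)$, $a,b\in\mathbf{k}^*$, is the 4-dimensional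 $\mathbf{k}$-algebra with basis $1,x_1,x_2,x_3$ and multiplication $x_1^2=a$, $x_2^2=b$, $x_1x_2=-x_2x_1=x_3$ (so $x_3^2=-ab$). *)

(* Defs.v *)
From HB Require Import structures.
From mathcomp Require Import all_boot all_order all_algebra.
From mathcomp Require Import reals.

Set Implicit Arguments.
Unset Strict Implicit.
Unset Printing Implicit Defensive.

Import Order.TTheory GRing.Theory Num.Theory.
Local Open Scope ring_scope.

(* The exterior algebra  /\ (K^n)  on generators e_0, ..., e_{n-1}    *)
(* (all of degree 1).  An element is its coefficient family on the    *)
(* basis e_S = e_{i1} ... e_{ip}  (S = {i1 < ... < ip}).              *)

Notation ext K n := {ffun {set 'I_n} -> K}.

Section Exterior.
Variables (K : fieldType) (n : nat).

Definition ext_inv (T U : {set 'I_n}) : nat :=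
  #|[set p : 'I_n * 'I_n | [&& p.1 \in T, p.2 \in U & (p.2 < p.1)%N]]|.

(* graded-commutative (wedge) product:  e_T e_U = (-1)^inv(T,U) e_(T u U)
   when T, U are disjoint, and 0 otherwise *)
Definition wedge (a b : ext K n) : ext K n :=
  [ffun S : {set 'I_n} => \sum_(T : {set 'I_n} | T \subset S)
                (-1) ^+ ext_inv T (S :\: T) * a T * b (S :\: T)].

Definition escale (c : K) (a : ext K n) : ext K n := [ffun S => c * a S].

Definition ext1 : ext K n := [ffun S : {set 'I_n} => (S == set0)%:R].

Definition homog (p : nat) (a : ext K n) : Prop :=
  forall S : {set 'I_n}, #|S| != p -> a S = 0.

Definition is_cdga_diff (D : ext K n -> ext K n) : Prop :=
  [/\ (forall (c : K) (x y : ext K n), D (escale c x + y) = escale c (D x) + D y),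
      (forall p x, homog p x -> homog p.+1 (D x)),
      (forall p x y, homog p x ->
         D (wedge x y) = wedge (D x) y + escale ((-1) ^+ p) (wedge x (D y))) &
      (forall x, D (D x) = 0)].

(* Sullivan minimality: there is an ordered basis x_0,...,x_{n-1} of the
   generating space V = V^1 such that each d x_i is expressed in terms of
   the preceding generators (in degree 2: a combination of x_a x_b, a,b < i). *)
Definition is_minimal (D : ext K n -> ext K n) : Prop :=
  exists x : 'I_n -> ext K n,
  [/\ (forall i, homog 1 (x i)),
      (forall c : 'I_n -> K, \sum_i escale (c i) (x i) = 0 -> forall i, c i = 0),
      (forall v, homog 1 v -> exists c : 'I_n -> K, v = \sum_i escale (c i) (x i)) &
      (forall i : 'I_n, exists c : 'I_n -> 'I_n -> K,
         D (x i) = \sum_(a < n | (a < i)%N) \sum_(b < n | (b < i)%N)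
                      escale (c a b) (wedge (x a) (x b)))].

Definition W0 (D : ext K n -> ext K n) (v : ext K n) : Prop :=
  homog 1 v /\ D v = 0.

(* characteristic filtration has length 2:  W_0 <> V  and
   W_1 = d^{-1}(/\^2 W_0) \cap V = V *)
Definition filt_length2 (D : ext K n -> ext K n) : Prop :=
  (exists v, homog 1 v /\ D v <> 0) /\
  (forall v, homog 1 v ->
     exists (m : nat) (w w' : 'I_m -> ext K n),
       (forall i, W0 D (w i) /\ W0 D (w' i)) /\
       D v = \sum_(i < m) wedge (w i) (w' i)).

Definition cdga_iso (D1 D2 : ext K n -> ext K n) : Prop :=
  exists phi : ext K n -> ext K n,
  [/\ (forall (c : K) (x y : ext K n), phi (escale c x + y) = escale c (phi x) + phi y),
      bijective phi /\ phi ext1 = ext1,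
      (forall x y, phi (wedge x y) = wedge (phi x) (phi y)),
      (forall p x, homog p x -> homog p (phi x)) &
      (forall x, phi (D1 x) = D2 (phi x))].

End Exterior.

Definition MinAlgL2 (K : fieldType) (n : nat) :=
  {D : ext K n -> ext K n |
     [/\ is_cdga_diff D, is_minimal D & filt_length2 D]}.

Definition minalg_iso (K : fieldType) (n : nat) (A B : MinAlgL2 K n) : Prop :=
  cdga_iso (proj1_sig A) (proj1_sig B).

(* Quaternion algebras (a,b): basis 1, x1, x2, x3 with                *)
(* x1^2 = a, x2^2 = b, x1 x2 = - x2 x1 = x3.                          *)

Record quat (K : Type) := Quat { q0 : K; q1 : K; q2 : K; q3 : K }.

Section Quat.
Variable K : fieldType.

Definition qadd (x y : quat K) : quat K :=
  Quat (q0 x + q0 y) (q1 x + q1 y) (q2 x + q2 y) (q3 x + q3 y).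
Definition qscale (c : K) (x : quat K) : quat K :=
  Quat (c * q0 x) (c * q1 x) (c * q2 x) (c * q3 x).
Definition qone : quat K := Quat 1 0 0 0.
Definition qmul (a b : K) (x y : quat K) : quat K :=
  Quat (q0 x * q0 y + a * q1 x * q1 y + b * q2 x * q2 y - a * b * q3 x * q3 y)
       (q0 x * q1 y + q1 x * q0 y - b * q2 x * q3 y + b * q3 x * q2 y)
       (q0 x * q2 y + q2 x * q0 y + a * q1 x * q3 y - a * q3 x * q1 y)
       (q0 x * q3 y + q3 x * q0 y + q1 x * q2 y - q2 x * q1 y).

Definition quat_iso (a b a' b' : K) : Prop :=
  exists f : quat K -> quat K,
  [/\ (forall c x y, f (qadd (qscale c x) y) = qadd (qscale c (f x)) (f y)),
      bijective f,
      f qone = qone &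
      (forall x y, f (qmul a b x y) = qmul a' b' (f x) (f y))].

Definition kstar := {a : K | a != 0}.
Definition sqclass_rel (x y : kstar) : Prop :=
  exists c : K, c != 0 /\ proj1_sig x = c ^+ 2 * proj1_sig y.

Definition qparam := {ab : K * K | (ab.1 != 0) && (ab.2 != 0)}.
Definition quat_rel (x y : qparam) : Prop :=
  quat_iso (proj1_sig x).1 (proj1_sig x).2 (proj1_sig y).1 (proj1_sig y).2.

End Quat.

Definition sum_rel (A B : Type) (R : A -> A -> Prop) (S : B -> B -> Prop)
  (u v : A + B) : Prop :=
  match u, v with
  | inl a, inl a' => R a a'
  | inr b, inr b' => S b b'
  | _, _ => False
  end.

(* Index set with cardinal 10 + r + r + s:
   'I_10 + (square classes + square classes) + quaternion algebras / iso *)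
Definition index_rel (K : fieldType) :=
  sum_rel (sum_rel (@eq 'I_10) (sum_rel (@sqclass_rel K) (@sqclass_rel K)))
          (@quat_rel K).

(* "the equivalence classes of R (on A) are in bijection with those of
    S (on B)": F : B -> A induces an injective and surjective map on classes *)
Definition same_class_count (A B : Type) (R : A -> A -> Prop)
  (S : B -> B -> Prop) : Prop :=
  exists F : B -> A,
    (forall b b', R (F b) (F b') <-> S b b') /\
    (forall a, exists b, R a (F b)).

(* Main.v *)
Require Import Defs.
From HB Require Import structures.
From mathcomp Require Import all_boot all_order all_algebra.
From mathcomp Require Import fingroup perm reals ring lra zify.
Import Order.TTheory GRing.Theory Num.Theory.
Local Open Scope ring_scope.

Set Implicit Arguments.
Unset Strict Implicit.
Unset Printing Implicit Defensive.

(** Since [V] is generated in degree one and [W_1 = V], such an algebra is the same as a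
    subspace [U = d V] of [/\^2 W_0], up to [GL(W_0)]; write [p = dim W_0] and
    [q = dim U], so [p + q = 7] and [(p, q)] is [(6,1)], [(5,2)] or [(4,3)].  A basis of
    [U] is a system of [q] alternating [p x p] matrices, modulo simultaneous congruence
    and change of basis of [U].  Write [ij] for [e_i e_j].

    - [(6,1)]: the rank of an alternating form gives 3 classes.
    - [(5,2)]: reducing a pencil by explicit base changes leaves [<01, 02>],
      [<01, 02+13>], [<01, 23+04>], [<01+23, 04+12>] and the family
      [<01+23, 02+a13>], [a <> 0].  The discriminant of the Pfaffian on the last one is
      [-a] up to squares, which gives [4 + r] classes.
    - [(4,3)]: diagonalise the Pfaffian on [U].  If it vanishes, [U] is [<01, 02, 03>] or
      [<01, 02, 12>].  Otherwise it is similar to [<1, -a, -b>] and then [U] is equivalent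
      to [<01+23, 02+a13, 03-b12>]; two of these are equivalent exactly when the ternary
      forms are similar.  Rank 1, 2 and 3 give [1], [r] and [s] classes, the last because
      [<1, -a, -b>] is similar to the square map on the pure quaternions of [(a,b)].

    Altogether [3 + (4 + r) + (2 + 1 + r + s) = 10 + 2r + s]. *)

(** Congruence by [P] multiplies the Pfaffian of an alternating 4 x 4 matrix by the determinant of
    [P], so in the case (4,3) the group acts on the six-dimensional space of such matrices through
    similitudes of a hyperbolic quadratic form. The similarity class of the restriction to [U] is
    therefore an invariant. The substance is the converse, in the style of Witt's extension theorem
    but obtained by explicit base changes: a nonzero restriction determines [U]. A zero restriction
    does not, because congruences preserve each of the two families of totally isotropic
    three-spaces; hence the two isotropic classes. For 5 x 5 matrices the Pfaffian is available only
    when the pencil has a common kernel vector; the remaining classes are told apart by that kernel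
    and by the decomposable elements of [U]. The shapes (p, q) are separated by the dimension of
    [W_0]. Those with [p <= 3] do not occur, since there are too few independent alternating
    matrices, and [q = 0] would make the differential vanish. *)

(** * The exterior algebra as an algebra *)

(* A separate name for [ext], so that the wedge product can be its canonical ring structure. *)
Definition ealg (K : fieldType) (n : nat) := ext K n.

Section WedgeLaws.
Variables (K : fieldType) (n : nat).
Implicit Types (x y z : ext K n).

Fact wedgeDl : left_distributive (@wedge K n) +%R.
Proof.
move=> x y z; apply/ffunP=> S; rewrite !ffunE -big_split; apply: eq_bigr => T _ /=.
by rewrite !ffunE mulrDr mulrDl.
Qed.

Fact wedgeDr : right_distributive (@wedge K n) +%R.
Proof.
move=> x y z; apply/ffunP=> S; rewrite !ffunE -big_split; apply: eq_bigr => T _ /=.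
by rewrite !ffunE mulrDr.
Qed.

Fact wedgeZl (c : K) x z : escale c (wedge x z) = wedge (escale c x) z.
Proof.
apply/ffunP=> S; rewrite !ffunE mulr_sumr; apply: eq_bigr => T _ /=.
by rewrite !ffunE -!mulrA [RHS]mulrCA.
Qed.

Fact wedgeZr (c : K) x z : escale c (wedge x z) = wedge x (escale c z).
Proof.
apply/ffunP=> S; rewrite !ffunE mulr_sumr; apply: eq_bigr => T _ /=.
by rewrite !ffunE mulrCA.
Qed.

(** Additivity of the inversion count in each argument is the cocycle identity that makes the signs
    of [wedge] associative. *)
Lemma ext_invUl (T U V : {set 'I_n}) : [disjoint T & U] ->
  ext_inv (T :|: U) V = (ext_inv T V + ext_inv U V)%N.
Proof.
move=> dTU; rewrite /ext_inv -cardsUI -[LHS]addn0; congr addn.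
  by congr #|pred_of_set _|; apply/setP=> -[a b]; rewrite !inE /= andb_orl.
apply/eqP; rewrite eq_sym cards_eq0 -subset0; apply/subsetP=> -[a b]; rewrite !inE /=.
move=> /andP[/and3P[aT _ _] /and3P[aU _ _]].
by move: dTU => /pred0P/(_ a); rewrite /= aT aU.
Qed.

Lemma ext_invUr (T U V : {set 'I_n}) : [disjoint T & U] ->
  ext_inv V (T :|: U) = (ext_inv V T + ext_inv V U)%N.
Proof.
move=> dTU; rewrite /ext_inv -cardsUI -[LHS]addn0; congr addn.
  by congr #|pred_of_set _|; apply/setP=> -[a b]; rewrite !inE /= andb_orl andb_orr.
apply/eqP; rewrite eq_sym cards_eq0 -subset0; apply/subsetP=> -[a b]; rewrite !inE /=.
move=> /andP[/and3P[_ aT _] /and3P[_ aU _]].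
by move: dTU => /pred0P/(_ b); rewrite /= aT aU.
Qed.

Lemma setUDK (I : finType) (T U : {set I}) : T \subset U -> T :|: (U :\: T) = U.
Proof.
move=> /subsetP sTU; apply/setP=> i; rewrite !inE.
by case: (boolP (i \in T)) => // /sTU ->.
Qed.

(** Both sides sum over the splittings of [S] into three ordered disjoint pieces. The right side is
    indexed by unions [T :|: U], and removing [T] matches it with the left side. *)
Fact wedgeA : associative (@wedge K n).
Proof.
move=> x y z; apply/ffunP=> S; rewrite !ffunE.
under eq_bigr => T _ do rewrite ffunE mulr_sumr.
under [RHS]eq_bigr => T _ do rewrite ffunE mulr_sumr mulr_suml.
rewrite [RHS](exchange_big_dep (fun T : {set 'I_n} => T \subset S)) /=; last first.
  by move=> T U /[swap]; apply: subset_trans.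
apply: eq_bigr => T sTS.
rewrite [RHS](reindex_onto (fun U => T :|: U) (fun U => U :\: T)); last first.
  by move=> U /andP[_ sTU]; rewrite setUDK.
rewrite /=; apply: eq_big => [U|U sU].
  rewrite subUset sTS subsetUl andbT /= setDUl setDv set0U subsetD.
  congr andb; apply/idP/eqP => [/setDidPl|<-] //.
  by rewrite disjoints_subset setDE subsetIr.
have dUT : [disjoint U & T] by move: sU; rewrite subsetD => /andP[].
have -> : (T :|: U) :\: T = U by rewrite setDUl setDv set0U; apply/setDidPl.
rewrite setDDl.
have e1 : S :\: T = U :|: (S :\: (T :|: U)).
  by rewrite -setDDl setUDK.
rewrite [in ext_inv T (S :\: T)]e1 ext_invUr; last first.
  by rewrite disjoint_sym disjoints_subset -setDDl setDE subsetIr.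
rewrite ext_invUl 1?disjoint_sym // !exprD -!mulrA.
ring.
Qed.

Lemma ext_inv0l (S : {set 'I_n}) : ext_inv set0 S = 0%N.
Proof. by apply/eqP; rewrite cards_eq0; apply/eqP/setP=> p; rewrite !inE. Qed.
Lemma ext_inv0r (S : {set 'I_n}) : ext_inv S set0 = 0%N.
Proof. by apply/eqP; rewrite cards_eq0; apply/eqP/setP=> p; rewrite !inE andbF. Qed.

Fact wedge1l : left_id (ext1 K n) (@wedge K n).
Proof.
move=> x; apply/ffunP=> S; rewrite ffunE (bigD1 set0) ?sub0set //= big1 => [|T /andP[_ /negPf T0]].
  by rewrite addr0 ffunE eqxx ext_inv0l setD0 !mul1r.
by rewrite ffunE T0 mulr0 mul0r.
Qed.

Fact wedge1r : right_id (ext1 K n) (@wedge K n).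
Proof.
move=> x; apply/ffunP=> S; rewrite ffunE (bigD1 S) //= big1 => [|T /andP[sTS TS]].
  by rewrite addr0 ffunE setDv eqxx ext_inv0r mulr1 mul1r.
rewrite ffunE setD_eq0; suff /negPf-> : ~~ (S \subset T) by rewrite mulr0.
by apply: contra TS => sST; rewrite eqEsubset sTS.
Qed.

Fact ext1_neq0 : ext1 K n != 0.
Proof. by apply/eqP=> /ffunP/(_ set0); rewrite !ffunE eqxx; apply/eqP/oner_neq0. Qed.

Fact escaleA (a b : K) x : escale a (escale b x) = escale (a * b) x.
Proof. by apply/ffunP=> S; rewrite !ffunE mulrA. Qed.
Fact escale1 : left_id 1 (@escale K n).
Proof. by move=> x; apply/ffunP=> S; rewrite !ffunE mul1r. Qed.
Fact escaleDr : right_distributive (@escale K n) +%R.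
Proof. by move=> c x y; apply/ffunP=> S; rewrite !ffunE mulrDr. Qed.
Fact escaleDl x : {morph (@escale K n)^~ x : a b / a + b}.
Proof. by move=> a b; apply/ffunP=> S; rewrite !ffunE mulrDl. Qed.

HB.instance Definition _ := GRing.Zmodule.copy (ealg K n) (ext K n).
HB.instance Definition _ := GRing.Zmodule_isNzRing.Build (ealg K n)
  wedgeA wedge1l wedge1r wedgeDl wedgeDr ext1_neq0.
HB.instance Definition _ := GRing.Zmodule_isLmodule.Build K (ealg K n)
  escaleA escale1 escaleDr escaleDl.
HB.instance Definition _ := GRing.Lmodule_isLalgebra.Build K (ealg K n) wedgeZl.
HB.instance Definition _ := GRing.Lalgebra_isAlgebra.Build K (ealg K n) wedgeZr.
End WedgeLaws.

(** * Generators, interior products and the grading involution *)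

Section ExteriorAlgebra.
Variables (K : fieldType) (n : nat).
Notation E := (ealg K n).
Implicit Types (x y z : E) (S T : {set 'I_n}) (i j k : 'I_n).

Lemma ealg_addE x y S : (x + y) S = x S + y S. Proof. exact: ffunE. Qed.
Lemma ealg_oppE x S : (- x) S = - x S. Proof. exact: ffunE. Qed.
Lemma ealg_zeroE S : (0 : E) S = 0. Proof. exact: ffunE. Qed.
Lemma ealg_scaleE (c : K) x S : (c *: x) S = c * x S. Proof. exact: ffunE. Qed.
Lemma ealg_oneE S : (1 : E) S = (S == set0)%:R. Proof. exact: ffunE. Qed.
Definition ealgE := (ealg_addE, ealg_oppE, ealg_scaleE, ealg_zeroE, ealg_oneE).

Lemma ealg_sumE (I : Type) (r : seq I) (P : pred I) (F : I -> E) S :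
  (\sum_(i <- r | P i) F i) S = \sum_(i <- r | P i) F i S.
Proof. by apply: (big_morph (fun x : E => x S)) => [u v|]; rewrite ealgE. Qed.

Definition monom S : E := [ffun T : {set 'I_n} => (T == S)%:R].
Definition gen i : E := monom [set i].
Definition nbelow i S : nat := #|[set j in S | (j < i)%N]|.
(** The interior product with the [i]-th dual vector: [gen i] is brought to the front of a monomial,
    at the cost of the sign, and removed. *)
Definition contract i x : E :=
  [ffun S : {set 'I_n} => if i \in S then 0 else (-1) ^+ nbelow i S * x (i |: S)].
(** The grading involution; it carries the sign of the graded Leibniz rules for factors that are not
    homogeneous. *)
Definition parity x : E := [ffun S : {set 'I_n} => (-1) ^+ #|S| * x S].

Lemma gen_mulE i x S :
  (gen i * x) S = if i \in S then (-1) ^+ nbelow i S * x (S :\ i) else 0.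
Proof.
rewrite ffunE; case: ifP => iS.
  rewrite (bigD1 [set i]) ?sub1set //= big1 => [|T /andP[_ /negPf T0]]; last first.
    by rewrite ffunE T0 mulr0 mul0r.
  rewrite addr0 ffunE eqxx mulr1; congr (_ ^+ _ * _).
  rewrite /ext_inv /nbelow -[RHS](card_imset _ (can_inj (f := pair i) (g := snd) _)) //.
  apply: eq_card => -[a b]; rewrite !inE /=; apply/and3P/imsetP.
    case=> /eqP-> /andP[bi bS] lt; exists b => //; by rewrite inE bS.
  case=> c; rewrite inE => /andP[cS lt] [-> ->]; rewrite eqxx cS lt; split=> //.
  by rewrite andbT; apply: contraTneq lt => ->; rewrite ltnn.
apply: big1 => T sTS; rewrite ffunE; case: eqP => [eT|_]; last by rewrite mulr0 mul0r.
by move: sTS; rewrite eT sub1set iS.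
Qed.

Lemma nbelowD1 i j S : j \in S ->
  nbelow i S = (nbelow i (S :\ j) + (j < i)%N)%N.
Proof.
move=> jS; rewrite /nbelow (cardsD1 j) inE jS /= addnC; congr (_ + _)%N.
by apply: eq_card => l; rewrite !inE andbA.
Qed.

Lemma nbelowU1 i j S : j \notin S ->
  nbelow i (j |: S) = (nbelow i S + (j < i)%N)%N.
Proof. by move=> jS; rewrite (@nbelowD1 i j) ?setU11 // setU1K. Qed.

Lemma signr_ltn_swap i j : i != j ->
  (-1) ^+ (i < j)%N = - (-1) ^+ (j < i)%N :> K.
Proof.
by rewrite -val_eqE neq_ltn; case: ltngtP => // _ _; rewrite ?expr1 ?expr0 ?opprK.
Qed.

Lemma signsqr (m : nat) : (-1) ^+ m * (-1) ^+ m = 1 :> K.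
Proof. by rewrite -exprD addnn -mul2n exprM sqrrN expr1n expr1n. Qed.

(** The anticommutation relation of the Clifford action. With [contract1] it determines [contract],
    so later identities follow by [ealg_ind] instead of by signs of coefficients. *)
Lemma contract_gen i j x :
  contract i (gen j * x) = (i == j)%:R *: x - gen j * contract i x.
Proof.
apply/ffunP=> S; rewrite !ealgE ffunE !gen_mulE ffunE.
case: (eqVneq i j) => [<-|nij] /=; rewrite ?mul1r ?mul0r.
  rewrite setU11 !inE eqxx /=; case: ifP => iS.
    by rewrite setD1K // (@nbelowD1 i i) // ltnn addn0 mulrA signsqr mul1r subrr.
  rewrite setU1K ?iS // nbelowU1 ?iS // ltnn addn0 mulrA signsqr mul1r.
  by rewrite subr0.
rewrite !inE (negPf nij) /= [j == i]eq_sym (negPf nij) /= add0r.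
case: (boolP (i \in S)) => iS; case: (boolP (j \in S)) => jS; rewrite ?oppr0 ?mulr0 ?oppr0 //.
rewrite nbelowU1 // (@nbelowD1 i j) // !exprD.
have -> : (i |: S) :\ j = i |: (S :\ j).
  by apply/setP=> l; rewrite !inE; case: (eqVneq l i) => // ->; rewrite nij.
rewrite (@signr_ltn_swap i j) //.
have := signsqr (j < i)%N; move: ((-1) ^+ (j < i)%N) => b hb.
move: ((-1) ^+ nbelow i _) ((-1) ^+ nbelow j S) (x _) => a c u.
by transitivity (- (b * b * (c * (a * u)))); [ring | rewrite hb mul1r].
Qed.


Lemma contract_is_linear i : linear (contract i).
Proof.
move=> c x y; apply/ffunP=> S; rewrite !(ealgE, ffunE); case: ifP => _; last ring.
by rewrite mulr0 addr0.
Qed.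
HB.instance Definition _ i := GRing.isLinear.Build K E E _ (contract i) (contract_is_linear i).

Lemma parity_is_linear : linear parity.
Proof. by move=> c x y; apply/ffunP=> S; rewrite !(ealgE, ffunE); ring. Qed.
HB.instance Definition _ := GRing.isLinear.Build K E E _ parity parity_is_linear.

Lemma contract1 i : contract i 1 = 0.
Proof.
apply/ffunP=> S; rewrite !(ealgE, ffunE); case: ifP => // _.
by rewrite -subset0 subUset sub1set inE /= mulr0.
Qed.

Lemma ealg_monomE x : x = \sum_S x S *: monom S.
Proof.
apply/ffunP=> T; rewrite ealg_sumE (bigD1 T) //= big1 => [|S /negPf nS].
  by rewrite addr0 ealgE ffunE eqxx mulr1.
by rewrite ealgE ffunE eq_sym nS mulr0.
Qed.

(** Every monomial is, up to sign, a product of generators, peeled off one at a time. *)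
Lemma ealg_ind (P : E -> Prop) :
  (forall c x y, P x -> P y -> P (c *: x + y)) ->
  P 1 -> (forall i x, P x -> P (gen i * x)) -> forall x, P x.
Proof.
move=> Plin P1 Pgen.
have P0 : P 0 by rewrite -[0](addNr (1 : E)) -scaleN1r; apply: Plin.
have PZ c x : P x -> P (c *: x) by move=> Px; rewrite -[_ *: _]addr0; apply: Plin.
have PD x y : P x -> P y -> P (x + y).
  by move=> Px Py; rewrite -[x]scale1r; apply: Plin.
suff Pm S : P (monom S).
  by move=> x; rewrite [x]ealg_monomE; elim/big_ind: _ => // S _; apply: PZ.
have [m] := ubnP #|S|; elim: m S => // m IHm S leSm.
have [->|[i iS]] := set_0Vmem S.
  by rewrite (_ : monom _ = 1) //; apply/ffunP=> T; rewrite ealgE ffunE.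
suff -> : monom S = (-1) ^+ nbelow i S *: (gen i * monom (S :\ i)).
  apply/PZ/Pgen/IHm; move: leSm; by rewrite (cardsD1 i) iS add1n ltnS.
apply/ffunP=> T; rewrite ealgE gen_mulE !ffunE; case: ifP => iT; last first.
  by rewrite mulr0; case: eqP => // eT; rewrite -eT iT in iS.
have -> : (T :\ i == S :\ i) = (T == S).
  by apply/eqP/eqP => [eTS|->//]; rewrite -(setD1K iT) eTS setD1K.
by case: eqP => [->|]; rewrite ?mulr0 // mulr1 signsqr.
Qed.

Lemma gen_gen i j x : gen i * (gen j * x) = - (gen j * (gen i * x)).
Proof.
have [<-|nij] := eqVneq i j.
  suff -> : gen i * (gen i * x) = 0 by rewrite oppr0.
  by apply/ffunP=> S; rewrite !gen_mulE !inE eqxx ealgE /= mulr0 if_same.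
apply/ffunP=> S; rewrite ealgE !gen_mulE !inE nij eq_sym nij /=.
case: (boolP (i \in S)) => iS; case: (boolP (j \in S)) => jS; rewrite ?(mulr0, oppr0) //.
rewrite (@nbelowD1 i j S) // (@nbelowD1 j i S) // !exprD (@signr_ltn_swap i j) //.
have -> : (S :\ i) :\ j = (S :\ j) :\ i by rewrite !setDDl setUC.
by ring.
Qed.

Lemma parity1 : parity 1 = 1.
Proof.
apply/ffunP=> S; rewrite !(ealgE, ffunE); case: eqP => [->|]; last by rewrite mulr0.
by rewrite cards0 mul1r.
Qed.

Lemma parity_gen i x : parity (gen i * x) = - (gen i * parity x).
Proof.
apply/ffunP=> S; rewrite ealgE ffunE !gen_mulE; case: ifP => iS; last by rewrite mulr0 oppr0.
by rewrite ffunE (cardsD1 i S) iS exprS; ring.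
Qed.

Lemma parityK : involutive parity.
Proof. by move=> x; apply/ffunP=> S; rewrite !ffunE mulrA signsqr mul1r. Qed.

Lemma contract_mul i x y :
  contract i (x * y) = contract i x * y + parity x * contract i y.
Proof.
elim/ealg_ind: x => [c u v IHu IHv||j x IHx].
- by rewrite mulrDl -scalerAl !linearP /= IHu IHv !mulrDl -!scalerAl scalerDr; rewrite addrACA.
- by rewrite contract1 parity1 !mul1r mul0r add0r.
rewrite -mulrA !contract_gen IHx parity_gen mulrDr mulrBl -scalerAl opprD addrA.
by rewrite !mulrA mulNr.
Qed.

Lemma gen_comm i x : gen i * x = parity x * gen i.
Proof.
elim/ealg_ind: x => [c u v IHu IHv||j x IHx].
- by rewrite mulrDr -scalerAr IHu IHv linearP mulrDl -scalerAl.
- by rewrite parity1 mul1r mulr1.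
by rewrite gen_gen IHx parity_gen mulNr mulrA.
Qed.

Lemma gen2_comm i j x : gen i * gen j * x = x * (gen i * gen j).
Proof. by rewrite -mulrA (gen_comm j) mulrA (gen_comm i) parityK mulrA. Qed.

End ExteriorAlgebra.

(** * Degrees, one-forms and two-forms *)

Section Grading.
Variables (K : fieldType) (n : nat).
Notation E := (ealg K n).
Implicit Types (x y z : E) (S T : {set 'I_n}) (i j k : 'I_n).

Lemma homogP p c x y : homog p x -> homog p y -> homog p (c *: x + y).
Proof. by move=> hx hy S pS; rewrite !ealgE hx ?hy // mulr0 addr0. Qed.

Lemma homog0v p : homog p (0 : E).
Proof. by move=> S _; rewrite ealgE. Qed.

Lemma homogD p x y : homog p x -> homog p y -> homog p (x + y).
Proof. by rewrite -{2}[x]scale1r; apply: homogP. Qed.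

Lemma homogZ p c x : homog p x -> homog p (c *: x).
Proof. by move=> hx; rewrite -[_ *: _]addr0; apply/homogP/homog0v. Qed.

Lemma homog_sum p (I : Type) (r : seq I) (P : pred I) (F : I -> E) :
  (forall a, P a -> homog p (F a)) -> homog p (\sum_(a <- r | P a) F a).
Proof. by move=> hF; apply: (big_ind (homog p)) => //; [apply: homog0v | apply: homogD]. Qed.

Lemma homogM p q x y : homog p x -> homog q y -> homog (p + q) (x * y).
Proof.
move=> hx hy S pS; rewrite ffunE big1 // => T sTS.
have [pT|/hx->] := eqVneq #|T| p; last by rewrite mulr0 mul0r.
rewrite hy ?mulr0 //; apply: contra pS => /eqP <-.
by rewrite -pT -[X in _ == (X + _)%N](_ : #|S :&: T| = _) ?cardsID //; rewrite (setIidPr sTS).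
Qed.

Lemma homog_gen i : homog 1 (gen K i).
Proof. by move=> S; rewrite ffunE; case: (S =P [set i]) => // ->; rewrite cards1. Qed.

Lemma homog_one : homog 0 (1 : E).
Proof. by move=> S; rewrite ealgE cards_eq0; case: eqP. Qed.

Lemma homog0E x : homog 0 x -> x = x set0 *: 1.
Proof.
move=> hx; apply/ffunP=> S; rewrite !ealgE; case: eqP => [->|/eqP S0]; first by rewrite mulr1.
by rewrite mulr0 hx // cards_eq0.
Qed.

Lemma homog_contract p i x : homog p.+1 x -> homog p (contract i x).
Proof.
move=> hx S pS; rewrite ffunE; case: ifP => // /negbT iS.
by rewrite hx ?mulr0 // cardsU1 iS.
Qed.

Lemma contract_homog0 i x : homog 0 x -> contract i x = 0.
Proof. by move=> /homog0E ->; rewrite linearZ /= contract1 scaler0. Qed.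

Lemma parity_homog p x : homog p x -> parity x = (-1) ^+ p *: x.
Proof.
move=> hx; apply/ffunP=> S; rewrite !(ealgE, ffunE).
by have [->|/hx->] := eqVneq #|S| p; rewrite ?mulr0.
Qed.

(** Each of the [p] indices of a monomial is moved to the front and back with cancelling signs. For
    [p] equal to 1 and 2 this rebuilds a form from its coefficients. *)
Lemma euler_contract p x : homog p x -> \sum_i gen K i * contract i x = p%:R *: x.
Proof.
move=> hx; apply/ffunP=> S; rewrite ealgE ealg_sumE.
under eq_bigr => i _ do rewrite gen_mulE.
rewrite -big_mkcond /= (eq_bigr (fun=> x S)) => [|i iS].
  by rewrite sumr_const; have [->|/hx->] := eqVneq #|S| p; rewrite ?mulr0 ?mul0rn // mulr_natl.
by rewrite ffunE !inE eqxx setD1K // (@nbelowD1 _ i i S) // ltnn addn0 mulrA signsqr mul1r.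
Qed.

Lemma contract_anticomm i j x :
  contract i (contract j x) = - contract j (contract i x).
Proof.
elim/ealg_ind: x => [c u v IHu IHv||k x IHx].
- by rewrite !linearP /= IHu IHv.
- by rewrite !contract1 !linear0.
rewrite !contract_gen !linearB !linearZ /= !contract_gen IHx mulrN.
by rewrite !opprK scalerN opprD [RHS]addrC addrA addrAC.
Qed.

Definition linvec (v : 'rV[K]_n) : E := \sum_i v 0 i *: gen K i.

Lemma linvec_is_linear : linear linvec.
Proof.
move=> c u v; rewrite /linvec scaler_sumr -big_split; apply: eq_bigr => i _ /=.
by rewrite !mxE scalerDl scalerA.
Qed.
HB.instance Definition _ := GRing.isLinear.Build K 'rV[K]_n E _ linvec linvec_is_linear.

Lemma homog_linvec v : homog 1 (linvec v).
Proof. by apply: homog_sum => i _; apply/homogZ/homog_gen. Qed.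

Lemma contract_gen1 i j : contract i (gen K j) = (i == j)%:R *: 1.
Proof. by rewrite -[gen K j]mulr1 contract_gen contract1 mulr0 subr0. Qed.

Lemma contract_linvec i v : contract i (linvec v) = v 0 i *: 1.
Proof.
rewrite linear_sum (bigD1 i) //= big1 => [|j /negPf ji]; rewrite linearZ /= contract_gen1.
  by rewrite eqxx scale1r addr0.
by rewrite eq_sym ji scale0r scaler0.
Qed.

Definition coordv x : 'rV[K]_n := \row_i contract i x set0.

Lemma coordvK v : coordv (linvec v) = v.
Proof. by apply/rowP=> i; rewrite mxE contract_linvec !ealgE eqxx mulr1. Qed.

Lemma linvecK x : homog 1 x -> linvec (coordv x) = x.
Proof.
move=> hx; rewrite -[RHS](scale1r x) -(euler_contract hx); apply: eq_bigr => i _.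
by rewrite mxE (homog0E (homog_contract i hx)) !ealgE eqxx mulr1 -scalerAr mulr1.
Qed.

Lemma linvec_delta i : linvec (delta_mx 0 i) = gen K i.
Proof.
rewrite /linvec (bigD1 i) //= big1 => [|j /negPf ji]; rewrite !mxE eqxx /=.
  by rewrite eqxx scale1r addr0.
by rewrite ji scale0r.
Qed.

Lemma linvec_mul_anticomm u v z : linvec u * (linvec v * z) = - (linvec v * (linvec u * z)).
Proof.
rewrite /linvec !mulr_suml; under eq_bigr => i _ do rewrite mulr_sumr.
under [in RHS]eq_bigr => i _ do rewrite mulr_sumr.
rewrite exchange_big -sumrN; apply: eq_bigr => i _; rewrite -sumrN; apply: eq_bigr => j _ /=.
by rewrite -!scalerAl -!scalerAr gen_gen !scalerN !scalerA mulrC.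
Qed.

(** A skew [M] meets each unordered pair of distinct generators twice, hence the factor one half in
    [mxbivec]. *)
Definition bivec (M : 'M[K]_n) : E := \sum_i gen K i * linvec (row i M).

Lemma bivec_is_linear : linear bivec.
Proof.
move=> c u v; rewrite /bivec scaler_sumr -big_split; apply: eq_bigr => i _ /=.
by rewrite !linearP /= mulrDr -scalerAr.
Qed.
HB.instance Definition _ := GRing.isLinear.Build K 'M[K]_n E _ bivec bivec_is_linear.

Lemma homog_bivec M : homog 2 (bivec M).
Proof. by apply: homog_sum => i _; apply: (@homogM 1 1); [apply: homog_gen | apply: homog_linvec]. Qed.

Lemma bivec_comm M x : bivec M * x = x * bivec M.
Proof.
rewrite mulr_suml mulr_sumr; apply: eq_bigr => i _.
rewrite /linvec !mulr_sumr mulr_suml; apply: eq_bigr => j _.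
by rewrite -!scalerAr -scalerAl gen2_comm.
Qed.

Lemma linvec_sum_gen (M : 'M[K]_n) (u : 'rV_n) : \sum_i u 0 i *: linvec (row i M) = linvec (u *m M).
Proof.
rewrite (mulmx_sum_row u M) linear_sum; apply: eq_bigr => i _.
by rewrite linearZ.
Qed.

Lemma linvecM u v : linvec u * linvec v = bivec (u^T *m v).
Proof.
rewrite {1}/linvec mulr_suml; apply: eq_bigr => i _.
rewrite -scalerAl scalerAr -linearZ /=; congr (_ * linvec _).
by apply/rowP=> j; rewrite !mxE big_ord1 !mxE.
Qed.

Lemma contract_bivec i M : contract i (bivec M) = linvec (row i M - row i M^T).
Proof.
rewrite /bivec linear_sum linearB /=.
under eq_bigr => j _ do rewrite contract_gen contract_linvec -scalerAr mulr1.
rewrite big_split /= sumrN (bigD1 i) //= big1 => [|j /negPf ji]; last first.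
  by rewrite eq_sym ji scale0r.
rewrite eqxx scale1r addr0; congr (_ - _).
by apply: eq_bigr => j _; rewrite !mxE.
Qed.

Hypothesis K2 : (2%:R : K) != 0.

Lemma linvec_sqr v z : linvec v * (linvec v * z) = 0.
Proof.
have /eqP := linvec_mul_anticomm v v z; rewrite -addr_eq0 -mulr2n -scaler_nat.
by rewrite scaler_eq0 (negPf K2) => /eqP.
Qed.

Definition mxbivec x : 'M[K]_n := 2%:R^-1 *: \matrix_(i, j) contract j (contract i x) set0.

Lemma mxbivec_is_linear : linear mxbivec.
Proof.
move=> c u v; apply/matrixP=> i j; rewrite !mxE !linearP /= !ealgE; ring.
Qed.
HB.instance Definition _ := GRing.isLinear.Build K E 'M[K]_n _ mxbivec mxbivec_is_linear.

Lemma mxbivec_anti x : (mxbivec x)^T = - mxbivec x.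
Proof. by apply/matrixP=> i j; rewrite !mxE contract_anticomm ealgE mulrN. Qed.

Lemma mxbivec_bivec M : mxbivec (bivec M) = 2%:R^-1 *: (M - M^T).
Proof.
apply/matrixP=> i j; rewrite !mxE contract_bivec contract_linvec.
by rewrite !mxE !ealgE eqxx mulr1.
Qed.

Lemma bivecK M : M^T = - M -> mxbivec (bivec M) = M.
Proof.
move=> aM; apply/matrixP=> i j; rewrite !mxE contract_bivec contract_linvec aM.
by rewrite !mxE opprK !ealgE eqxx mulr1 -mulr2n -[M i j *+ 2]mulr_natl mulKf.
Qed.

Lemma mxbivecK x : homog 2 x -> bivec (mxbivec x) = x.
Proof.
move=> hx; rewrite /mxbivec linearZ /=.
apply: (canLR (scalerK K2)); rewrite -(euler_contract hx); apply: eq_bigr => i _.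
congr (_ * _); rewrite -[RHS](linvecK (homog_contract i hx)); congr linvec.
by apply/rowP=> j; rewrite !mxE.
Qed.

End Grading.

(** * Algebra endomorphisms induced by linear maps of the generators *)

Section ExtMap.
Variables (K : fieldType) (n : nat).
Notation E := (ealg K n).
Implicit Types (x y z : E) (i j k : 'I_n).

(* The algebra map sending generator [k] to [f k]: splitting [x] as a part free of [e_k]
   plus [e_k * contract k x] makes multiplicativity follow from [contract_gen] alone. *)
Fixpoint mapgen (f : 'I_n -> E) (r : seq 'I_n) (x : E) : E :=
  if r is k :: r' then mapgen f r' x + f k * mapgen f r' (contract k x)
  else x set0 *: 1.

Lemma mapgen_is_linear f r : linear (mapgen f r).
Proof.
elim: r => [|k r IHr] c x y /=; first by rewrite !ealgE scalerDl scalerA.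
by rewrite !IHr linearP IHr mulrDr -scalerAr scalerDr addrACA.
Qed.
HB.instance Definition _ f r := GRing.isLinear.Build K E E _ (mapgen f r) (mapgen_is_linear f r).

Lemma mapgen1 f r : mapgen f r 1 = 1.
Proof.
elim: r => /= [|k r ->]; first by rewrite ealgE eqxx scale1r.
by rewrite contract1 linear0 mulr0 addr0.
Qed.

Lemma mapgen_homog f r p x : (forall i, homog 1 (f i)) -> homog p x -> homog p (mapgen f r x).
Proof.
move=> hf; elim: r p x => [|k r IHr] [|p] x hx /=.
- exact/homogZ/homog_one.
- by rewrite hx ?scale0r ?cards0 //; apply: homog0v.
- by rewrite contract_homog0 // linear0 mulr0 addr0; apply: IHr.
apply: homogD; first exact: IHr.
by apply: (@homogM _ _ 1 p) => //; apply/IHr/homog_contract.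
Qed.

(** The two hypotheses on [f] are the exterior relations for the images: the first moves [f i] past
    the earlier images, the second kills a repeated one. *)
Lemma mapgen_gen f r i x : uniq r ->
    (forall j k z, f j * (f k * z) = - (f k * (f j * z))) ->
    (forall j z, f j * (f j * z) = 0) ->
  mapgen f r (gen K i * x) = if i \in r then f i * mapgen f r x else 0.
Proof.
move=> + fC f0; elim: r x => [|k r IHr] x /=.
  by rewrite gen_mulE inE scale0r.
move=> /andP[kr ur]; rewrite in_cons contract_gen linearB linearZ /= !IHr //.
have [->|nik] := eqVneq i k; rewrite /= ?eqxx.
  by rewrite (negPf kr) add0r scale1r subr0 mulrDr f0 addr0.
rewrite scale0r sub0r.
case: ifP => _; last by rewrite oppr0 mulr0 addr0.
by rewrite mulrN mulrDr; congr (_ + _); rewrite [RHS]fC.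
Qed.

Definition extmap (g : 'M[K]_n) : E -> E := mapgen (fun i => linvec (row i g)) (enum 'I_n).
HB.instance Definition _ g := GRing.Linear.copy (extmap g) (mapgen (fun i => linvec (row i g)) (enum 'I_n)).

Lemma extmap1 g : extmap g 1 = 1. Proof. exact: mapgen1. Qed.

Lemma extmapP g c x y : extmap g (c *: x + y) = c *: extmap g x + extmap g y.
Proof. exact: linearP. Qed.

Lemma extmapB g x y : extmap g (x - y) = extmap g x - extmap g y.
Proof. exact: linearB. Qed.

Lemma extmap_homog g p x : homog p x -> homog p (extmap g x).
Proof. by apply: mapgen_homog => i; apply: homog_linvec. Qed.

Hypothesis K2 : (2%:R : K) != 0.

Lemma extmap_gen g i x : extmap g (gen K i * x) = linvec (row i g) * extmap g x.
Proof.
rewrite /extmap mapgen_gen ?enum_uniq ?mem_enum // => *; [exact: linvec_mul_anticomm|exact: linvec_sqr].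
Qed.

Lemma extmapM g x y : extmap g (x * y) = extmap g x * extmap g y.
Proof.
elim/ealg_ind: x => [c u v IHu IHv||i x IHx].
- by rewrite mulrDl -scalerAl !linearP /= IHu IHv mulrDl -scalerAl.
- by rewrite extmap1 !mul1r.
by rewrite -mulrA !extmap_gen IHx mulrA.
Qed.

Lemma extmap_gen1 g i : extmap g (gen K i) = linvec (row i g).
Proof. by rewrite -[gen K i]mulr1 extmap_gen extmap1 mulr1. Qed.

Lemma extmap_linvec g v : extmap g (linvec v) = linvec (v *m g).
Proof.
rewrite -linvec_sum_gen linear_sum; apply: eq_bigr => i _.
by rewrite linearZ /= extmap_gen1.
Qed.

Lemma extmap_bivec g M : extmap g (bivec M) = bivec (g^T *m M *m g).
Proof.
rewrite linear_sum; under eq_bigr => i _ do rewrite /= extmapM extmap_gen1 extmap_linvec linvecM.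
rewrite -linear_sum; congr bivec.
apply/matrixP=> a b; rewrite summxE -mulmxA !mxE; apply: eq_bigr => i _.
by rewrite !mxE big_ord1 -row_mul !mxE.
Qed.

Lemma extmap_comp g h x : extmap h (extmap g x) = extmap (g *m h) x.
Proof.
elim/ealg_ind: x => [c u v IHu IHv||i x IHx].
- by rewrite !linearP /= IHu IHv.
- by rewrite !extmap1.
by rewrite !extmapM IHx !extmap_gen1 extmap_linvec row_mul.
Qed.

Lemma extmap_id x : extmap 1%:M x = x.
Proof.
elim/ealg_ind: x => [c u v IHu IHv||i x IHx].
- by rewrite !linearP /= IHu IHv.
- by rewrite !extmap1.
by rewrite extmap_gen IHx row1 linvec_delta.
Qed.

End ExtMap.

(** * Differentials determined by degree one *)

Section Differentials.
Variables (K : fieldType) (n : nat).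
Hypothesis K2 : (2%:R : K) != 0.
Notation E := (ealg K n).
Implicit Types (x y z : E) (D : E -> E).

Definition diffmx D (i : 'I_n) : 'M[K]_n := mxbivec (D (gen K i)).

Definition diffmxv D (v : 'rV[K]_n) : 'M[K]_n := \sum_i v 0 i *: diffmx D i.

Lemma diffmx_anti D i : (diffmx D i)^T = - diffmx D i.
Proof. exact: mxbivec_anti. Qed.

Lemma diffmxv_anti D v : (diffmxv D v)^T = - diffmxv D v.
Proof.
rewrite /diffmxv linear_sum -sumrN; apply: eq_bigr => i _.
by rewrite linearZ /= diffmx_anti scalerN.
Qed.

Lemma diffmxv_is_linear D : linear (diffmxv D).
Proof.
move=> c u v; rewrite /diffmxv scaler_sumr -big_split; apply: eq_bigr => i _ /=.
by rewrite !mxE scalerDl scalerA.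
Qed.
HB.instance Definition _ D := GRing.isLinear.Build K 'rV[K]_n 'M[K]_n _ (diffmxv D) (diffmxv_is_linear D).

Section Given.
Variable D : E -> E.
Hypothesis cD : is_cdga_diff D.

Lemma diffP c x y : D (c *: x + y) = c *: D x + D y.
Proof. by case: cD => lD _ _ _; apply: lD. Qed.

Lemma diff_homog p x : homog p x -> homog p.+1 (D x).
Proof. by case: cD => _ hD _ _; apply: hD. Qed.

Lemma diff_sum (I : Type) (r : seq I) (P : pred I) (F : I -> E) :
  D (\sum_(a <- r | P a) F a) = \sum_(a <- r | P a) D (F a).
Proof.
apply: (big_morph D) => [u v|]; first by rewrite -[u]scale1r diffP !scale1r.
by rewrite -[0 in LHS](addNr (0 : E)) -scaleN1r diffP scaleN1r addNr.
Qed.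

Lemma diffZ c x : D (c *: x) = c *: D x.
Proof.
have D0 : D 0 = 0 by have := @diff_sum nat [::] xpredT (fun=> 0); rewrite !big_nil.
by rewrite -[_ *: _]addr0 diffP D0 addr0.
Qed.

Lemma diff_leibniz1 v y : D (linvec v * y) = D (linvec v) * y - linvec v * D y.
Proof.
case: cD => _ _ lD _; rewrite -scaleN1r -[-1]expr1; apply: (lD 1%N).
exact: homog_linvec.
Qed.

Lemma diff_one : D 1 = 0.
Proof.
have /esym/eqP : D (1 * 1) = D 1 * 1 + (-1) ^+ 0 *: (1 * D 1).
  by case: cD => _ _ lD _; apply/lD/homog_one.
by rewrite expr0 scale1r !mulr1 mul1r -subr_eq0 addrK => /eqP.
Qed.

Lemma diff_linvec v : D (linvec v) = bivec (diffmxv D v).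
Proof.
rewrite /linvec diff_sum linear_sum; apply: eq_bigr => i _.
by rewrite diffZ linearZ /= /diffmx mxbivecK //; apply/diff_homog/homog_gen.
Qed.

End Given.

(** Degree one generates, so an isomorphism is its matrix [g] on one-forms, and compatibility with
    the differentials is tested on one-forms only, where it is a congruence. *)
Lemma cdga_iso_mxP D1 D2 : is_cdga_diff D1 -> is_cdga_diff D2 ->
  cdga_iso D1 D2 <->
  exists2 g : 'M[K]_n, g \in unitmx &
    forall v, g^T *m diffmxv D1 v *m g = diffmxv D2 (v *m g).
Proof.
move=> c1 c2; split=> [[phi [lphi [bij_phi _] Mphi hphi Dphi]]|[g ug hg]].
  (* The hypotheses are restated with the ring and module operations of [ealg], which are
     convertible to [wedge] and [escale]. *)
  move: phi lphi bij_phi Mphi hphi Dphi.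
  change (forall phi : E -> E, (forall c x y, phi (c *: x + y) = c *: phi x + phi y) ->
    bijective phi -> (forall x y, phi (x * y) = phi x * phi y) ->
    (forall p x, homog p x -> homog p (phi x)) ->
    (forall x, phi (D1 x) = D2 (phi x)) ->
    exists2 g : 'M[K]_n, g \in unitmx &
      forall v, g^T *m diffmxv D1 v *m g = diffmxv D2 (v *m g)).
  move=> phi lphi bij_phi Mphi hphi Dphi.
  pose g : 'M[K]_n := \matrix_i coordv (phi (gen K i)).
  have phi0 : phi 0 = 0.
    by rewrite -[0 in LHS](addNr (0 : E)) -scaleN1r lphi scaleN1r addNr.
  have phiZ c x : phi (c *: x) = c *: phi x.
    by rewrite -[_ *: _]addr0 lphi phi0 addr0.
  have phiS (I : finType) (F : I -> E) : phi (\sum_i F i) = \sum_i phi (F i).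
    by apply: (big_morph phi) => // u v; rewrite -[u]scale1r lphi !scale1r.
  have phig i : phi (gen K i) = linvec (row i g).
    by rewrite rowK linvecK //; apply/hphi/homog_gen.
  have phiv v : phi (linvec v) = linvec (v *m g).
    by rewrite -linvec_sum_gen phiS; apply: eq_bigr => i _; rewrite phiZ phig.
  have phif M : phi (bivec M) = bivec (g^T *m M *m g).
    rewrite -extmap_bivec // /bivec phiS linear_sum; apply: eq_bigr => i _.
    by rewrite Mphi phig phiv /= extmapM // extmap_gen1 // extmap_linvec.
  exists g.
    (* A row of the kernel of [g] is a one-form that [phi] sends to zero. *)
    rewrite -row_free_unit -kermx_eq0; apply/eqP/row_matrixP=> i; rewrite row0.
    have := mulmx_ker g; move/(congr1 (row i)); rewrite row_mul row0.
    move: (row i _) => v vg; apply: (can_inj (@coordvK K n)).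
    by apply: (bij_inj bij_phi); rewrite phiv vg !linear0 phi0.
  move=> v; have aM M : M^T = - M -> (g^T *m M *m g)^T = - (g^T *m M *m g).
    by move=> aM; rewrite !trmx_mul trmxK aM mulNmx mulmxN mulmxA.
  rewrite -[LHS](bivecK K2); last by rewrite aM // diffmxv_anti.
  by rewrite -phif -diff_linvec // Dphi phiv diff_linvec // bivecK // diffmxv_anti.
exists (extmap g); split.
- by move=> c x y; apply: linearP.
- split; last exact: extmap1.
  exists (extmap (invmx g)) => x; rewrite extmap_comp //.
    by rewrite mulmxV // extmap_id.
  by rewrite mulVmx // extmap_id.
- by move=> x y; apply: extmapM.
- by move=> p x; apply: extmap_homog.
elim/ealg_ind => [c u v IHu IHv||i x IHx].
- by rewrite (diffP c1) !extmapP (diffP c2) IHu IHv.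
- by rewrite extmap1 !diff_one // linear0.
rewrite -linvec_delta (extmapM K2) (extmap_linvec K2) (diff_leibniz1 c1) (diff_leibniz1 c2).
rewrite extmapB !(extmapM K2) IHx (extmap_linvec K2).
by rewrite (diff_linvec c1) (extmap_bivec K2) hg (diff_linvec c2).
Qed.

(* The contractions are antiderivations and two-forms are central, so this is the derivation
   with [d e_k = bivec (c k)]. *)
Definition quadder (c : 'I_n -> 'M[K]_n) x : E := \sum_k bivec (c k) * contract k x.

Lemma quadder_is_linear c : linear (quadder c).
Proof.
move=> a x y; rewrite /quadder scaler_sumr -big_split; apply: eq_bigr => k _ /=.
by rewrite linearP /= mulrDr -scalerAr.
Qed.
HB.instance Definition _ c := GRing.isLinear.Build K E E _ (quadder c) (quadder_is_linear c).

Lemma quadderM c x y : quadder c (x * y) = quadder c x * y + parity x * quadder c y.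
Proof.
rewrite /quadder mulr_suml mulr_sumr -big_split; apply: eq_bigr => k _ /=.
by rewrite contract_mul mulrDr mulrA; congr (_ + _); rewrite mulrA bivec_comm mulrA.
Qed.

Lemma quadder_linvec c v : quadder c (linvec v) = bivec (\sum_k v 0 k *: c k).
Proof.
rewrite /quadder linear_sum; apply: eq_bigr => k _.
by rewrite contract_linvec -scalerAr mulr1 linearZ.
Qed.

(** The hypothesis removes the terms in which a contraction hits a coefficient. The rest of the
    square pairs products of two-forms, symmetric in [k] and [l], with anticommuting contractions,
    so it equals its own negative. *)
Lemma quadder_cdga c :
    (forall k l, bivec (c k) * contract k (bivec (c l)) = 0) ->
  is_cdga_diff (quadder c).
Proof.
move=> hc; split.
- by move=> a x y; apply: linearP.
- case=> [|p] x hx; rewrite /quadder.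
    by rewrite big1 => [|k _]; [apply: homog0v | rewrite contract_homog0 // mulr0].
  by apply: homog_sum => k _; apply: (@homogM _ _ 2 p); [apply: homog_bivec | apply: homog_contract].
- move=> p x y hx; have := quadderM c x y; rewrite (parity_homog hx) => ->.
  by rewrite -scalerAl.
move=> x; rewrite {1}/quadder.
have -> : \sum_k bivec (c k) * contract k (quadder c x) =
    \sum_k \sum_l bivec (c k) * bivec (c l) * contract k (contract l x).
  apply: eq_bigr => k _; rewrite /quadder linear_sum mulr_sumr; apply: eq_bigr => l _ /=.
  rewrite contract_mul mulrDr !mulrA hc mul0r add0r.
  by rewrite (parity_homog (homog_bivec (c l))) sqrrN expr1n scale1r.
apply/eqP; set S := \sum_k _; suff /eqP : S = - S.
  by rewrite -addr_eq0 -mulr2n -scaler_nat scaler_eq0 (negPf K2).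
rewrite {1}/S exchange_big /= -sumrN; apply: eq_bigr => k _; rewrite -sumrN; apply: eq_bigr => l _.
by rewrite contract_anticomm mulrN bivec_comm.
Qed.

Lemma diffmxv_quadder c v : (forall k, (c k)^T = - c k) ->
  diffmxv (quadder c) v = \sum_k v 0 k *: c k.
Proof.
move=> aC; apply: eq_bigr => k _; congr (_ *: _).
rewrite /diffmx -linvec_delta quadder_linvec bivecK //.
  rewrite (bigD1 k) //= big1 => [|l /negPf lk]; rewrite !mxE eqxx /=.
    by rewrite eqxx scale1r addr0.
  by rewrite lk scale0r.
rewrite linear_sum -sumrN; apply: eq_bigr => l _.
by rewrite linearZ /= aC scalerN.
Qed.

End Differentials.

(** * Reduction to systems of alternating matrices *)

Section Systems.
Variable K : fieldType.

Definition comb (p q : nat) (M : 'I_q -> 'M[K]_p) (w : 'rV[K]_q) : 'M[K]_p :=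
  \sum_k w 0 k *: M k.
Definition anti (p q : nat) (M : 'I_q -> 'M[K]_p) := forall k, (M k)^T = - M k.
Definition tfree (p q : nat) (M : 'I_q -> 'M[K]_p) := forall w, comb M w = 0 -> w = 0.
(** [P] changes the basis of [W_0] and [h] the basis of the span [U]. *)
Definition teq (p q : nat) (M N : 'I_q -> 'M[K]_p) :=
  exists P h, [/\ P \in unitmx, h \in unitmx &
    forall w, P *m comb M w *m P^T = comb N (w *m h)].

Lemma comb_is_linear p q (M : 'I_q -> 'M[K]_p) : linear (comb M).
Proof.
move=> c u v; rewrite /comb scaler_sumr -big_split; apply: eq_bigr => i _ /=.
by rewrite !mxE scalerDl scalerA.
Qed.
HB.instance Definition _ p q (M : 'I_q -> 'M[K]_p) :=
  GRing.isLinear.Build K 'rV[K]_q 'M[K]_p _ (comb M) (comb_is_linear M).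

Lemma comb_delta p q (M : 'I_q -> 'M[K]_p) k : comb M (delta_mx 0 k) = M k.
Proof.
rewrite /comb (bigD1 k) //= big1 => [|l /negPf lk]; rewrite !mxE eqxx /=.
  by rewrite eqxx scale1r addr0.
by rewrite lk scale0r.
Qed.

Lemma comb_anti p q (M : 'I_q -> 'M[K]_p) w : anti M -> (comb M w)^T = - comb M w.
Proof.
move=> aM; rewrite /comb linear_sum -sumrN; apply: eq_bigr => i _.
by rewrite linearZ /= aM scalerN.
Qed.

Lemma teq_sym p q (M N : 'I_q -> 'M[K]_p) : teq M N -> teq N M.
Proof.
case=> P [h [uP uh PM]]; exists (invmx P), (invmx h); rewrite !unitmx_inv; split=> // w.
rewrite -{1}[w](mulmxKV uh) -PM trmx_inv -!mulmxA mulKmx //.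
by rewrite mulmxV ?unitmx_tr // mulmx1.
Qed.

Lemma teq_trans p q (M N L : 'I_q -> 'M[K]_p) : teq M N -> teq N L -> teq M L.
Proof.
case=> P [h [uP uh PM]] [Q [l [uQ ul QN]]]; exists (Q *m P), (h *m l).
rewrite !unitmx_mul uP uh uQ ul; split=> // w.
by rewrite trmx_mul !mulmxA -QN -PM !mulmxA.
Qed.

Lemma teq_free p q (M N : 'I_q -> 'M[K]_p) : teq M N -> tfree M -> tfree N.
Proof.
move=> /teq_sym[P [h [uP uh PN]]] fM w Nw0.
have := PN w; rewrite Nw0 mulmx0 mul0mx => /esym/fM wh0.
by rewrite -(mulmxK uh w) wh0 mul0mx.
Qed.

(** The algebra of a system: the first [p] generators are closed, and the last [q] have
    differentials that involve only the first [p]. *)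
Definition stdmx (p q : nat) (M : 'I_q -> 'M[K]_p) (i : 'I_(p + q)) : 'M[K]_(p + q) :=
  if split i is inr k then block_mx (M k) 0 0 0 else 0.
Definition stdD (p q : nat) (M : 'I_q -> 'M[K]_p) : ealg K (p + q) -> ealg K (p + q) :=
  quadder (stdmx M).

Lemma stdmx_lshift p q (M : 'I_q -> 'M[K]_p) i : stdmx M (lshift q i) = 0.
Proof. by rewrite /stdmx -[lshift q i]/(unsplit (inl i)) unsplitK. Qed.
Lemma stdmx_rshift p q (M : 'I_q -> 'M[K]_p) i :
  stdmx M (rshift p i) = block_mx (M i) 0 0 0.
Proof. by rewrite /stdmx -[rshift p i]/(unsplit (inr i)) unsplitK. Qed.

Lemma stdmx_anti p q (M : 'I_q -> 'M[K]_p) : anti M -> anti (stdmx M).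
Proof.
move=> aM i; rewrite /stdmx; case: split => k; first by rewrite trmx0 oppr0.
by rewrite tr_block_mx !trmx0 aM opp_block_mx !oppr0.
Qed.

Lemma comb_stdmx p q (M : 'I_q -> 'M[K]_p) (v : 'rV_(p + q)) :
  comb (stdmx M) v = block_mx (comb M (rsubmx v)) 0 0 0.
Proof.
rewrite /comb big_split_ord /= big1 => [|i _]; last by rewrite stdmx_lshift scaler0.
rewrite add0r.
transitivity (\sum_k (rsubmx v) 0 k *: block_mx (M k) 0 0 0 : 'M[K]_(p + q)).
  by apply: eq_bigr => k _; rewrite stdmx_rshift !mxE.
apply: (big_rec2 (fun x y => y = block_mx x 0 0 0)); first by rewrite block_mx0.
by move=> k x y _ ->; rewrite scale_block_mx add_block_mx !scaler0 !addr0.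
Qed.

Lemma row_stdmx p q (M : 'I_q -> 'M[K]_p) l (a : 'I_q) : row (rshift p a) (stdmx M l) = 0.
Proof. by rewrite /stdmx; case: split => b; rewrite ?row0 // block_mxEv rowKd row_mx0 row0. Qed.

Hypothesis K2 : (2%:R : K) != 0.

Section Std.
Variables (p q : nat) (M : 'I_q -> 'M[K]_p).
Hypothesis aM : anti M.
Notation E := (ealg K (p + q)).

(** Only contractions along the last [q] generators meet a nonzero coefficient, and these kill every
    two-form supported on the first block. *)
Lemma stdD_cdga : is_cdga_diff (stdD M).
Proof.
apply: quadder_cdga => // k l; rewrite -[k]splitK; case: (split k) => a /=.
  by rewrite stdmx_lshift linear0 mul0r.
rewrite contract_bivec stdmx_anti // [row _ (- _)]linearN /= row_stdmx.
by rewrite !oppr0 addr0 linear0 mulr0.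
Qed.


Lemma stdD_linvec v : stdD M (linvec v) = bivec (block_mx (comb M (rsubmx v)) 0 0 0).
Proof. by rewrite /stdD quadder_linvec -[\sum_k _]/(comb _ _) comb_stdmx. Qed.

Lemma bivecE n (X : 'M[K]_n) :
  bivec X = \sum_a \sum_b X a b *: (gen K a * gen K b).
Proof.
apply: eq_bigr => a _; rewrite /linvec mulr_sumr; apply: eq_bigr => b _.
by rewrite !mxE scalerAr.
Qed.

(** The numbering of the generators is already a suitable order, the closed ones coming first. *)
Lemma stdD_minimal : is_minimal (stdD M).
Proof.
exists (@gen K _); split.
- exact: homog_gen.
- move=> c.
  have -> : \sum_i escale (c i) (gen K i) = linvec (\row_i c i).
    by apply: eq_bigr => i _; rewrite !mxE.
  move/(congr1 (@coordv K _)); rewrite coordvK => /rowP + i => /(_ i).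
  by rewrite !mxE linear0 ealgE.
- move=> v hv; exists (fun i => coordv (v : E) 0 i).
  by rewrite -{1}(linvecK hv).
move=> i; exists (fun a b => stdmx M i a b).
rewrite -linvec_delta /stdD quadder_linvec -[\sum_k _]/(comb _ _) comb_delta bivecE.
have st0 (a b : 'I_(p + q)) : ~~ ((a < i)%N && (b < i)%N) -> stdmx M i a b = 0.
  rewrite -{1 2}[i]splitK -[a]splitK -[b]splitK /stdmx; case: (split i) => k /=.
    by rewrite mxE.
  case: (split a) => a'; case: (split b) => b' /=; rewrite ?block_mxEul ?block_mxEur
    ?block_mxEdl ?block_mxEdr ?mxE //.
  by rewrite !(leq_trans (ltn_ord _)) ?leq_addr.
rewrite [RHS]big_mkcond /=; apply: eq_bigr => a _; case: ifP => ai.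
  rewrite [RHS]big_mkcond /=; apply: eq_bigr => b _; case: ifP => bi //.
  by rewrite st0 ?scale0r // ai bi.
by rewrite big1 // => b _; rewrite st0 ?scale0r // ai.
Qed.

Lemma stdD_length2 : (exists k, M k != 0) -> filt_length2 (stdD M).
Proof.
move=> [k Mk]; split.
  exists (gen K (rshift p k)); split; first exact: homog_gen.
  rewrite -linvec_delta /stdD quadder_linvec -[\sum_k _]/(comb _ _) comb_delta stdmx_rshift.
  move/(congr1 (@mxbivec K _)); rewrite bivecK //.
    rewrite linear0 -block_mx0 => /eq_block_mx[Mk0 _ _ _].
    by move: Mk; rewrite Mk0 eqxx.
  by have := stdmx_anti aM (rshift p k); rewrite stdmx_rshift.
move=> v hv.
have W0l (u : 'rV_(p + q)) : rsubmx u = 0 -> W0 (stdD M) (linvec u).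
  move=> u0; split; first exact: homog_linvec.
  by rewrite stdD_linvec u0 linear0 block_mx0 linear0.
exists p, (fun i => gen K (lshift q i)).
exists (fun i => linvec (row (lshift q i) (block_mx (comb M (rsubmx (coordv (v : E)))) 0 0 0))).
split=> [i|].
  rewrite -linvec_delta; split; apply: W0l.
    by apply/rowP=> j; rewrite !mxE eq_rlshift.
  by rewrite block_mxEv rowKu row_row_mx row_mxKr row0.
rewrite -{1}(linvecK hv) stdD_linvec /bivec big_split_ord /= [X in _ + X]big1 ?addr0 // => i _.
by rewrite block_mxEv rowKd row_mx0 row0 linear0 mulr0.
Qed.

Lemma diffmxv_stdD v : diffmxv (stdD M) v = block_mx (comb M (rsubmx v)) 0 0 0.
Proof. by rewrite /stdD diffmxv_quadder //; [apply: comb_stdmx | apply: stdmx_anti]. Qed.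

End Std.

Lemma tr_congr m r (Y : 'M[K]_(r, m)) X : (Y^T *m X *m Y)^T = Y^T *m X^T *m Y.
Proof. by rewrite !trmx_mul trmxK mulmxA. Qed.

Lemma block_congr p q (A : 'M[K]_p) (B : 'M[K]_q) (C : 'M[K]_(q, p)) (X : 'M[K]_p) :
  (block_mx A 0 C B)^T *m block_mx X 0 0 0 *m block_mx A 0 C B = block_mx (A^T *m X *m A) 0 0 0.
Proof. by rewrite tr_block_mx !mulmx_block !trmx0 !(mulmx0, mul0mx, addr0, add0r). Qed.

Lemma teq_iso p q (M N : 'I_q -> 'M[K]_p) : anti M -> anti N ->
  teq M N -> cdga_iso (stdD M) (stdD N).
Proof.
move=> aM aN [P [h [uP uh PM]]].
apply/(cdga_iso_mxP K2 (stdD_cdga aM) (stdD_cdga aN)).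
exists (block_mx P^T 0 0 h) => [|v].
  by rewrite unitmxE det_ublock unitrM -!unitmxE unitmx_tr uP uh.
rewrite !diffmxv_stdD // block_congr trmxK PM; congr (block_mx (comb _ _) _ _ _).
rewrite -[v in RHS]hsubmxK mul_row_block row_mxKr mulmx0 add0r //.
Qed.

(** Since [N] is free, the first [p] coordinates are the whole kernel of [stdD N] in degree one.
    Hence [g] is block triangular, and its diagonal blocks give [P] and [h]. *)
Lemma iso_teq p q (M N : 'I_q -> 'M[K]_p) : anti M -> anti N -> tfree N ->
  cdga_iso (stdD M) (stdD N) -> teq M N.
Proof.
move=> aM aN fN /(cdga_iso_mxP K2 (stdD_cdga aM) (stdD_cdga aN))[g ug hg].
have g0 : ursubmx g = 0.
  apply/row_matrixP=> i; rewrite row0; apply: fN.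
  have := hg (row_mx (delta_mx 0 i) 0); rewrite !diffmxv_stdD // row_mxKr linear0 block_mx0.
  rewrite mulmx0 mul0mx -[g in row_mx _ _ *m g]submxK mul_row_block !mul0mx !addr0 row_mxKr.
  by rewrite -rowE -block_mx0 => /eq_block_mx[].
rewrite -[g]submxK g0 in ug hg.
exists (ulsubmx g)^T, (drsubmx g).
move: ug; rewrite [block_mx _ _ _ _ \in _]unitmxE det_lblock unitrM -!unitmxE unitmx_tr => /andP[-> ->]; split=> // w.
have := hg (row_mx 0 w); rewrite !diffmxv_stdD // block_congr row_mxKr trmxK.
by rewrite mul_row_block !mul0mx !add0r row_mxKr => /eq_block_mx[].
Qed.

Section Kernel.
Variable n : nat.
Implicit Type D : ealg K n -> ealg K n.

(** [W_0] in coordinates; its rank is the invariant [p]. *)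
Definition diffker D : 'M[K]_n := kermx (lin1_mx (mxvec \o diffmxv D)).

Lemma sub_diffker D m (v : 'M[K]_(m, n)) :
  (v <= diffker D)%MS = [forall i, diffmxv D (row i v) == 0].
Proof.
rewrite (sameP row_subP forallP); apply: eq_forallb => i.
rewrite sub_kermx mul_rV_lin1 /=; apply/eqP/eqP => [|->]; last by rewrite linear0.
by move/(congr1 vec_mx); rewrite mxvecK linear0.
Qed.

Lemma iso_diffker D1 D2 : is_cdga_diff D1 -> is_cdga_diff D2 -> cdga_iso D1 D2 ->
  \rank (diffker D1) = \rank (diffker D2).
Proof.
move=> c1 c2 /(cdga_iso_mxP K2 c1 c2)[g ug hg]; apply/eqP; rewrite eqn_leq; apply/andP; split.
  rewrite -(mxrankMfree _ (_ : row_free g)) ?row_free_unit //.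
  apply: mxrankS; rewrite sub_diffker; apply/forallP=> i; rewrite row_mul -hg.
  have := submx_refl (diffker D1); rewrite sub_diffker => /forallP/(_ i)/eqP->.
  by rewrite mulmx0 mul0mx.
rewrite -(mxrankMfree _ (_ : row_free (invmx g))) ?row_free_unit ?unitmx_inv //.
apply: mxrankS; rewrite sub_diffker; apply/forallP=> i; rewrite row_mul.
have := submx_refl (diffker D2); rewrite sub_diffker => /forallP/(_ i)/eqP.
move: (row i _) => v v0; have := hg (v *m invmx g); rewrite mulmxKV // v0.
move/(congr1 (fun X => (invmx g)^T *m X *m invmx g)).
rewrite mulmx0 mul0mx -!mulmxA mulmxV // mulmx1 mulmxA -trmx_mul mulmxV // trmx1 mul1mx.
by move/eqP.
Qed.

End Kernel.

Lemma diffker_stdD p q (M : 'I_q -> 'M[K]_p) : anti M -> tfree M ->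
  \rank (diffker (stdD M)) = p.
Proof.
move=> aM fM; rewrite -[RHS](mxrank1 K p) -(rank_row_mx0 q (1%:M : 'M[K]_p)).
apply/eqmx_rank/andP; split.
  apply/row_subP=> i; have := submx_refl (diffker (stdD M)).
  rewrite sub_diffker => /forallP/(_ i)/eqP; rewrite diffmxv_stdD // -block_mx0 => /eq_block_mx[+ _ _ _].
  move/fM=> v0; apply/submxP; exists (lsubmx (row i (diffker (stdD M)))).
  by rewrite mul_mx_row mulmx1 mulmx0 -{1}[row i _]hsubmxK v0.
rewrite sub_diffker; apply/forallP=> i.
by rewrite row_row_mx row0 diffmxv_stdD // row_mxKr linear0 block_mx0.
Qed.

(** A basis of [W_0] is completed to one of [V]. Length 2 puts every differential in the second
    exterior power of [W_0], so it is given by a matrix in the basis [Z]. *)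
Lemma std_reduction n (D : ealg K n -> ealg K n) : is_cdga_diff D -> filt_length2 D ->
  exists p q (M : 'I_q -> 'M[K]_p) (G : 'M[K]_(p + q, n)),
    [/\ (p + q)%N = n, row_free G, anti M, tfree M &
        forall v, diffmxv D (v *m G) = G^T *m block_mx (comb M (rsubmx v)) 0 0 0 *m G].
Proof.
move=> cD [_ hW].
pose Z := row_base (diffker D); pose C := row_base (diffker D)^C%MS.
have kerZ (a : 'rV_(\rank (diffker D))) : diffmxv D (a *m Z) = 0.
  have : (a *m Z <= diffker D)%MS by rewrite (submx_trans (submxMl _ _)) // eq_row_base.
  by rewrite sub_diffker => /forallP/(_ 0); rewrite row_id => /eqP.
have inZ (x : ealg K n) : W0 D x -> exists a, x = linvec (a *m Z).
  move=> [hx Dx]; have : (coordv x <= Z)%MS.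
    rewrite eq_row_base sub_diffker; apply/forallP=> i; rewrite row_id.
    have := diff_linvec K2 cD (coordv x); rewrite linvecK // Dx => /esym/(congr1 (@mxbivec K n)).
    by rewrite bivecK // ?diffmxv_anti // linear0 => ->.
  by case/submxP=> a e; exists a; rewrite -e linvecK.
have decomp v : exists N : 'M[K]_(\rank (diffker D)), N^T = - N /\ diffmxv D v = Z^T *m N *m Z.
  have [m [w [w' [hw Dv]]]] := hW (linvec v) (homog_linvec v).
  have /fin_all_exists[a ha] i := inZ _ (proj1 (hw i)).
  have /fin_all_exists[b hb] i := inZ _ (proj2 (hw i)).
  pose B := \sum_i (a i)^T *m b i.
  have DvE : D (linvec v) = bivec (Z^T *m B *m Z).
    rewrite Dv /B mulmx_sumr mulmx_suml linear_sum; apply: eq_bigr => i _.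
    rewrite -[wedge _ _]/((w i : ealg K n) * w' i) ha hb linvecM trmx_mul.
    by rewrite !mulmxA.
  (* [B] defines the same two-form as its skew part. *)
  exists (2%:R^-1 *: (B - B^T)); split.
    by rewrite linearZ linearB /= trmxK -scalerN opprB.
  have := diff_linvec K2 cD v; rewrite DvE => /esym/(congr1 (@mxbivec K n)).
  rewrite bivecK ?diffmxv_anti // => ->.
  rewrite mxbivec_bivec -scalemxAr -scalemxAl mulmxBr mulmxBl.
  by rewrite tr_congr.
have /fin_all_exists[N hN] k := decomp (row k C).
exists (\rank (diffker D)), (\rank (diffker D)^C%MS), N, (col_mx Z C).
have Grank : \rank (col_mx Z C) = n.
  rewrite -addsmxE -[RHS](mxrank1 K n); apply/eqmx_rank; rewrite submx1 /= (adds_eqmx (eq_row_base _) (eq_row_base _)).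
  by rewrite sub1mx addsmx_compl_full.
have pq : (\rank (diffker D) + \rank (diffker D)^C%MS)%N = n.
  by rewrite mxrank_compl subnKC // rank_leq_row.
have Gfree : row_free (col_mx Z C) by rewrite /row_free Grank pq.
have GN v : diffmxv D (v *m col_mx Z C) =
    (col_mx Z C)^T *m block_mx (comb N (rsubmx v)) 0 0 0 *m col_mx Z C.
  rewrite -{1}[v]hsubmxK mul_row_col linearD /= kerZ add0r.
  rewrite tr_col_mx mul_row_block !mulmx0 !addr0 mul_row_col mul0mx addr0.
  rewrite (mulmx_sum_row _ C) linear_sum /comb mulmx_sumr mulmx_suml; apply: eq_bigr => k _.
  by rewrite linearZ /= (proj2 (hN k)) -scalemxAr -scalemxAl.
split=> // [k|w Nw]; first exact: (proj1 (hN k)).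
(* A vanishing combination of the [N k] would put a combination of the complementary rows [C] into
   [W_0]. *)
have : (row_mx 0 w *m col_mx Z C <= diffker D)%MS.
  by rewrite sub_diffker; apply/forallP=> i; rewrite row_id GN row_mxKr Nw block_mx0 mulmx0 mul0mx.
rewrite -(eq_row_base (diffker D)) -/Z => /submxP[a].
have -> : a *m Z = row_mx a 0 *m col_mx Z C by rewrite mul_row_col mul0mx addr0.
by move/(row_free_inj Gfree)/eq_row_mx => [].
Qed.

End Systems.

(** * Explicit alternating matrices and the polarised Pfaffian *)

(** With lists of rows, products, transposes and determinants of explicit matrices compute down to
    scalar identities for [ring] and [field]. *)
Definition mxl (K : fieldType) (p : nat) (s : seq (seq K)) : 'M[K]_p :=
  \matrix_(i, j) nth 0 (nth [::] s i) j.

Definition alt4 (K : fieldType) (a01 a02 a03 a12 a13 a23 : K) : 'M[K]_4 :=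
  mxl 4 [:: [:: 0; a01; a02; a03]; [:: - a01; 0; a12; a13];
            [:: - a02; - a12; 0; a23]; [:: - a03; - a13; - a23; 0]].

Definition alt5 (K : fieldType) (a01 a02 a03 a04 a12 a13 a14 a23 a24 a34 : K) : 'M[K]_5 :=
  mxl 5 [:: [:: 0; a01; a02; a03; a04]; [:: - a01; 0; a12; a13; a14];
            [:: - a02; - a12; 0; a23; a24]; [:: - a03; - a13; - a23; 0; a34];
            [:: - a04; - a14; - a24; - a34; 0]].


Section ListMatrices.
Variable K : fieldType.
Implicit Types s t : seq (seq K).

Lemma mxlM p s t : mxl p s *m mxl p t =
  mxl p (mkseq (fun i => mkseq (fun j =>
    foldr +%R 0 (mkseq (fun k => nth 0 (nth [::] s i) k * nth 0 (nth [::] t k) j) p)) p) p).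
Proof.
apply/matrixP=> i j; rewrite !mxE !nth_mkseq // foldrE big_map.
have -> : iota 0 p = index_iota 0 p by rewrite /index_iota subn0.
by rewrite big_mkord; apply: eq_bigr => k _; rewrite !mxE.
Qed.

Lemma trmxl p s : (mxl p s)^T = mxl p (mkseq (fun i => mkseq (fun j => nth 0 (nth [::] s j) i) p) p).
Proof. by apply/matrixP=> i j; rewrite !mxE !nth_mkseq. Qed.

(** The alternating form with coefficients [aij] evaluated at the vectors [x] and [y]. *)
Definition ev4 (a01 a02 a03 a12 a13 a23 x0 x1 x2 x3 y0 y1 y2 y3 : K) : K :=
  a01 * (x0 * y1 - x1 * y0) + a02 * (x0 * y2 - x2 * y0) + a03 * (x0 * y3 - x3 * y0) +
  a12 * (x1 * y2 - x2 * y1) + a13 * (x1 * y3 - x3 * y1) + a23 * (x2 * y3 - x3 * y2).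

Definition ev5 (a01 a02 a03 a04 a12 a13 a14 a23 a24 a34 x0 x1 x2 x3 x4 y0 y1 y2 y3 y4 : K) : K :=
  a01 * (x0 * y1 - x1 * y0) + a02 * (x0 * y2 - x2 * y0) + a03 * (x0 * y3 - x3 * y0) +
  a04 * (x0 * y4 - x4 * y0) + a12 * (x1 * y2 - x2 * y1) + a13 * (x1 * y3 - x3 * y1) +
  a14 * (x1 * y4 - x4 * y1) + a23 * (x2 * y3 - x3 * y2) + a24 * (x2 * y4 - x4 * y2) +
  a34 * (x3 * y4 - x4 * y3).

Lemma cong4 (a01 a02 a03 a12 a13 a23 : K)
    (x0 x1 x2 x3 y0 y1 y2 y3 z0 z1 z2 z3 t0 t1 t2 t3 : K) :
  let P := mxl 4 [:: [:: x0; x1; x2; x3]; [:: y0; y1; y2; y3];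
                     [:: z0; z1; z2; z3]; [:: t0; t1; t2; t3]] in
  let e := ev4 a01 a02 a03 a12 a13 a23 in
  P *m alt4 a01 a02 a03 a12 a13 a23 *m P^T =
  alt4 (e x0 x1 x2 x3 y0 y1 y2 y3) (e x0 x1 x2 x3 z0 z1 z2 z3) (e x0 x1 x2 x3 t0 t1 t2 t3)
       (e y0 y1 y2 y3 z0 z1 z2 z3) (e y0 y1 y2 y3 t0 t1 t2 t3) (e z0 z1 z2 z3 t0 t1 t2 t3).
Proof.
move=> P e; rewrite /P /e /alt4 trmxl !mxlM /mkseq /= /ev4; congr mxl.
by congr [:: [:: _; _; _; _]; [:: _; _; _; _]; [:: _; _; _; _]; [:: _; _; _; _]]; ring.
Qed.

Lemma cong5 (a01 a02 a03 a04 a12 a13 a14 a23 a24 a34 : K)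
    (x0 x1 x2 x3 x4 y0 y1 y2 y3 y4 z0 z1 z2 z3 z4 t0 t1 t2 t3 t4 u0 u1 u2 u3 u4 : K) :
  let P := mxl 5 [:: [:: x0; x1; x2; x3; x4]; [:: y0; y1; y2; y3; y4]; [:: z0; z1; z2; z3; z4];
                     [:: t0; t1; t2; t3; t4]; [:: u0; u1; u2; u3; u4]] in
  let e := ev5 a01 a02 a03 a04 a12 a13 a14 a23 a24 a34 in
  P *m alt5 a01 a02 a03 a04 a12 a13 a14 a23 a24 a34 *m P^T =
  alt5 (e x0 x1 x2 x3 x4 y0 y1 y2 y3 y4) (e x0 x1 x2 x3 x4 z0 z1 z2 z3 z4)
       (e x0 x1 x2 x3 x4 t0 t1 t2 t3 t4) (e x0 x1 x2 x3 x4 u0 u1 u2 u3 u4)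
       (e y0 y1 y2 y3 y4 z0 z1 z2 z3 z4) (e y0 y1 y2 y3 y4 t0 t1 t2 t3 t4)
       (e y0 y1 y2 y3 y4 u0 u1 u2 u3 u4) (e z0 z1 z2 z3 z4 t0 t1 t2 t3 t4)
       (e z0 z1 z2 z3 z4 u0 u1 u2 u3 u4) (e t0 t1 t2 t3 t4 u0 u1 u2 u3 u4).
Proof.
move=> P e; rewrite /P /e /alt5 trmxl !mxlM /mkseq /= /ev5; congr mxl.
by congr [:: [:: _; _; _; _; _]; [:: _; _; _; _; _]; [:: _; _; _; _; _]; [:: _; _; _; _; _];
  [:: _; _; _; _; _]]; ring.
Qed.

(** The determinant with rows [x], [y], [z], [t], in Laplace expansion along the first two. *)
Definition det4l (x0 x1 x2 x3 y0 y1 y2 y3 z0 z1 z2 z3 t0 t1 t2 t3 : K) : K :=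
  (x0 * y1 - x1 * y0) * (z2 * t3 - z3 * t2) - (x0 * y2 - x2 * y0) * (z1 * t3 - z3 * t1)
  + (x0 * y3 - x3 * y0) * (z1 * t2 - z2 * t1) + (x1 * y2 - x2 * y1) * (z0 * t3 - z3 * t0)
  - (x1 * y3 - x3 * y1) * (z0 * t2 - z2 * t0) + (x2 * y3 - x3 * y2) * (z0 * t1 - z1 * t0).

(** The polarisation of Pf(P X P^T) = det(P) Pf(X). *)
Lemma pf_ring (a01 a02 a03 a12 a13 a23 b01 b02 b03 b12 b13 b23 : K)
    (x0 x1 x2 x3 y0 y1 y2 y3 z0 z1 z2 z3 t0 t1 t2 t3 : K) :
  let e := ev4 a01 a02 a03 a12 a13 a23 in
  let f := ev4 b01 b02 b03 b12 b13 b23 in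
  e x0 x1 x2 x3 y0 y1 y2 y3 * f z0 z1 z2 z3 t0 t1 t2 t3 
  + e z0 z1 z2 z3 t0 t1 t2 t3 * f x0 x1 x2 x3 y0 y1 y2 y3
  - e x0 x1 x2 x3 z0 z1 z2 z3 * f y0 y1 y2 y3 t0 t1 t2 t3
  - e y0 y1 y2 y3 t0 t1 t2 t3 * f x0 x1 x2 x3 z0 z1 z2 z3
  + e x0 x1 x2 x3 t0 t1 t2 t3 * f y0 y1 y2 y3 z0 z1 z2 z3
  + e y0 y1 y2 y3 z0 z1 z2 z3 * f x0 x1 x2 x3 t0 t1 t2 t3
  = det4l x0 x1 x2 x3 y0 y1 y2 y3 z0 z1 z2 z3 t0 t1 t2 t3 *
    (a01 * b23 + a23 * b01 - a02 * b13 - a13 * b02 + a03 * b12 + a12 * b03).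
Proof. rewrite /= /ev4 /det4l. ring. Qed.


(** Natural numbers as indices keep ordinal proofs out of the entrywise identities. *)
Definition en p (X : 'M[K]_p.+1) (i j : nat) : K := X (inord i) (inord j).

Lemma enE p (X : 'M[K]_p.+1) i j : X i j = en X i j.
Proof. by rewrite /en !inord_val. Qed.

Lemma en_mxl p s i j : (i <= p)%N -> (j <= p)%N -> en (mxl p.+1 s) i j = nth 0 (nth [::] s i) j.
Proof. by move=> ip jp; rewrite /en mxE !inordK. Qed.

Lemma en_anti p (X : 'M[K]_p.+1) i j : X^T = - X -> en X j i = - en X i j.
Proof. by move=> aX; have := congr1 (fun Y => en Y i j) aX; rewrite /en !mxE. Qed.

Lemma alt4_anti (a01 a02 a03 a12 a13 a23 : K) :
  (alt4 a01 a02 a03 a12 a13 a23)^T = - alt4 a01 a02 a03 a12 a13 a23.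
Proof.
apply/matrixP=> -[i li] [j lj]; rewrite !mxE /=.
by move: i j li lj => [|[|[|[|i]]]] [|[|[|[|j]]]] //= _ _; rewrite ?opprK ?oppr0.
Qed.

Lemma alt5_anti (a01 a02 a03 a04 a12 a13 a14 a23 a24 a34 : K) :
  (alt5 a01 a02 a03 a04 a12 a13 a14 a23 a24 a34)^T = - alt5 a01 a02 a03 a04 a12 a13 a14 a23 a24 a34.
Proof.
apply/matrixP=> -[i li] [j lj]; rewrite !mxE /=.
by move: i j li lj => [|[|[|[|[|i]]]]] [|[|[|[|[|j]]]]] //= _ _; rewrite ?opprK ?oppr0.
Qed.

Lemma mxl4E (P : 'M[K]_4) : P = mxl 4
  [:: [:: en P 0 0; en P 0 1; en P 0 2; en P 0 3]; [:: en P 1 0; en P 1 1; en P 1 2; en P 1 3];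
      [:: en P 2 0; en P 2 1; en P 2 2; en P 2 3]; [:: en P 3 0; en P 3 1; en P 3 2; en P 3 3]].
Proof.
apply/matrixP=> i j; rewrite enE mxE; case: i j => [i li] [j lj] /=.
by move: i j li lj => [|[|[|[|i]]]] [|[|[|[|j]]]].
Qed.

Hypothesis K2 : (2%:R : K) != 0.

Lemma en_diag p (X : 'M[K]_p.+1) i : X^T = - X -> en X i i = 0.
Proof.
move=> /(en_anti i i)/eqP; rewrite -addr_eq0 -mulr2n -mulr_natl mulf_eq0 (negPf K2).
by move/eqP.
Qed.

Lemma alt4E (X : 'M[K]_4) : X^T = - X ->
  X = alt4 (en X 0 1) (en X 0 2) (en X 0 3) (en X 1 2) (en X 1 3) (en X 2 3).
Proof.
move=> aX; apply/matrixP=> i j; rewrite enE mxE; case: i j => [i li] [j lj] /=.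
by move: i j li lj => [|[|[|[|i]]]] [|[|[|[|j]]]] //= _ _; rewrite ?en_diag //; apply: en_anti.
Qed.

Lemma alt5E (X : 'M[K]_5) : X^T = - X ->
  X = alt5 (en X 0 1) (en X 0 2) (en X 0 3) (en X 0 4) (en X 1 2) (en X 1 3) (en X 1 4)
           (en X 2 3) (en X 2 4) (en X 3 4).
Proof.
move=> aX; apply/matrixP=> i j; rewrite enE mxE; case: i j => [i li] [j lj] /=.
by move: i j li lj => [|[|[|[|[|i]]]]] [|[|[|[|[|j]]]]] //= _ _; rewrite ?en_diag //; apply: en_anti.
Qed.

(** The polar form of the Pfaffian; [pfp X X] is twice the Pfaffian of [X]. *)
Definition pfp (X Y : 'M[K]_4) : K :=
  en X 0 1 * en Y 2 3 + en X 2 3 * en Y 0 1 - en X 0 2 * en Y 1 3 - en X 1 3 * en Y 0 2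
  + en X 0 3 * en Y 1 2 + en X 1 2 * en Y 0 3.

Lemma pfp_sym X Y : pfp X Y = pfp Y X.
Proof. rewrite /pfp; ring. Qed.

Lemma pfp_linearl Y c X X' : pfp (c *: X + X') Y = c * pfp X Y + pfp X' Y.
Proof. rewrite /pfp /en !mxE; ring. Qed.

Lemma pfp_alt4 (a01 a02 a03 a12 a13 a23 b01 b02 b03 b12 b13 b23 : K) :
  pfp (alt4 a01 a02 a03 a12 a13 a23) (alt4 b01 b02 b03 b12 b13 b23) =
  a01 * b23 + a23 * b01 - a02 * b13 - a13 * b02 + a03 * b12 + a12 * b03.
Proof. by rewrite /pfp !en_mxl. Qed.

Lemma pfp_cong (P : 'M[K]_4) : exists d, forall X Y, X^T = - X -> Y^T = - Y ->
  pfp (P *m X *m P^T) (P *m Y *m P^T) = d * pfp X Y.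
Proof.
rewrite (mxl4E P); eexists => X Y /alt4E -> /alt4E ->.
by rewrite !cong4 !pfp_alt4 pf_ring.
Qed.

(** Congruence by [invmx P] scales [pfp] as well, and going there and back on the matrix 01+23 must
    return its nonzero value 2. *)
Lemma pfp_cong_unit (P : 'M[K]_4) d : P \in unitmx ->
  (forall X Y, X^T = - X -> Y^T = - Y -> pfp (P *m X *m P^T) (P *m Y *m P^T) = d * pfp X Y) ->
  d != 0.
Proof.
move=> uP hd; have [d' hd'] := pfp_cong (invmx P).
have aJ := alt4_anti 1 0 0 0 0 1.
have := hd' (P *m alt4 1 0 0 0 0 1 *m P^T) (P *m alt4 1 0 0 0 0 1 *m P^T).
rewrite hd // !trmx_mul trmxK aJ mulNmx mulmxN mulmxA => /(_ erefl erefl).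
rewrite -!mulmxA -trmx_mul mulVmx // trmx1 mulmx1 mulKmx // pfp_alt4 => e.
apply: contra_neq K2 => d0; rewrite d0 !(mul0r, mulr0) in e.
by rewrite -[RHS]e; ring.
Qed.

Definition gram q (M : 'I_q -> 'M[K]_4) : 'M[K]_q := \matrix_(k, l) pfp (M k) (M l).

Lemma pfp_suml q (M : 'I_q -> 'M[K]_4) u Y : pfp (comb M u) Y = \sum_k u 0 k * pfp (M k) Y.
Proof.
apply: (big_rec2 (fun x y => pfp x Y = y)); first by rewrite /pfp /en !mxE; ring.
by move=> k x y _ <-; rewrite pfp_linearl.
Qed.

Lemma pfp_comb q (M : 'I_q -> 'M[K]_4) u v :
  pfp (comb M u) (comb M v) = (u *m gram M *m v^T) 0 0.
Proof.
rewrite pfp_suml -mulmxA mxE; apply: eq_bigr => k _; congr (_ * _).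
by rewrite pfp_sym pfp_suml mxE; apply: eq_bigr => l _; rewrite !mxE pfp_sym mulrC.
Qed.

Lemma gram_cong q (M N : 'I_q -> 'M[K]_4) P h d :
    (forall k l, pfp (P *m M k *m P^T) (P *m M l *m P^T) = d * pfp (M k) (M l)) ->
    (forall w, P *m comb M w *m P^T = comb N (w *m h)) ->
  d *: gram M = h *m gram N *m h^T.
Proof.
move=> hd hP; apply/matrixP=> k l; rewrite mxE mxE -hd -!(comb_delta M) !hP -!rowE pfp_comb.
by rewrite -row_mul [LHS]mxE [RHS]mxE; apply: eq_bigr => i _; rewrite !mxE.
Qed.

End ListMatrices.

(** * Congruence normal forms *)

Section Congruence.
Variable K : fieldType.
Hypothesis K2 : (2%:R : K) != 0.

Definition cgr p (X Y : 'M[K]_p) := exists2 P, P \in unitmx & P *m X *m P^T = Y.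

Lemma cgr_refl p (X : 'M[K]_p) : cgr X X.
Proof. by exists 1%:M; rewrite ?unitmx1 // trmx1 mulmx1 mul1mx. Qed.

Lemma cgr_trans p (X Y Z : 'M[K]_p) : cgr X Y -> cgr Y Z -> cgr X Z.
Proof.
move=> [P uP <-] [Q uQ <-]; exists (Q *m P); first by rewrite unitmx_mul uP uQ.
by rewrite trmx_mul !mulmxA.
Qed.

Lemma cgr_tr p (e : K) (X Y : 'M[K]_p) : X^T = e *: X -> cgr X Y -> Y^T = e *: Y.
Proof.
by move=> aX [P _ <-]; rewrite !trmx_mul trmxK aX mulmxA -scalemxAr -scalemxAl.
Qed.

Lemma cgr_anti p (X Y : 'M[K]_p) : X^T = - X -> cgr X Y -> Y^T = - Y.
Proof. by rewrite -!scaleN1r; apply: cgr_tr. Qed.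

Lemma cgr_block m p (A : 'M[K]_m) (X Y : 'M[K]_p) :
  cgr X Y -> cgr (block_mx A 0 0 X) (block_mx A 0 0 Y).
Proof.
move=> [P uP <-]; exists (block_mx 1%:M 0 0 P).
  by rewrite unitmxE det_ublock det1 mul1r -unitmxE.
by rewrite tr_block_mx !mulmx_block !trmx0 trmx1 !(mulmx0, mul0mx, addr0, add0r, mulmx1, mul1mx).
Qed.

Lemma cgr_perm p (s : 'S_p) (X : 'M[K]_p) : cgr X (row_perm s (col_perm s X)).
Proof.
exists (perm_mx s); first exact: unitmx_perm.
by rewrite -row_permE tr_perm_mx -col_permE; apply/matrixP=> i j; rewrite !mxE.
Qed.

(** Block elimination against an invertible corner, for symmetric ([e = 1]) and skew ([e = -1])
    matrices at once. *)
Lemma cgr_elim m p (e : K) (A : 'M[K]_m) (B : 'M[K]_(m, p)) (D : 'M[K]_p) :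
  e * e = 1 -> A \in unitmx -> A^T = e *: A ->
  exists D', cgr (block_mx A B (e *: B^T) D) (block_mx A 0 0 D').
Proof.
move=> ee uA aA; pose X := - (e *: B^T *m invmx A).
exists (X *m B + D), (block_mx 1%:M 0 X 1%:M).
  by rewrite unitmxE det_lblock !det1 mul1r unitr1.
rewrite tr_block_mx !mulmx_block !trmx0 !trmx1 !(mulmx0, mul0mx, addr0, add0r, mulmx1, mul1mx).
have XA : X *m A + e *: B^T = 0 by rewrite /X mulNmx mulmxKV // addNr.
have AX : A *m X^T + B = 0.
  apply: trmx_inj; rewrite linearD /= trmx_mul trmxK aA -scalemxAr trmx0.
  apply: (scalerI (a := e)); last by rewrite scaler0 scalerDr scalerA ee scale1r XA.
  by apply: contra_eq_neq ee => ->; rewrite mul0r eq_sym oner_neq0.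
by rewrite XA AX !mul0mx add0r.
Qed.

Definition J2 : 'M[K]_2 := mxl 2 [:: [:: 0; 1]; [:: -1; 0]].

Lemma J2_unit : J2 \in unitmx.
Proof.
have : J2 *m (- J2) = 1%:M; last by case/mulmx1_unit.
rewrite mulmxN mxlM /mkseq /=; apply/matrixP=> -[i li] [j lj]; rewrite !mxE -val_eqE /=.
by move: i j li lj => [|[|i]] [|[|j]] //= _ _; rewrite !(mul0r, mulr0, addr0, add0r, mulr1, mul1r, opprK, oppr0).
Qed.

Lemma skew_split m (M : 'M[K]_(2 + m)) : M^T = - M -> M != 0 ->
  exists M', cgr M (block_mx J2 0 0 M').
Proof.
move=> aM M0.
have /matrix0Pn[i [j Mij]] := M0.
have nij : i != j.
  by apply: contraNneq Mij => ->; rewrite enE en_diag.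
pose o0 : 'I_(2 + m) := ord0; pose o1 : 'I_(2 + m) := lift ord0 ord0.
(* [s] brings the nonzero entry [M i j] to position (0, 1); scaling the first basis vector then
   makes it 1. *)
pose t := tperm o0 i; pose s := (tperm o1 (t j) * t)%g.
have s0 : s o0 = i.
  rewrite permM tpermD // ?tpermL //.
  by rewrite -(inj_eq (@perm_inj _ t)) tpermK tpermL eq_sym.
have s1 : s o1 = j by rewrite permM tpermL tpermK.
pose c := M i j.
pose M1 := row_perm s (col_perm s M); have M01 : M1 o0 o1 = c by rewrite !mxE s0 s1.
have cM1 : cgr M M1 by apply: cgr_perm.
have aM1 : M1^T = - M1 by apply: cgr_anti cM1.
move: M1 M01 cM1 aM1 => M1 M01 cM1 aM1.
pose Q := block_mx (mxl 2 [:: [:: c^-1; 0]; [:: 0; 1]]) 0 0 1%:M : 'M[K]_(2 + m).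
have uQ : Q \in unitmx.
  rewrite unitmxE det_ublock det1 mulr1 (expand_det_row _ 0) !big_ord_recl big_ord0 !mxE /=.
  by rewrite /cofactor !det_mx11 !mxE /= !(mul0r, mulr1, mul1r, addr0) unitfE invr_eq0.
have cM2 : cgr M (Q *m M1 *m Q^T) by apply: cgr_trans cM1 _; exists Q.
move: cM2; rewrite -{1}[M1]submxK /Q tr_block_mx !mulmx_block !trmx0 trmx1.
rewrite !(mulmx0, mul0mx, addr0, add0r, mulmx1, mul1mx).
have -> : mxl 2 [:: [:: c^-1; 0]; [:: 0; 1]] *m ulsubmx M1 *m (mxl 2 [:: [:: c^-1; 0]; [:: 0; 1]])^T = J2.
  have -> : ulsubmx M1 = mxl 2 [:: [:: 0; c]; [:: - c; 0]].
    have e0 : lshift m (inord 0 : 'I_2) = o0 by apply/val_inj; rewrite /= inordK.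
    have e1 : lshift m (inord 1 : 'I_2) = o1 by apply/val_inj; rewrite /= inordK.
    have au : (ulsubmx M1)^T = - ulsubmx M1 by rewrite trmx_ulsub aM1; apply/matrixP=> a b; rewrite !mxE.
    apply/matrixP=> i' j'; rewrite enE !mxE; case: i' j' => [a la] [b lb] /=.
    move: a b la lb => [|[|a]] [|[|b]] //= _ _; rewrite ?(en_diag K2) //.
      by rewrite /en !mxE e0 e1 M01.
    by rewrite (en_anti 0 1 au) /en !mxE e0 e1 M01.
  rewrite trmxl !mxlM /mkseq /=; congr mxl; congr [:: [:: _; _]; [:: _; _]]; by field.
set Bl := _ *m ursubmx M1; set Cl := dlsubmx M1 *m _ => cM2.
have aM2 := cgr_anti aM cM2.
have eC : Cl = (-1) *: Bl^T.
  move: aM2; rewrite tr_block_mx opp_block_mx => /eq_block_mx[_ eC _ _].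
  by rewrite scaleN1r -(trmxK Cl) eC linearN.
rewrite eC in cM2.
have [||D' cD] := @cgr_elim 2 m (-1) J2 Bl (drsubmx M1) _ J2_unit.
- by rewrite mulrNN mulr1.
- by move: aM2; rewrite tr_block_mx opp_block_mx scaleN1r => /eq_block_mx[].
by exists D'; apply: cgr_trans cD.
Qed.

(** [r] diagonal blocks [J2] followed by zeros. *)
Definition Jn p r : 'M[K]_p := \matrix_(i, j)
  if [&& j == i.+1 :> nat, ~~ odd i & (j < r.*2)%N] then 1
  else if [&& i == j.+1 :> nat, ~~ odd j & (i < r.*2)%N] then -1 else 0.

Lemma Jn0 p : Jn p 0 = 0.
Proof. by apply/matrixP=> i j; rewrite !mxE !ltn0 !andbF. Qed.

Lemma JnS p r : Jn (2 + p) r.+1 = block_mx J2 0 0 (Jn p r).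
Proof.
apply/matrixP=> i j; rewrite -[i]splitK -[j]splitK; case: (split i) => a; case: (split j) => b /=.
- rewrite block_mxEul !mxE; case: a b => [[|[|a]] la] [[|[|b]] lb] //=; by rewrite doubleS.
- by rewrite block_mxEur !mxE; case: a => [[|[|a]] la] //=; rewrite !andbF.
- by rewrite block_mxEdl !mxE; case: b => [[|[|b]] lb] //=; rewrite ?andbF.
rewrite block_mxEdr !mxE /= doubleS !eqSS !ltnS.
by rewrite !add0n !negbK.
Qed.

Lemma skew_nf p (M : 'M[K]_p) : M^T = - M -> exists r, (r.*2 <= p)%N /\ cgr M (Jn p r).
Proof.
have [n] := ubnP p; elim: n p M => // n IHn p M pn aM.
have [->|M0] := eqVneq M 0; first by exists 0%N; rewrite Jn0; split=> //; apply: cgr_refl.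
case: p M pn aM M0 => [|[|p]] M pn aM M0.
- by rewrite [M]flatmx0 eqxx in M0.
- case/eqP: M0; apply/matrixP=> i j; rewrite enE ord1 [j]ord1 en_diag ?mxE //.
have [M' cM] := skew_split aM M0.
have aM' : M'^T = - M'.
  by have := @cgr_anti (2 + p) _ _ aM cM; rewrite tr_block_mx opp_block_mx => /eq_block_mx[].
have [|r [rp cr]] := IHn _ _ _ aM'; first by lia.
exists r.+1; rewrite doubleS ltnS; split=> //.
by rewrite (JnS p r); apply: cgr_trans cM _; apply: cgr_block.
Qed.

Lemma sym_diag n (B : 'M[K]_n) : B^T = B -> exists d, cgr B (diag_mx d).
Proof.
elim: n B => [|n IHn] B sB.
  by exists 0; rewrite [B]flatmx0 [diag_mx _]flatmx0; apply: cgr_refl.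
have [->|B0] := eqVneq B 0; first by exists 0; rewrite linear0; apply: cgr_refl.
have cs (X : 'M_(1 + n)) : cgr B X -> X^T = X.
  by rewrite -[X in _ -> _ = X]scale1r; apply: cgr_tr; rewrite scale1r.
have [B1 cB1 nz1] : exists2 B1, cgr B B1 & exists i, B1 i i != 0.
  have [/existsP[i Bi]|] := boolP [exists i, B i i != 0].
    by exists B; [apply: cgr_refl | exists i].
  rewrite negb_exists => /forallP Bd.
  have {}Bd i : B i i = 0 by have := Bd i; rewrite negbK => /eqP.
  have /matrix0Pn[i [j Bij]] := B0.
  have nij : i != j by apply: contraNneq Bij => ->; rewrite Bd.
  (* The diagonal is zero, so adding the [j]-th basis vector to the [i]-th creates the diagonal
     entry [2 * B i j]. *)
  pose P : 'M[K]_n.+1 := 1%:M + delta_mx i j.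
  have uP : P \in unitmx.
    have : P *m (1%:M - delta_mx i j) = 1%:M; last by case/mulmx1_unit.
    rewrite mulmxDl mul1mx mulmxBr mulmx1 mul_delta_mx_cond eq_sym (negPf nij) mulr0n subr0.
    by rewrite subrK.
  exists (P *m B *m P^T); first by exists P.
  have Dl (X : 'M[K]_n.+1) k : (delta_mx i j *m X) i k = X j k.
    rewrite mxE (bigD1 j) //= big1 => [|l /negPf lj]; rewrite !mxE eqxx /=.
      by rewrite eqxx mul1r addr0.
    by rewrite lj mul0r.
  have Dr (X : 'M[K]_n.+1) : (X *m delta_mx j i) i i = X i j.
    rewrite mxE (bigD1 j) //= big1 => [|l /negPf lj]; rewrite !mxE eqxx /= ?eqxx.
      by rewrite mulr1 addr0.
    by rewrite lj mulr0.
  have addE (X Y : 'M[K]_n.+1) a b : (X + Y) a b = X a b + Y a b by rewrite mxE.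
  exists i; rewrite /P linearD /= trmx1 trmx_delta mulmxDr mulmx1 mulmxDl mul1mx.
  rewrite !addE Dr addE !Dl !Bd.
  have -> : B j i = B i j by rewrite -{1}sB mxE.
  by rewrite add0r addr0 -mulr2n -mulr_natl mulf_neq0.
move: nz1 => [i B1i].
have cB2 := cgr_trans cB1 (cgr_perm (tperm ord0 i) B1).
move: cB2; set B2 := row_perm _ _ => cB2.
have B20 : B2 ord0 ord0 != 0.
  by rewrite !mxE tpermL; exact: B1i.
have sB2 := cs _ cB2.
move: B2 B20 cB2 sB2; rewrite -[n.+1]/(1 + n)%N => B2 B20 cB2 sB2.
rewrite -[B2]submxK in cB2 sB2.
have uA : ulsubmx B2 \in unitmx.
  rewrite unitmxE det_mx11 unitfE !mxE; suff -> : @lshift 1 n 0 = ord0 :> 'I_n.+1 by [].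
  by apply: val_inj.
have [|||D cD] := @cgr_elim 1 n 1 (ulsubmx B2) (ursubmx B2)
   (drsubmx B2) => //.
- by rewrite mulr1.
- by move: sB2; rewrite tr_block_mx scale1r => /eq_block_mx[].
rewrite scale1r in cD.
have eC : (ursubmx B2)^T = dlsubmx B2.
  by move: sB2; rewrite tr_block_mx => /eq_block_mx[].
rewrite eC in cD.
have cB3 := cgr_trans cB2 cD.
have sD : D^T = D by move: (cs _ cB3); rewrite tr_block_mx => /eq_block_mx[].
have [d cd] := IHn D sD.
exists (row_mx (ulsubmx B2) d : 'rV_(1 + n)).
apply: cgr_trans cB3 _; rewrite diag_mx_row.
suff <- : ulsubmx B2 = diag_mx (ulsubmx B2) by apply: cgr_block.
by apply/matrixP=> a b; rewrite !mxE !ord1 eqxx mulr1n.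
Qed.

End Congruence.

(** * Small systems *)

Section ListDet.
Variable K : fieldType.

(** Cofactor expansion along the first row, on lists, so that explicit determinants compute. *)
Fixpoint ldet (p : nat) (s : seq (seq K)) : K :=
  if p is p'.+1 then
    foldr +%R 0 (mkseq (fun j => (-1) ^+ j * nth 0 (nth [::] s 0) j *
      ldet p' [seq take j r ++ drop j.+1 r | r <- behead s]) p)
  else 1.

Lemma ldetS p s : ldet p.+1 s =
  foldr +%R 0 (mkseq (fun j => (-1) ^+ j * nth 0 (nth [::] s 0) j *
    ldet p [seq take j r ++ drop j.+1 r | r <- behead s]) p.+1).
Proof. by []. Qed.

Lemma det_mxl p s : \det (mxl p s) = ldet p s.
Proof.
elim: p s => [|p IHp] s; first by rewrite det_mx00.
rewrite (expand_det_row _ ord0) ldetS.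
have mkE (T : Type) (f : nat -> T) : mkseq f p.+1 = [seq f j | j <- index_iota 0 p.+1].
  by rewrite /index_iota subn0.
rewrite mkE foldrE big_map big_mkord; apply: eq_bigr => j _; rewrite mxE -IHp /cofactor add0n /=.
rewrite mulrCA mulrA; congr (_ * \det _); apply/matrixP=> a b; rewrite !mxE /= /bump leq0n add1n.
case: s => [|r s] /=; first by rewrite !nth_nil.
have [lt|ge] := ltnP a (size s); last by rewrite !nth_default ?size_map //.
rewrite (nth_map [::]) //; move: (nth _ s a) => u; rewrite nth_cat size_take.
case: ltnP => ju; case: (ltnP b j) => bj; rewrite ?add0n ?add1n.
- by rewrite nth_take.
- by case: (ltnP j (size u)) ju => h1 h2; [|rewrite take_oversize // nth_default]; lia.
- by rewrite nth_drop !nth_default //; move: ju; case: ifP; lia.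
move: ju; case: ifP => ju ub; rewrite nth_drop; first by congr nth; lia.
by rewrite !nth_default //; lia.
Qed.

Lemma unit_mxl p s c : ldet p s = c -> c != 0 -> mxl p s \in unitmx.
Proof. by move=> e c0; rewrite unitmxE det_mxl e unitfE. Qed.

End ListDet.

Section Sys.
Variable K : fieldType.

Definition sys p q (s : seq 'M[K]_p) : 'I_q -> 'M[K]_p := fun k => nth 0 s k.

Lemma teqI p q (M N : 'I_q -> 'M[K]_p) P h : P \in unitmx -> h \in unitmx ->
  (forall k, P *m M k *m P^T = comb N (row k h)) -> teq M N.
Proof.
move=> uP uh hM; exists P, h; split=> // w.
rewrite {1}/comb mulmx_sumr mulmx_suml (mulmx_sum_row w h) linear_sum.
by apply: eq_bigr => k _; rewrite -scalemxAr -scalemxAl hM linearZ.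
Qed.

Lemma teq_ext p q (M N : 'I_q -> 'M[K]_p) : M =1 N -> teq M N.
Proof.
move=> MN; apply: (@teqI _ _ _ _ 1%:M 1%:M); rewrite ?unitmx1 // => k.
by rewrite trmx1 mul1mx mulmx1 row1 comb_delta MN.
Qed.

Lemma teq_refl p q (M : 'I_q -> 'M[K]_p) : teq M M.
Proof. exact: teq_ext. Qed.

Lemma comb_sys2 p (A B : 'M[K]_p) w : comb (sys (q := 2) [:: A; B]) w = w 0 0 *: A + w 0 1 *: B.
Proof. by rewrite /comb !big_ord_recl big_ord0 addr0 /sys /=; congr (_ + w _ _ *: _); apply: val_inj. Qed.

Lemma comb_sys3 p (A B C : 'M[K]_p) w :
  comb (sys (q := 3) [:: A; B; C]) w = w 0 0 *: A + w 0 1 *: B + w 0 (inord 2) *: C.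
Proof.
rewrite /comb !big_ord_recl big_ord0 addr0 /sys /= addrA.
by congr (_ + w _ _ *: _ + w _ _ *: _); apply: val_inj; rewrite //= inordK.
Qed.

Definition s2 p (A B : 'M[K]_p) : 'I_2 -> 'M[K]_p := sys [:: A; B].
Definition s3 p (A B C : 'M[K]_p) : 'I_3 -> 'M[K]_p := sys [:: A; B; C].

Lemma sys2E p (M : 'I_2 -> 'M[K]_p) : teq M (s2 (M 0) (M 1)).
Proof.
by apply: teq_ext => -[[|[|k]] lk] //=; rewrite /s2 /sys /=; congr M; apply: val_inj.
Qed.

Lemma sys3E p (M : 'I_3 -> 'M[K]_p) : teq M (s3 (M 0) (M 1) (M (inord 2))).
Proof.
by apply: teq_ext => -[[|[|[|k]]] lk] //=; rewrite /s3 /sys /=; congr M; apply: val_inj; rewrite /= ?inordK.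
Qed.

Lemma teq2I p (A B A' B' : 'M[K]_p) P (a b c d : K) : P \in unitmx -> a * d - b * c != 0 ->
  P *m A *m P^T = a *: A' + b *: B' -> P *m B *m P^T = c *: A' + d *: B' -> teq (s2 A B) (s2 A' B').
Proof.
move=> uP h0 hA hB; apply: (@teqI _ _ _ _ P (mxl 2 [:: [:: a; b]; [:: c; d]])) => //.
  by apply: unit_mxl h0; rewrite /ldet /=; ring.
by move=> -[[|[|k]] lk] //=; rewrite /s2 comb_sys2 !mxE /= -?hA -?hB.
Qed.

Lemma teq2_cgr p (A B A' B' : 'M[K]_p) P : P \in unitmx ->
  P *m A *m P^T = A' -> P *m B *m P^T = B' -> teq (s2 A B) (s2 A' B').
Proof.
move=> uP hA hB; apply: (@teq2I _ _ _ _ _ P 1 0 0 1) => //.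
- by rewrite mul0r mulr1 subr0 oner_neq0.
- by rewrite scale1r scale0r addr0.
by rewrite scale1r scale0r add0r.
Qed.

Lemma teq3I p (A B C A' B' C' : 'M[K]_p) P (a b1 b c1 c2 c : K) : P \in unitmx -> a * b * c != 0 ->
  P *m A *m P^T = a *: A' -> P *m B *m P^T = b1 *: A' + b *: B' ->
  P *m C *m P^T = c1 *: A' + c2 *: B' + c *: C' -> teq (s3 A B C) (s3 A' B' C').
Proof.
move=> uP h0 hA hB hC.
apply: (@teqI _ _ _ _ P (mxl 3 [:: [:: a; 0; 0]; [:: b1; b; 0]; [:: c1; c2; c]])) => //.
  by apply: unit_mxl h0; rewrite /ldet /=; ring.
move=> -[[|[|[|k]]] lk] //=; rewrite /s3 comb_sys3 !mxE inordK //= -?hA -?hB -?hC.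
  by rewrite hA !scale0r !addr0.
by rewrite hB scale0r addr0.
Qed.

Lemma alt4_lin (x : K) a01 a02 a03 a12 a13 a23 b01 b02 b03 b12 b13 b23 :
  x *: alt4 a01 a02 a03 a12 a13 a23 + alt4 b01 b02 b03 b12 b13 b23 =
  alt4 (x * a01 + b01) (x * a02 + b02) (x * a03 + b03) (x * a12 + b12) (x * a13 + b13) (x * a23 + b23).
Proof.
apply/matrixP=> -[i li] [j lj]; rewrite !mxE /=.
by move: i j li lj => [|[|[|[|i]]]] [|[|[|[|j]]]] //= _ _; ring.
Qed.

Lemma alt4Z (x : K) a01 a02 a03 a12 a13 a23 :
  x *: alt4 a01 a02 a03 a12 a13 a23 = alt4 (x * a01) (x * a02) (x * a03) (x * a12) (x * a13) (x * a23).
Proof.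
apply/matrixP=> -[i li] [j lj]; rewrite !mxE /=.
by move: i j li lj => [|[|[|[|i]]]] [|[|[|[|j]]]] //= _ _; ring.
Qed.

Lemma alt5_lin (x : K) a01 a02 a03 a04 a12 a13 a14 a23 a24 a34 b01 b02 b03 b04 b12 b13 b14 b23 b24 b34 :
  x *: alt5 a01 a02 a03 a04 a12 a13 a14 a23 a24 a34 + alt5 b01 b02 b03 b04 b12 b13 b14 b23 b24 b34 =
  alt5 (x * a01 + b01) (x * a02 + b02) (x * a03 + b03) (x * a04 + b04) (x * a12 + b12) (x * a13 + b13)
    (x * a14 + b14) (x * a23 + b23) (x * a24 + b24) (x * a34 + b34).
Proof.
apply/matrixP=> -[i li] [j lj]; rewrite !mxE /=.
by move: i j li lj => [|[|[|[|[|i]]]]] [|[|[|[|[|j]]]]] //= _ _; ring.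
Qed.

Lemma alt5Z (x : K) a01 a02 a03 a04 a12 a13 a14 a23 a24 a34 :
  x *: alt5 a01 a02 a03 a04 a12 a13 a14 a23 a24 a34 =
  alt5 (x * a01) (x * a02) (x * a03) (x * a04) (x * a12) (x * a13) (x * a14) (x * a23) (x * a24) (x * a34).
Proof.
apply/matrixP=> -[i li] [j lj]; rewrite !mxE /=.
by move: i j li lj => [|[|[|[|[|i]]]]] [|[|[|[|[|j]]]]] //= _ _; ring.
Qed.

Lemma alt4D a01 a02 a03 a12 a13 a23 b01 b02 b03 b12 b13 b23 :
  alt4 a01 a02 a03 a12 a13 a23 + alt4 b01 b02 b03 b12 b13 b23 =
  alt4 (a01 + b01) (a02 + b02) (a03 + b03) (a12 + b12) (a13 + b13) (a23 + b23 : K).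
Proof. by rewrite -[X in X + _]scale1r alt4_lin !mul1r. Qed.

Lemma alt5D a01 a02 a03 a04 a12 a13 a14 a23 a24 a34 b01 b02 b03 b04 b12 b13 b14 b23 b24 b34 :
  alt5 a01 a02 a03 a04 a12 a13 a14 a23 a24 a34 + alt5 b01 b02 b03 b04 b12 b13 b14 b23 b24 b34 =
  alt5 (a01 + b01) (a02 + b02) (a03 + b03) (a04 + b04) (a12 + b12) (a13 + b13)
    (a14 + b14) (a23 + b23) (a24 + b24) (a34 + b34 : K).
Proof. by rewrite -[X in X + _]scale1r alt5_lin !mul1r. Qed.

Lemma alt4_0 : alt4 0 0 0 0 0 0 = 0 :> 'M[K]_4.
Proof. by rewrite -[RHS](scale0r (alt4 0 0 0 0 0 0)) alt4Z !mul0r. Qed.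
Lemma alt5_0 : alt5 0 0 0 0 0 0 0 0 0 0 = 0 :> 'M[K]_5.
Proof. by rewrite -[RHS](scale0r (alt5 0 0 0 0 0 0 0 0 0 0)) alt5Z !mul0r. Qed.

End Sys.

(** * Pencils in dimension five *)

Section NF52.
Variable K : fieldType.
Hypothesis K2 : (2%:R : K) != 0.

Definition N52_1 : 'I_2 -> 'M[K]_5 := s2 (alt5 1 0 0 0 0 0 0 0 0 0) (alt5 0 1 0 0 0 0 0 0 0 0).
Definition N52_2 : 'I_2 -> 'M[K]_5 := s2 (alt5 1 0 0 0 0 0 0 0 0 0) (alt5 0 1 0 0 0 1 0 0 0 0).
Definition N52_3 : 'I_2 -> 'M[K]_5 := s2 (alt5 1 0 0 0 0 0 0 0 0 0) (alt5 0 0 0 1 0 0 0 1 0 0).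
Definition N52_4 : 'I_2 -> 'M[K]_5 := s2 (alt5 1 0 0 0 0 0 0 1 0 0) (alt5 0 0 0 1 1 0 0 0 0 0).
Definition N52_F (a : K) : 'I_2 -> 'M[K]_5 :=
  s2 (alt5 1 0 0 0 0 0 0 1 0 0) (alt5 0 1 0 0 0 a 0 0 0 0).

Definition NF52 (M : 'I_2 -> 'M[K]_5) :=
  [\/ teq M N52_1, teq M N52_2, teq M N52_3 | teq M N52_4] \/ exists2 a, a != 0 & teq M (N52_F a).

Lemma NF52_teq M N : teq M N -> NF52 N -> NF52 M.
Proof.
by move=> MN [[h|h|h|h]|[a a0 h]]; [left; constructor 1 | left; constructor 2 |
  left; constructor 3 | left; constructor 4 | right; exists a => //]; apply: teq_trans h.
Qed.

Notation mx5 a b c d e := (mxl 5 [:: a; b; c; d; e]).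

Ltac altring := rewrite ?cong5; do ?rewrite !alt5Z; rewrite ?alt5D /ev5; congr alt5.

Lemma nf52_swap34 b01 b02 b03 b04 b12 b13 b14 b23 b24 b34 :
  teq (s2 (alt5 1 0 0 0 0 0 0 0 0 0) (alt5 b01 b02 b03 b04 b12 b13 b14 b23 b24 b34))
      (s2 (alt5 1 0 0 0 0 0 0 0 0 0) (alt5 b01 b02 b04 b03 b12 b14 b13 b24 b23 (- b34 : K))).
Proof.
apply: (@teq2_cgr _ _ _ _ _ _ (mx5 [:: 1; 0; 0; 0; 0] [:: 0; 1; 0; 0; 0] [:: 0; 0; 1; 0; 0]
  [:: 0; 0; 0; 0; 1] [:: 0; 0; 0; 1; 0])).
- by apply: (unit_mxl (c := -1)); rewrite ?oppr_eq0 ?oner_eq0 // /ldet /=; ring.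
- by altring; ring.
- by altring; ring.
Qed.

Lemma nf52_swap23 b01 b02 b03 b04 b12 b13 b14 b23 b24 b34 :
  teq (s2 (alt5 1 0 0 0 0 0 0 0 0 0) (alt5 b01 b02 b03 b04 b12 b13 b14 b23 b24 b34))
      (s2 (alt5 1 0 0 0 0 0 0 0 0 0) (alt5 b01 b03 b02 b04 b13 b12 b14 (- b23) b34 (b24 : K))).
Proof.
apply: (@teq2_cgr _ _ _ _ _ _ (mx5 [:: 1; 0; 0; 0; 0] [:: 0; 1; 0; 0; 0] [:: 0; 0; 0; 1; 0]
  [:: 0; 0; 1; 0; 0] [:: 0; 0; 0; 0; 1])).
- by apply: (unit_mxl (c := -1)); rewrite ?oppr_eq0 ?oner_eq0 // /ldet /=; ring.
- by altring; ring.
- by altring; ring.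
Qed.

Lemma nf52_swap01 b01 b02 b03 b04 b12 b13 b14 b23 b24 b34 :
  teq (s2 (alt5 1 0 0 0 0 0 0 0 0 0) (alt5 b01 b02 b03 b04 b12 b13 b14 b23 b24 b34))
      (s2 (alt5 1 0 0 0 0 0 0 0 0 0) (alt5 b01 b12 b13 b14 (- b02) (- b03) (- b04) b23 b24 (b34 : K))).
Proof.
apply: (@teq2_cgr _ _ _ _ _ _ (mx5 [:: 0; 1; 0; 0; 0] [:: -1; 0; 0; 0; 0] [:: 0; 0; 1; 0; 0]
  [:: 0; 0; 0; 1; 0] [:: 0; 0; 0; 0; 1])).
- by apply: (unit_mxl (c := 1)); rewrite ?oppr_eq0 ?oner_eq0 // /ldet /=; ring.
- by altring; ring.
- by altring; ring.
Qed.

(** A term 04 or 14 leads to [N52_3]. Otherwise the pencil is spanned by 01 and 23, its Pfaffian is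
    a hyperbolic plane, and the parameter is 1. *)
Lemma nf52_end1 x p q :
  NF52 (s2 (alt5 1 0 0 0 0 0 0 0 0 0) (alt5 x 0 0 p 0 0 q 1 0 0)).
Proof.
have [p0|p0] := eqVneq p 0; last first.
  left; constructor 3.
  apply: (@teq2I _ _ _ _ _ _ (mx5 [:: p^-1; 0; 0; 0; 0] [:: - q / p; 1; 0; 0; 0] [:: 0; 0; 1; 0; 0]
    [:: 0; 0; 0; 1; 0] [:: 0; 0; 0; 0; 1]) p^-1 0 (x / p) 1).
  - by apply: (unit_mxl (c := p^-1)); rewrite ?invr_eq0 // /ldet /=; field.
  - by rewrite mul0r subr0 mulr1 invr_eq0.
  - by altring; field.
  - by altring; field.
have [q0|q0] := eqVneq q 0; last first.
  left; constructor 3.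
  apply: (@teq2I _ _ _ _ _ _ (mx5 [:: 0; q^-1; 0; 0; 0] [:: 1; 0; 0; 0; 0] [:: 0; 0; 1; 0; 0]
    [:: 0; 0; 0; 1; 0] [:: 0; 0; 0; 0; 1]) (- q^-1) 0 (- x / q) 1).
  - by apply: (unit_mxl (c := - q^-1)); rewrite ?oppr_eq0 ?invr_eq0 // /ldet /=; field.
  - by rewrite mul0r subr0 mulr1 oppr_eq0 invr_eq0.
  - by altring; field.
  by rewrite p0; altring; field.
right; exists 1; first exact: oner_neq0.
apply: (@teq2I _ _ _ _ _ _ (mx5 [:: 1; 0; 1; 0; 0] [:: 0; 2%:R^-1; 0; 2%:R^-1; 0]
   [:: 0; 2%:R^-1; 0; - 2%:R^-1; 0] [:: -1; 0; 1; 0; 0] [:: 0; 0; 0; 0; 1])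
   2%:R^-1 2%:R^-1 ((x + 1) / 2%:R) ((x - 1) / 2%:R)).
- by apply: (unit_mxl (c := 1)); rewrite ?oner_eq0 // /ldet /=; field.
- have -> : 2%:R^-1 * ((x - 1) / 2%:R) - 2%:R^-1 * ((x + 1) / 2%:R) = - 2%:R^-1 by field.
  by rewrite oppr_eq0 invr_eq0.
- by altring; field.
by rewrite p0 q0; altring; field.
Qed.

Lemma nf52_b23 b01 b02 b03 b04 b12 b13 b14 b23 b24 b34 : b23 != 0 ->
  NF52 (s2 (alt5 1 0 0 0 0 0 0 0 0 0) (alt5 b01 b02 b03 b04 b12 b13 b14 b23 b24 b34)).
Proof.
(* Adding multiples of [e_2] and [e_3] to the other vectors makes them orthogonal to [e_2] and [e_3]
   for the second form; the form 01 does not see these additions. *)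
move=> b0; pose P := mx5 [:: 1; 0; - b03 / b23; b02 / b23 ; 0] [:: 0; 1; - b13/b23; b12/b23; 0]
     [:: 0; 0; b23^-1; 0; 0] [:: 0;0;0;1;0] [:: 0;0; b34/b23; - b24/b23; 1].
have uP : P \in unitmx by apply: (unit_mxl (c := b23^-1)); rewrite ?invr_eq0 // /ldet /=; field.
have [x [p [q e]]] : exists x p q, P *m (alt5 b01 b02 b03 b04 b12 b13 b14 b23 b24 b34) *m P^T =
   alt5 x 0 0 p 0 0 q 1 0 0.
  do 3 eexists; rewrite /P; altring; by field.
apply: NF52_teq (nf52_end1 x p q); apply: (teq2_cgr uP _ e).
by rewrite /P; altring; field.
Qed.

(** Only the linear form [(m, k)] on the span of [e_3] and [e_4] is left to normalise: nonzero it
    becomes 13, zero it leaves [N52_1]. *)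
Lemma nf52_end2 x m k :
  NF52 (s2 (alt5 1 0 0 0 0 0 0 0 0 0) (alt5 x 1 0 0 0 m k 0 0 0)).
Proof.
have [m0|m0] := eqVneq m 0; last first.
  left; constructor 2.
  apply: (@teq2I _ _ _ _ _ _ (mx5 [:: 1; 0; 0; 0; 0] [:: 0; 1; 0; 0; 0] [:: 0; 0; 1; 0; 0]
    [:: 0; 0; 0; m^-1; 0] [:: 0; 0; 0; - k / m; 1]) 1 0 x 1).
  - by apply: (unit_mxl (c := m^-1)); rewrite ?invr_eq0 // /ldet /=; field.
  - by rewrite mul0r subr0 mulr1 oner_eq0.
  - by altring; field.
  - by altring; field.
have [k0|k0] := eqVneq k 0; last first.
  left; constructor 2.
  apply: (@teq2I _ _ _ _ _ _ (mx5 [:: 1; 0; 0; 0; 0] [:: 0; 1; 0; 0; 0] [:: 0; 0; 1; 0; 0]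
    [:: 0; 0; 0; 0; k^-1] [:: 0; 0; 0; 1; 0]) 1 0 x 1).
  - by apply: (unit_mxl (c := - k^-1)); rewrite ?oppr_eq0 ?invr_eq0 // /ldet /=; field.
  - by rewrite mul0r subr0 mulr1 oner_eq0.
  - by altring; field.
  by rewrite m0; altring; field.
left; constructor 1.
apply: (@teq2I _ _ _ _ _ _ 1%:M 1 0 x 1); rewrite ?unitmx1 //.
- by rewrite mul0r subr0 mulr1 oner_eq0.
- by rewrite trmx1 mul1mx mulmx1 scale1r scale0r addr0.
by rewrite trmx1 mul1mx mulmx1 m0 k0; altring; ring.
Qed.

Lemma nf52_b02 b01 b02 b03 b04 b12 b13 b14 : b02 != 0 ->
  NF52 (s2 (alt5 1 0 0 0 0 0 0 0 0 0) (alt5 b01 b02 b03 b04 b12 b13 b14 0 0 0)).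
Proof.
move=> b0; pose P := mx5 [:: 1; 0; 0; 0; 0] [:: - b12 / b02; 1; 0; 0; 0]
     [:: 0; 0; b02^-1; 0; 0] [:: 0; 0; - b03 / b02; 1; 0] [:: 0; 0; - b04 / b02; 0; 1].
have uP : P \in unitmx by apply: (unit_mxl (c := b02^-1)); rewrite ?invr_eq0 // /ldet /=; field.
have [x [m [k e]]] : exists x m k, P *m (alt5 b01 b02 b03 b04 b12 b13 b14 0 0 0) *m P^T =
   alt5 x 1 0 0 0 m k 0 0 0.
  do 3 eexists; rewrite /P; altring; by field.
apply: NF52_teq (nf52_end2 x m k); apply: (teq2_cgr uP _ e).
by rewrite /P; altring; field.
Qed.

(** The form 01 ignores [e_2], [e_3], [e_4], so the restriction of the second form to their span
    decides: nonzero leads to [nf52_b23], zero to [nf52_b02]. *)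
Lemma nf52_rank2 b01 b02 b03 b04 b12 b13 b14 b23 b24 b34 :
  tfree (s2 (alt5 1 0 0 0 0 0 0 0 0 0) (alt5 b01 b02 b03 b04 b12 b13 b14 b23 b24 b34)) ->
  NF52 (s2 (alt5 1 0 0 0 0 0 0 0 0 0) (alt5 b01 b02 b03 b04 b12 b13 b14 b23 b24 b34)).
Proof.
move=> fr.
have [z23|] := eqVneq b23 0; last exact: nf52_b23.
have [z24|n24] := eqVneq b24 0; last by apply: NF52_teq (nf52_swap34 _ _ _ _ _ _ _ _ _ _) (nf52_b23 _ _ _ _ _ _ _ _ _ n24).
have [z34|n34] := eqVneq b34 0; last first.
  apply: NF52_teq (nf52_swap23 _ _ _ _ _ _ _ _ _ _) _.
  by apply: NF52_teq (nf52_swap34 _ _ _ _ _ _ _ _ _ _) (nf52_b23 _ _ _ _ _ _ _ _ _ n34).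
have row0 c01 c02 c03 c04 c12 c13 c14 : [|| c02 != 0, c03 != 0 | c04 != 0] ->
    NF52 (s2 (alt5 1 0 0 0 0 0 0 0 0 0) (alt5 c01 c02 c03 c04 c12 c13 c14 0 0 0)).
  case/or3P=> n0.
  - exact: nf52_b02.
  - apply: NF52_teq (nf52_swap23 _ _ _ _ _ _ _ _ _ _) _; rewrite oppr0; exact: nf52_b02.
  apply: NF52_teq (nf52_swap34 _ _ _ _ _ _ _ _ _ _) _.
  apply: NF52_teq (nf52_swap23 _ _ _ _ _ _ _ _ _ _) _; rewrite !oppr0; exact: nf52_b02.
rewrite z23 z24 z34 in fr *.
have [|] := boolP [|| b02 != 0, b03 != 0 | b04 != 0]; first exact: row0.
have [h _|] := boolP [|| b12 != 0, b13 != 0 | b14 != 0].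
  by apply: NF52_teq (nf52_swap01 _ _ _ _ _ _ _ _ _ _) _; apply: row0.
rewrite !negb_or !negbK => /and3P[/eqP e12 /eqP e13 /eqP e14] /and3P[/eqP e02 /eqP e03 /eqP e04].
have : (\row_(k < 2) [:: - b01; 1]`_k : 'rV[K]_2) = 0.
  apply: fr; rewrite /s2 comb_sys2 !mxE /= e02 e03 e04 e12 e13 e14 -alt5_0.
  by altring; ring.
by move/rowP/(_ 1); rewrite !mxE /= => /eqP; rewrite oner_eq0.
Qed.

End NF52.

(** * Symplectic base changes and pencils containing a rank four form *)

Section Symplectic4.
Variable K : fieldType.
Hypothesis K2 : (2%:R : K) != 0.

Notation mx4 a b c d := (mxl 4 [:: a; b; c; d]).
Notation mx5 a b c d e := (mxl 5 [:: a; b; c; d; e]).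
Ltac alt4ring := rewrite ?cong4; do ?rewrite !alt4Z; rewrite ?alt4D /ev4; congr alt4.
Ltac alt5ring := rewrite ?cong5; do ?rewrite !alt5Z; rewrite ?alt5D /ev5; congr alt5.

Definition J4 : 'M[K]_4 := alt4 1 0 0 0 0 1.
Definition spcgr (B B' : 'M[K]_4) :=
  exists P, [/\ P \in unitmx, P *m J4 *m P^T = J4 & P *m B *m P^T = B'].

Lemma spcgr_trans B1 B2 B3 : spcgr B1 B2 -> spcgr B2 B3 -> spcgr B1 B3.
Proof.
move=> [P [uP PJ <-]] [Q [uQ QJ <-]]; exists (Q *m P); split.
- by rewrite unitmx_mul uP uQ.
- by rewrite trmx_mul -!mulmxA (mulmxA P) (mulmxA (P *m _)) PJ mulmxA.
by rewrite trmx_mul !mulmxA.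
Qed.

(** The last entry [- b] expresses orthogonality to [J4] for the polarised Pfaffian, which base
    changes fixing [J4] preserve. *)
Lemma spcgr_b02 b b02 b03 b12 b13 : b02 != 0 ->
  exists a, spcgr (alt4 b b02 b03 b12 b13 (- b)) (alt4 0 1 0 0 a 0).
Proof.
move=> b0; eexists; exists (mx4 [:: 1; 0; 0; 0] [:: - b12 / b02; 1; - b / b02; 0]
  [:: 0; 0; b02^-1; 0] [:: - b; 0; - b03; b02]); split.
- by apply: (unit_mxl (c := 1)); rewrite ?oner_eq0 // /ldet /=; field.
- by rewrite /J4; alt4ring; field.
by alt4ring; field.
Qed.

(* The last step moves [b (01 - 23)] to a frame where it has a nonzero [02] entry. *)
Lemma spcgr_nf b b02 b03 b12 b13 : alt4 b b02 b03 b12 b13 (- b) != 0 ->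
  exists a, spcgr (alt4 b b02 b03 b12 b13 (- b)) (alt4 0 1 0 0 a 0).
Proof.
have sw01 c c02 c03 c12 c13 : spcgr (alt4 c c02 c03 c12 c13 (- c)) (alt4 c c12 c13 (- c02) (- c03) (- c)).
  exists (mx4 [:: 0; 1; 0; 0] [:: -1; 0; 0; 0] [:: 0; 0; 1; 0] [:: 0; 0; 0; 1]); split.
  - by apply: (unit_mxl (c := 1)); rewrite ?oner_eq0 // /ldet /=; ring.
  - by rewrite /J4; alt4ring; ring.
  by alt4ring; ring.
have sw23 c c02 c03 c12 c13 : spcgr (alt4 c c02 c03 c12 c13 (- c)) (alt4 c c03 (- c02) c13 (- c12) (- c)).
  exists (mx4 [:: 1; 0; 0; 0] [:: 0; 1; 0; 0] [:: 0; 0; 0; 1] [:: 0; 0; -1; 0]); split.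
  - by apply: (unit_mxl (c := 1)); rewrite ?oner_eq0 // /ldet /=; ring.
  - by rewrite /J4; alt4ring; ring.
  by alt4ring; ring.
have top c c02 c03 c12 c13 : (c02 != 0) || (c03 != 0) ->
    exists a, spcgr (alt4 c c02 c03 c12 c13 (- c)) (alt4 0 1 0 0 a 0).
  case/orP=> n0; first exact: spcgr_b02.
  have [a ha] := spcgr_b02 c (- c02) c13 (- c12) n0.
  by exists a; apply: spcgr_trans ha.
have [|n1] := boolP ((b02 != 0) || (b03 != 0)); first by move=> h _; apply: top.
have [h _|n2] := boolP ((b12 != 0) || (b13 != 0)).
  by have [a ha] := top b _ _ (- b02) (- b03) h; exists a; apply: spcgr_trans ha.
move: n1 n2; rewrite !negb_or !negbK => /andP[/eqP-> /eqP->] /andP[/eqP-> /eqP->].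
have [->|b0 _] := eqVneq b 0; first by rewrite oppr0 alt4_0 eqxx.
suff [b03' [b12' [b13' h]]] : exists b03' b12' b13',
   spcgr (alt4 b 0 0 0 0 (- b)) (alt4 0 b b03' b12' b13' (- 0)).
  have [a ha] := spcgr_b02 0 b03' b12' b13' b0.
  by exists a; apply: spcgr_trans ha.
do 3 eexists; exists (mx4 [:: 1; 0; 1; 0] [:: 0; 2%:R^-1; 0; 2%:R^-1]
   [:: 0; 2%:R^-1; 0; - 2%:R^-1] [:: -1; 0; 1; 0]); split.
- by apply: (unit_mxl (c := 1)); rewrite ?oner_eq0 // /ldet /=; field.
- by rewrite /J4; alt4ring; field.
by alt4ring; field.
Qed.

Lemma alt5_block (a01 a02 a03 a12 a13 a23 : K) :
  alt5 a01 a02 a03 0 a12 a13 0 a23 0 0 = block_mx (alt4 a01 a02 a03 a12 a13 a23) 0 0 0 :> 'M[K]_(4 + 1).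
Proof.
apply/matrixP=> i j; rewrite -[i]splitK -[j]splitK; case: (split i) => a; case: (split j) => b /=.
- rewrite block_mxEul !mxE /=; case: a b => [a la] [b lb] /=.
  by move: a b la lb => [|[|[|[|a]]]] [|[|[|[|b]]]].
- rewrite block_mxEur !mxE /= ord1 addn0; case: a => [a la] /=.
  by move: a la => [|[|[|[|a]]]].
- rewrite block_mxEdl !mxE /= ord1 addn0; case: b => [b lb] /=.
  by move: b lb => [|[|[|[|b]]]] //= _; rewrite oppr0.
by rewrite block_mxEdr !mxE /= !ord1 addn0.
Qed.

Lemma block_cgr p q (P X : 'M[K]_p) :
  block_mx P 0 0 1%:M *m block_mx X 0 0 (0 : 'M_q) *m (block_mx P 0 0 1%:M)^T =
  block_mx (P *m X *m P^T) 0 0 0.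
Proof.
by rewrite tr_block_mx !mulmx_block !trmx0 trmx1 !(mulmx0, mul0mx, addr0, add0r, mulmx1, mul1mx).
Qed.

Lemma block_unit p q (P : 'M[K]_p) : P \in unitmx -> block_mx P 0 0 (1%:M : 'M_q) \in unitmx.
Proof. by move=> uP; rewrite unitmxE det_ublock det1 mulr1 -unitmxE. Qed.

Lemma nf52_2a b01 b02 b03 b12 b13 b23 :
  tfree (s2 (alt5 1 0 0 0 0 0 0 1 0 0) (alt5 b01 b02 b03 0 b12 b13 0 b23 0 0)) ->
  NF52 (s2 (alt5 1 0 0 0 0 0 0 1 0 0) (alt5 b01 b02 b03 0 b12 b13 0 b23 0 (0 : K))).
Proof.
(* [l] is the coefficient of the Pfaffian projection onto 01+23; subtracting that multiple leaves a
   form orthogonal to 01+23. *)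
pose l := (b01 + b23) / 2%:R; pose b := (b01 - b23) / 2%:R.
have e : alt5 b01 b02 b03 0 b12 b13 0 b23 0 0 =
   l *: alt5 1 0 0 0 0 0 0 1 0 0 + 1 *: alt5 b b02 b03 0 b12 b13 0 (- b) 0 0.
  by rewrite /l /b; alt5ring; field.
move=> fr.
have B0 : alt4 b b02 b03 b12 b13 (- b) != 0.
  apply/eqP=> B0.
  have : (\row_(k < 2) [:: - l; 1]`_k : 'rV[K]_2) = 0.
    apply: fr; rewrite /s2 comb_sys2 !mxE /= e !alt5_block B0 !scale1r block_mx0.
    by rewrite addr0 -scalerDl addNr scale0r.
  by move/rowP/(_ 1); rewrite !mxE /= => /eqP; rewrite oner_eq0.
have [a [P [uP PJ PB]]] := spcgr_nf B0.
have tF : teq (s2 (alt5 1 0 0 0 0 0 0 1 0 0) (alt5 b01 b02 b03 0 b12 b13 0 b23 0 0)) (N52_F a).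
  pose Q : 'M[K]_5 := block_mx P 0 0 (1%:M : 'M_1).
  have QJ : Q *m alt5 1 0 0 0 0 0 0 1 0 0 *m Q^T = alt5 1 0 0 0 0 0 0 1 0 0.
    by rewrite alt5_block; have := @block_cgr 4 1 P J4; rewrite PJ.
  have QB : Q *m alt5 b b02 b03 0 b12 b13 0 (- b) 0 0 *m Q^T = alt5 0 1 0 0 0 a 0 0 0 0.
    by rewrite !alt5_block; have := @block_cgr 4 1 P (alt4 b b02 b03 b12 b13 (- b)); rewrite PB.
  apply: (@teq2I _ 5 _ _ _ _ Q 1 0 l 1).
  - exact: (@block_unit 4 1 P uP).
  - by rewrite mul0r subr0 mulr1 oner_eq0.
  - by rewrite QJ scale1r scale0r addr0.
  by rewrite e mulmxDr mulmxDl -!scalemxAr -!scalemxAl QJ QB.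
have [a0|a0] := eqVneq a 0; last by right; exists a.
(* The pencil is now spanned by 01+23 and 02; exchanging [e_1] with [e_2], and the two forms, gives
   [N52_2]. *)
left; constructor 2; apply: teq_trans tF _; rewrite a0.
apply: (@teq2I _ 5 _ _ _ _ (mx5 [:: 1; 0; 0; 0; 0] [:: 0; 0; 1; 0; 0] [:: 0; 1; 0; 0; 0]
  [:: 0; 0; 0; 1; 0] [:: 0; 0; 0; 0; 1]) 0 1 1 0).
- by apply: (unit_mxl (c := -1)); rewrite ?oppr_eq0 ?oner_eq0 // /ldet /=; ring.
- by rewrite mul0r sub0r mulr1 oppr_eq0 oner_eq0.
- by alt5ring; ring.
by alt5ring; ring.
Qed.

(** A nonzero linear form [(m, k)] on the span of [e_2] and [e_3] is normalised by a base change of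
    determinant 1, which keeps 23. If it vanishes, exchanging [e_1] and [e_4] gives [N52_3]. *)
Lemma nf52_end3 m k :
  NF52 (s2 (alt5 1 0 0 0 0 0 0 1 0 0) (alt5 0 0 0 1 m k 0 0 0 (0 : K))).
Proof.
left; have [m0|m0] := eqVneq m 0; last first.
  constructor 4.
  apply: (@teq2_cgr _ 5 _ _ _ _ (mx5 [:: 1; 0; 0; 0; 0] [:: 0; 1; 0; 0; 0] [:: 0; 0; m^-1; 0; 0]
    [:: 0; 0; - k; m; 0] [:: 0; 0; 0; 0; 1])).
  - by apply: (unit_mxl (c := 1)); rewrite ?oner_eq0 // /ldet /=; field.
  - by alt5ring; field.
  by alt5ring; field.
have [k0|k0] := eqVneq k 0; last first.
  constructor 4; rewrite m0.
  apply: (@teq2_cgr _ 5 _ _ _ _ (mx5 [:: 1; 0; 0; 0; 0] [:: 0; 1; 0; 0; 0] [:: 0; 0; 0; k^-1; 0]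
    [:: 0; 0; - k; 0; 0] [:: 0; 0; 0; 0; 1])).
  - by apply: (unit_mxl (c := 1)); rewrite ?oner_eq0 // /ldet /=; field.
  - by alt5ring; field.
  by alt5ring; field.
constructor 3; rewrite m0 k0.
apply: (@teq2I _ 5 _ _ _ _ (mx5 [:: 1; 0; 0; 0; 0] [:: 0; 0; 0; 0; 1] [:: 0; 0; 1; 0; 0]
  [:: 0; 0; 0; 1; 0] [:: 0; 1; 0; 0; 0]) 0 1 1 0).
- by apply: (unit_mxl (c := -1)); rewrite ?oppr_eq0 ?oner_eq0 // /ldet /=; ring.
- by rewrite mul0r sub0r mulr1 oppr_eq0 oner_eq0.
- by alt5ring; ring.
by alt5ring; ring.
Qed.

Lemma nf52_b04 b01 b02 b03 b04 b12 b13 b14 b23 b24 b34 : b04 != 0 ->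
  NF52 (s2 (alt5 1 0 0 0 0 0 0 1 0 0) (alt5 b01 b02 b03 b04 b12 b13 b14 b23 b24 (b34 : K))).
Proof.
(* [P] preserves 01+23 and makes [e_4] pair with [e_0] only, with value 1. *)
move=> b0; pose P := mx5 [:: b04^-1; 0; 0; 0; 0] [:: - b14; b04; - b34; b24; 0]
  [:: - b24 / b04; 0; 1; 0; 0] [:: - b34 / b04; 0; 0; 1; 0] [:: 0; 0; 0; 0; 1].
have uP : P \in unitmx by apply: (unit_mxl (c := 1)); rewrite ?oner_eq0 // /ldet /=; field.
have [x01 [x02 [x03 [x12 [x13 [x23 e]]]]]] : exists x01 x02 x03 x12 x13 x23,
   P *m (alt5 b01 b02 b03 b04 b12 b13 b14 b23 b24 b34) *m P^T =
   alt5 x01 x02 x03 1 x12 x13 0 x23 0 0.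
  by do 6 eexists; rewrite /P; alt5ring; field.
apply: (@NF52_teq _ _ (s2 (alt5 1 0 0 0 0 0 0 1 0 0) (alt5 x01 x02 x03 1 x12 x13 0 x23 0 0))).
  by apply: (teq2_cgr uP _ e); rewrite /P; alt5ring; field.
apply: NF52_teq (nf52_end3 x12 x13).
(* [e_4] lies in the kernel of 01+23. Adding its multiples clears 02 and 03 and makes the 01 entry
   equal to the 23 entry, so that [x23] times the first form can be split off. *)
apply: (@teq2I _ 5 _ _ _ _ (mx5 [:: 1; 0; 0; 0; 0] [:: 0; 1; 0; 0; x23 - x01] [:: 0; 0; 1; 0; - x02]
  [:: 0; 0; 0; 1; - x03] [:: 0; 0; 0; 0; 1]) 1 0 x23 1).
- by apply: (unit_mxl (c := 1)); rewrite ?oner_eq0 // /ldet /=; ring.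
- by rewrite mul0r subr0 mulr1 oner_eq0.
- by alt5ring; ring.
by alt5ring; ring.
Qed.

(** Symmetries of 01+23 move a nonzero entry of the last column to 04; a zero column leaves a pencil
    of 4 x 4 matrices. *)
Lemma nf52_rank4 b01 b02 b03 b04 b12 b13 b14 b23 b24 b34 :
  tfree (s2 (alt5 1 0 0 0 0 0 0 1 0 0) (alt5 b01 b02 b03 b04 b12 b13 b14 b23 b24 b34)) ->
  NF52 (s2 (alt5 1 0 0 0 0 0 0 1 0 0) (alt5 b01 b02 b03 b04 b12 b13 b14 b23 b24 (b34 : K))).
Proof.
move=> fr.
have top c01 c02 c03 c04 c12 c13 c14 c23 c24 c34 : (c04 != 0) || (c14 != 0) ->
    NF52 (s2 (alt5 1 0 0 0 0 0 0 1 0 0) (alt5 c01 c02 c03 c04 c12 c13 c14 c23 c24 (c34 : K))).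
  case/orP=> n0; first exact: nf52_b04.
  apply: NF52_teq (nf52_b04 c01 c12 c13 (- c02) (- c03) (- c04) c23 c24 c34 n0).
  apply: (@teq2_cgr _ 5 _ _ _ _ (mx5 [:: 0; 1; 0; 0; 0] [:: -1; 0; 0; 0; 0] [:: 0; 0; 1; 0; 0]
    [:: 0; 0; 0; 1; 0] [:: 0; 0; 0; 0; 1])).
  - by apply: (unit_mxl (c := 1)); rewrite ?oner_eq0 // /ldet /=; ring.
  - by alt5ring; ring.
  by alt5ring; ring.
have [|] := boolP ((b04 != 0) || (b14 != 0)); first exact: top.
have [h _|] := boolP ((b24 != 0) || (b34 != 0)).
  apply: NF52_teq (top b23 (- b02) (- b12) b24 (- b03) (- b13) b34 b01 b04 b14 h).
  apply: (@teq2_cgr _ 5 _ _ _ _ (mx5 [:: 0; 0; 1; 0; 0] [:: 0; 0; 0; 1; 0] [:: 1; 0; 0; 0; 0]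
    [:: 0; 1; 0; 0; 0] [:: 0; 0; 0; 0; 1])).
  - by apply: (unit_mxl (c := 1)); rewrite ?oner_eq0 // /ldet /=; ring.
  - by alt5ring; ring.
  by alt5ring; ring.
rewrite !negb_or !negbK => /andP[/eqP e24 /eqP e34] /andP[/eqP e04 /eqP e14].
by rewrite e24 e34 e04 e14 in fr *; apply: nf52_2a.
Qed.

Lemma teq_cgr p q (M : 'I_q -> 'M[K]_p) (P : 'M[K]_p) : P \in unitmx ->
  teq M (fun k => P *m M k *m P^T).
Proof.
move=> uP; apply: (@teqI _ _ _ _ _ P 1%:M) => //; rewrite ?unitmx1 // => k.
by rewrite row1 comb_delta.
Qed.

Lemma tfree_neq0 p q (M : 'I_q -> 'M[K]_p) k : tfree M -> M k != 0.
Proof.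
move=> fM; apply/eqP=> Mk; have := fM (delta_mx 0 k); rewrite comb_delta => /(_ Mk).
by move/rowP/(_ k); rewrite !mxE !eqxx => /eqP; rewrite oner_eq0.
Qed.

Lemma Jn_5_1 : Jn K 5 1 = alt5 1 0 0 0 0 0 0 0 0 0.
Proof.
apply/matrixP=> -[i li] [j lj]; rewrite !mxE /=.
by move: i j li lj => [|[|[|[|[|i]]]]] [|[|[|[|[|j]]]]] //= _ _; rewrite oppr0.
Qed.
Lemma Jn_5_2 : Jn K 5 2 = alt5 1 0 0 0 0 0 0 1 0 0.
Proof.
apply/matrixP=> -[i li] [j lj]; rewrite !mxE /=.
by move: i j li lj => [|[|[|[|[|i]]]]] [|[|[|[|[|j]]]]] //= _ _; rewrite oppr0.
Qed.
Lemma Jn_4_1 : Jn K 4 1 = alt4 1 0 0 0 0 0.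
Proof.
apply/matrixP=> -[i li] [j lj]; rewrite !mxE /=.
by move: i j li lj => [|[|[|[|[|i]]]]] [|[|[|[|[|j]]]]] //= _ _; rewrite oppr0.
Qed.
Lemma Jn_4_2 : Jn K 4 2 = J4.
Proof.
apply/matrixP=> -[i li] [j lj]; rewrite !mxE /=.
by move: i j li lj => [|[|[|[|[|i]]]]] [|[|[|[|[|j]]]]] //= _ _; rewrite oppr0.
Qed.

Theorem nf52 (M : 'I_2 -> 'M[K]_5) : anti M -> tfree M -> NF52 M.
Proof.
move=> aM fM; have [r [r5 [P uP eP]]] := skew_nf K2 (aM 0).
have t1 := teq_trans (teq_cgr M uP) (sys2E _); rewrite eP in t1.
have aN : (P *m M 1 *m P^T)^T = - (P *m M 1 *m P^T).
  by rewrite !trmx_mul trmxK aM mulNmx mulmxN mulmxA.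
have fN := teq_free t1 fM.
have := tfree_neq0 0 fN; rewrite /s2 /sys /= => n0.
apply: (NF52_teq t1); move: n0; rewrite (alt5E K2 aN) in fN *.
case: r r5 fN {eP t1} => [|[|[|r]]] // _; first by rewrite Jn0 eqxx.
  by rewrite Jn_5_1 => fN _; apply: nf52_rank2.
by rewrite Jn_5_2 => fN _; apply: nf52_rank4.
Qed.

End Symplectic4.

(** * Nets in dimension four *)

Section NF43.
Variable K : fieldType.
Hypothesis K2 : (2%:R : K) != 0.

Notation mx4 a b c d := (mxl 4 [:: a; b; c; d]).
Notation J4 := (J4 K).
Ltac alt4ring := rewrite ?cong4; do ?rewrite !alt4Z; rewrite ?alt4D /ev4; congr alt4.

Definition phi4 (a : K) : 'M[K]_4 := alt4 0 1 0 0 a 0.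
Definition N43_1 : 'I_3 -> 'M[K]_4 := s3 (alt4 1 0 0 0 0 0) (alt4 0 1 0 0 0 0) (alt4 0 0 1 0 0 0).
Definition N43_2 : 'I_3 -> 'M[K]_4 := s3 (alt4 1 0 0 0 0 0) (alt4 0 1 0 0 0 0) (alt4 0 0 0 1 0 0).
Definition N43_U (a b : K) : 'I_3 -> 'M[K]_4 := s3 J4 (phi4 a) (alt4 0 0 1 (- b) 0 0).

Lemma teq3_cgr p (A B C A' B' C' : 'M[K]_p) P : P \in unitmx ->
  P *m A *m P^T = A' -> P *m B *m P^T = B' -> P *m C *m P^T = C' -> teq (s3 A B C) (s3 A' B' C').
Proof.
move=> uP hA hB hC; apply: (@teq3I _ _ _ _ _ _ _ _ P 1 0 1 0 0 1) => //.
- by rewrite !mulr1 oner_neq0.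
- by rewrite scale1r.
- by rewrite scale1r scale0r add0r.
by rewrite scale1r !scale0r !add0r.
Qed.

Lemma mulr2_inj (x y : K) : 2%:R * x = 2%:R * y -> x = y.
Proof. exact: (mulfI K2). Qed.

Lemma anti_cgr p (P X : 'M[K]_p) : X^T = - X -> (P *m X *m P^T)^T = - (P *m X *m P^T).
Proof. by move=> aX; rewrite !trmx_mul trmxK aX mulNmx mulmxN mulmxA. Qed.

Lemma pfp_J4J4 : pfp J4 J4 = 2%:R.
Proof. by rewrite pfp_alt4; ring. Qed.

(** The multiplier is read off at [J4], where [pfp] has the nonzero value 2. *)
Lemma spcgr_pfp P : P *m J4 *m P^T = J4 -> forall X Y, X^T = - X -> Y^T = - Y ->
  pfp (P *m X *m P^T) (P *m Y *m P^T) = pfp X Y.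
Proof.
move=> PJ; have [d hd] := pfp_cong K2 P.
have := hd _ _ (alt4_anti 1 0 0 0 0 1) (alt4_anti 1 0 0 0 0 1).
rewrite PJ pfp_J4J4 -[X in X = _]mul1r => /(mulIf K2) d1.
by move=> X Y aX aY; rewrite hd // -d1 mul1r.
Qed.

Lemma nf43_end a b C : C^T = - C -> pfp J4 C = 0 -> pfp (phi4 a) C = 0 -> pfp C C = - (2%:R * b) ->
  en C 0 3 != 0 -> teq (s3 J4 (phi4 a) C) (N43_U a b).
Proof.
move=> aC; rewrite (alt4E K2 aC) !en_mxl //=.
move: (en C 0 1) (en C 0 2) (en C 0 3) (en C 1 2) (en C 1 3) (en C 2 3) => g e c03 c12 c13 c23.
rewrite !pfp_alt4 !(mul0r, mul1r, add0r, addr0, sub0r, subr0) => h1 h2 h3 c0.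
have e23 : c23 = - g by apply/eqP; rewrite -addr_eq0 h1.
have e13 : c13 = - (a * e) by apply/eqP; rewrite -addr_eq0 -oppr_eq0 opprD h2.
have eb : b = g ^+ 2 - a * e ^+ 2 - c03 * c12.
  apply: mulr2_inj; apply: oppr_inj; rewrite -h3 e23 e13; ring.
rewrite e23 e13 eb.
(* A similitude: each of the three forms goes to [c03] times its normal form. *)
apply: (@teq3I _ _ _ _ _ _ _ _ (mx4 [:: 1; 0; 0; 0] [:: a * e; c03; 0; - g]
   [:: g; 0; c03; - e] [:: 0; 0; 0; 1]) c03 0 c03 0 0 c03).
- by apply: (unit_mxl (c := c03 ^+ 2)); rewrite ?expf_neq0 // /ldet /=; ring.
- by rewrite !mulf_neq0.
- by alt4ring; ring.
- by rewrite /phi4; alt4ring; ring.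
by rewrite /phi4; alt4ring; ring.
Qed.

(* The base changes [mu u] and [mt t] fix [J4] and [phi4 a]; unless all of them leave the [03] entry
   of [C] zero, [nf43_end] applies, and otherwise [C] is a multiple of [phi4 a]. *)
Lemma nf43_J4phi a b C : C^T = - C -> pfp J4 C = 0 -> pfp (phi4 a) C = 0 -> pfp C C = - (2%:R * b) ->
  tfree (s3 J4 (phi4 a) C) -> teq (s3 J4 (phi4 a) C) (N43_U a b).
Proof.
move=> aC h1 h2 h3 fr.
suff [P [uP PJ Pphi P3]] : exists P, [/\ P \in unitmx, P *m J4 *m P^T = J4,
    P *m phi4 a *m P^T = phi4 a & en (P *m C *m P^T) 0 3 != 0].
  apply: teq_trans (teq3_cgr uP PJ Pphi erefl) _.
  have aphi : (phi4 a)^T = - phi4 a by apply: alt4_anti.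
  have sp := spcgr_pfp PJ.
  apply: nf43_end => //; first exact: anti_cgr.
  - by rewrite -PJ sp // alt4_anti.
  - by rewrite -Pphi sp.
  by rewrite sp.
move: h1 h2 {h3} fr; rewrite (alt4E K2 aC).
move: (en C 0 1) (en C 0 2) (en C 0 3) (en C 1 2) (en C 1 3) (en C 2 3) => g e c03 c12 c13 c23.
rewrite !pfp_alt4 !(mul0r, mul1r, add0r, addr0, sub0r, subr0) => h1 h2 fr.
have e23 : c23 = - g by apply/eqP; rewrite -addr_eq0 h1.
have e13 : c13 = - (a * e) by apply/eqP; rewrite -addr_eq0 -oppr_eq0 opprD h2.
rewrite {}e23 {}e13 {h1 h2} in fr *.
have mu u : c03 - 2%:R * u * g + u ^+ 2 * c12 != 0 -> exists P, [/\ P \in unitmx,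
    P *m J4 *m P^T = J4, P *m phi4 a *m P^T = phi4 a &
    en (P *m alt4 g e c03 c12 (- (a * e)) (- g) *m P^T) 0 3 != 0].
  move=> nz; exists (mx4 [:: 1; 0; u; 0] [:: 0; 1; 0; 0] [:: 0; 0; 1; 0] [:: 0; - u; 0; 1]); split.
  - by apply: (unit_mxl (c := 1)); rewrite ?oner_eq0 // /ldet /=; ring.
  - by rewrite /J4; alt4ring; ring.
  - by rewrite /phi4; alt4ring; ring.
  rewrite cong4 en_mxl //= /ev4; apply: contra_neq nz => nz; rewrite -[RHS]nz; ring.
have mt t : c03 - 2%:R * a * t * e - a * t ^+ 2 * c12 != 0 -> exists P, [/\ P \in unitmx,
    P *m J4 *m P^T = J4, P *m phi4 a *m P^T = phi4 a &
    en (P *m alt4 g e c03 c12 (- (a * e)) (- g) *m P^T) 0 3 != 0].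
  move=> nz; exists (mx4 [:: 1; t; 0; 0] [:: 0; 1; 0; 0] [:: 0; 0; 1; 0] [:: 0; 0; - (a * t); 1]); split.
  - by apply: (unit_mxl (c := 1)); rewrite ?oner_eq0 // /ldet /=; ring.
  - by rewrite /J4; alt4ring; ring.
  - by rewrite /phi4; alt4ring; ring.
  rewrite cong4 en_mxl //= /ev4; apply: contra_neq nz => nz; rewrite -[RHS]nz; ring.
have [c0|] := eqVneq c03 0; last first.
  by move=> c0; apply: (mu 0); rewrite mulr0 mul0r subr0 expr2 mul0r mul0r addr0.
have [m1|] := eqVneq (c03 - 2%:R * 1 * g + 1 ^+ 2 * c12) 0; last exact: mu.
have [m2|] := eqVneq (c03 - 2%:R * (- 1) * g + (- 1) ^+ 2 * c12) 0; last exact: mu.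
have c120 : c12 = 0.
  apply: mulr2_inj; rewrite mulr0 -[RHS](addr0 0) -{1}m1 -m2 c0; ring.
have g0 : g = 0.
  by apply: mulr2_inj; rewrite mulr0 -oppr0 -[in RHS]m1 c0 c120; ring.
have [m3|] := eqVneq (c03 - 2%:R * a * 1 * e - a * 1 ^+ 2 * c12) 0; last exact: mt.
have ae : a * e = 0.
  by apply: mulr2_inj; rewrite mulr0 -oppr0 -[in RHS]m3 c0 c120; ring.
exfalso; rewrite c0 c120 g0 ae in fr.
have : (\row_(k < 3) [:: 0; - e; 1]`_k : 'rV[K]_3) = 0.
  apply: fr; rewrite /s3 comb_sys3 !mxE inordK //= /phi4; do ?rewrite !alt4Z; rewrite !alt4D -alt4_0.
  by congr alt4; rewrite ?mulrN ?mulNr ?[e * a]mulrC ?ae; ring.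
by move/rowP/(_ (inord 2)); rewrite !mxE inordK //= => /eqP; rewrite oner_eq0.
Qed.

Lemma nf43_J4 a b B C : B^T = - B -> C^T = - C -> pfp J4 B = 0 -> pfp J4 C = 0 -> pfp B C = 0 ->
  pfp B B = - (2%:R * a) -> pfp C C = - (2%:R * b) ->
  tfree (s3 J4 B C) -> teq (s3 J4 B C) (N43_U a b).
Proof.
move=> aB aC JB JC BC BB CC fr.
have [b01 [b02 [b03 [b12 [b13 eB]]]]] : exists b01 b02 b03 b12 b13, B = alt4 b01 b02 b03 b12 b13 (- b01).
  move: JB; rewrite (alt4E K2 aB) pfp_alt4 !(mul0r, mul1r, subr0, addr0) => /eqP.
  by rewrite addr_eq0 => /eqP->; do 5 eexists.
have B0 : alt4 b01 b02 b03 b12 b13 (- b01) != 0 by rewrite -eB; apply: (tfree_neq0 1 fr).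
have [a' [P [uP PJ PB]]] := spcgr_nf K2 B0; rewrite -eB in PB.
have sp := spcgr_pfp PJ.
(* Base changes fixing [J4] preserve [pfp], so [pfp B B] forces the parameter. *)
have ea : a' = a.
  have := sp _ _ aB aB; rewrite PB BB pfp_alt4 => h.
  by apply: mulr2_inj; apply: oppr_inj; rewrite -h; ring.
rewrite ea -/(phi4 a) in PB.
have tt := teq3_cgr uP PJ PB erefl; apply: (teq_trans (tt C)).
apply: nf43_J4phi; first exact: anti_cgr.
- by rewrite -PJ sp // alt4_anti.
- by rewrite -PB sp.
- by rewrite sp.
exact: teq_free (tt C) fr.
Qed.

(** The Witt-type step: a Gram matrix with nonzero leading entry determines the net. [A] has full
    rank and becomes [J4], which normalises the constant [c] to 2. *)
Lemma nf43_ab a b c A B C : A^T = - A -> B^T = - B -> C^T = - C -> c != 0 ->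
  pfp A A = c -> pfp A B = 0 -> pfp A C = 0 -> pfp B C = 0 ->
  pfp B B = - (c * a) -> pfp C C = - (c * b) ->
  tfree (s3 A B C) -> teq (s3 A B C) (N43_U a b).
Proof.
move=> aA aB aC c0 AA AB AC BC BB CC fr.
have [r [r4 [P uP eP]]] := skew_nf K2 aA.
have [d hd] := pfp_cong K2 P; have d0 := pfp_cong_unit K2 uP hd.
have dc : pfp (P *m A *m P^T) (P *m A *m P^T) = d * c by rewrite hd // AA.
have dc0 : d * c != 0 by rewrite mulf_neq0.
have PA : P *m A *m P^T = J4.
  rewrite eP in dc *; case: r r4 dc {eP} => [|[|[|r]]] // _; last by rewrite Jn_4_2.
    by rewrite Jn0 -alt4_0 pfp_alt4 => h; case/eqP: dc0; rewrite -h; ring.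
  by rewrite Jn_4_1 pfp_alt4 => h; case/eqP: dc0; rewrite -h; ring.
have dc2 : d * c = 2%:R by rewrite -dc PA pfp_J4J4.
have t1 := teq3_cgr uP PA erefl erefl; apply: (teq_trans (t1 B C)).
apply: nf43_J4; try exact: anti_cgr.
- by rewrite -PA hd // AB mulr0.
- by rewrite -PA hd // AC mulr0.
- by rewrite hd // BC mulr0.
- by rewrite hd // BB -dc2; ring.
- by rewrite hd // CC -dc2; ring.
exact: teq_free (t1 B C) fr.
Qed.

(** All elements of [U] are decomposable, so [U] is a plane on the Klein quadric. The outcomes are
    the two families of planes: forms divisible by a common vector, and forms on a common
    three-space. *)
Lemma nf43_iso01 B C : B^T = - B -> C^T = - C ->
  pfp (alt4 1 0 0 0 0 0) B = 0 -> pfp (alt4 1 0 0 0 0 0) C = 0 -> pfp B C = 0 ->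
  pfp B B = 0 -> pfp C C = 0 -> tfree (s3 (alt4 1 0 0 0 0 0) B C) ->
  teq (s3 (alt4 1 0 0 0 0 0) B C) N43_1 \/ teq (s3 (alt4 1 0 0 0 0 0) B C) N43_2.
Proof.
pose A : 'M[K]_4 := alt4 1 0 0 0 0 0; rewrite -/A.
pose G B C := [/\ B^T = - B, C^T = - C, pfp A B = 0, pfp A C = 0 & pfp B C = 0] /\
  [/\ pfp B B = 0, pfp C C = 0 & tfree (s3 A B C)].
pose R B C := teq (s3 A B C) N43_1 \/ teq (s3 A B C) N43_2.
suff GR B' C' : G B' C' -> R B' C' by move=> *; apply: GR.
have aA : A^T = - A by apply: alt4_anti.
(* With the claim stated for all pairs, a base change fixing [A] reduces it to a simpler pair. *)
have step P : P \in unitmx -> P *m A *m P^T = A -> forall B C,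
    (G (P *m B *m P^T) (P *m C *m P^T) -> R (P *m B *m P^T) (P *m C *m P^T)) -> G B C -> R B C.
  move=> uP PA B1 C1 hR [[aB aC AB AC BC] [BB CC fr]].
  have t1 := teq3_cgr uP PA (erefl (P *m B1 *m P^T)) (erefl (P *m C1 *m P^T)).
  have [d hd] := pfp_cong K2 P.
  suff : R (P *m B1 *m P^T) (P *m C1 *m P^T).
    by case=> h; [left | right]; apply: teq_trans h.
  apply: hR; split; split.
  - exact: anti_cgr.
  - exact: anti_cgr.
  - by rewrite -[X in pfp X _]PA hd // AB mulr0.
  - by rewrite -[X in pfp X _]PA hd // AC mulr0.
  - by rewrite hd // BC mulr0.
  - by rewrite hd // BB mulr0.
  - by rewrite hd // CC mulr0.
  exact: teq_free t1 fr.
have fin x C1 : G (alt4 x 1 0 0 0 0) C1 -> R (alt4 x 1 0 0 0 0) C1.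
  move=> [[_ aC _ + +] [_]]; rewrite (alt4E K2 aC) !pfp_alt4.
  move: (en C1 0 1) (en C1 0 2) (en C1 0 3) (en C1 1 2) (en C1 1 3) (en C1 2 3) => g e c03 c12 c13 c23.
  move=> h23 h13 hCC.
  have e23 : c23 = 0 by rewrite -[RHS]h23; ring.
  have e13 : c13 = 0 by apply: oppr_inj; rewrite oppr0 -[RHS]h13 e23; ring.
  (* Which of the two factors vanishes distinguishes the two families. *)
  have : 2%:R * (c03 * c12) = 0 by rewrite -[RHS]hCC e13 e23; ring.
  move/eqP; rewrite e13 e23 {e13 e23 h23 h13 hCC} !mulf_eq0 (negPf K2) /= => /orP[] /eqP->.
    move=> fr; right; have [c0|c0] := eqVneq c12 0.
      have : (\row_(k < 3) [:: e * x - g; - e; 1]`_k : 'rV[K]_3) = 0.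
        apply: fr; rewrite /s3 comb_sys3 !mxE inordK //= /A c0; do ?rewrite !alt4Z; rewrite !alt4D -alt4_0.
        by congr alt4; ring.
      by move/rowP/(_ (inord 2)); rewrite !mxE inordK //= => /eqP; rewrite oner_eq0.
    apply: (@teq3I _ _ _ _ _ _ _ _ 1%:M 1 x 1 g e c12); rewrite ?unitmx1 ?trmx1 ?mulmx1 ?mul1mx //.
    - by rewrite !mul1r.
    - by rewrite scale1r.
    - by alt4ring; ring.
    by alt4ring; ring.
  move=> fr; left; have [c0|c0] := eqVneq c03 0.
    have : (\row_(k < 3) [:: e * x - g; - e; 1]`_k : 'rV[K]_3) = 0.
      apply: fr; rewrite /s3 comb_sys3 !mxE inordK //= /A c0; do ?rewrite !alt4Z; rewrite !alt4D -alt4_0.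
      by congr alt4; ring.
    by move/rowP/(_ (inord 2)); rewrite !mxE inordK //= => /eqP; rewrite oner_eq0.
  apply: (@teq3I _ _ _ _ _ _ _ _ 1%:M 1 x 1 g e c03); rewrite ?unitmx1 ?trmx1 ?mulmx1 ?mul1mx //.
  - by rewrite !mul1r.
  - by rewrite scale1r.
  - by alt4ring; ring.
  by alt4ring; ring.
have b02P b01 b02 b03 b12 b13 b23 C1 : b02 != 0 -> G (alt4 b01 b02 b03 b12 b13 b23) C1 ->
   R (alt4 b01 b02 b03 b12 b13 b23) C1.
  move=> b0 g; have [[_ _ + _ _] [+ _ _]] := g; rewrite !pfp_alt4.
  move=> h23 hBB; have e23 : b23 = 0 by rewrite -[RHS]h23; ring.
  have e13 : b13 = b03 * b12 / b02.
    apply: (mulfI b0); apply: mulr2_inj; apply/eqP; rewrite -subr_eq0 -oppr_eq0; apply/eqP.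
    by rewrite -[RHS]hBB e23; field.
  move: g; rewrite e23 e13.
  pose P := mx4 [:: 1; 0; 0; 0] [:: - b12 / b02; 1; 0; 0] [:: 0; 0; b02^-1; 0] [:: 0; 0; - b03 / b02; 1].
  apply: (step P).
  - by apply: (unit_mxl (c := b02^-1)); rewrite ?invr_eq0 // /ldet /=; field.
  - by rewrite /P /A; alt4ring; field.
  have -> : P *m alt4 b01 b02 b03 b12 (b03 * b12 / b02) 0 *m P^T = alt4 b01 1 0 0 0 0.
    by rewrite /P; alt4ring; field.
  exact: fin.
have topP b01 b02 b03 b12 b13 b23 C1 : (b02 != 0) || (b03 != 0) -> G (alt4 b01 b02 b03 b12 b13 b23) C1 ->
   R (alt4 b01 b02 b03 b12 b13 b23) C1.
  case/orP=> n0; first exact: b02P.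
  apply: (step (mx4 [:: 1; 0; 0; 0] [:: 0; 1; 0; 0] [:: 0; 0; 0; 1] [:: 0; 0; 1; 0])).
  - by apply: (unit_mxl (c := -1)); rewrite ?oppr_eq0 ?oner_eq0 // /ldet /=; ring.
  - by rewrite /A; alt4ring; ring.
  rewrite !cong4; apply: b02P; rewrite /ev4.
  by apply: contra_neq n0 => n0; rewrite -[RHS]n0; ring.
move=> g; have aB : B'^T = - B' by case: g => -[].
rewrite (alt4E K2 aB) in g *.
move: (en B' 0 1) (en B' 0 2) (en B' 0 3) (en B' 1 2) (en B' 1 3) (en B' 2 3) g {aB}
  => b01 b02 b03 b12 b13 b23.
have [h|n1] := boolP ((b02 != 0) || (b03 != 0)); first exact: topP.
have [h|n2] := boolP ((b12 != 0) || (b13 != 0)).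
  apply: (step (mx4 [:: 0; 1; 0; 0] [:: -1; 0; 0; 0] [:: 0; 0; 1; 0] [:: 0; 0; 0; 1])).
  - by apply: (unit_mxl (c := 1)); rewrite ?oppr_eq0 ?oner_eq0 // /ldet /=; ring.
  - by rewrite /A; alt4ring; ring.
  rewrite !cong4; apply: topP; rewrite /ev4; case/orP: h => n0; apply/orP; [left|right];
  by apply: contra_neq n0 => n0; rewrite -[RHS]n0; ring.
move: n1 n2; rewrite !negb_or !negbK => /andP[/eqP-> /eqP->] /andP[/eqP-> /eqP->] [[_ _ + _ _] [_ _ fr]].
rewrite pfp_alt4 => h23; have e23 : b23 = 0 by rewrite -[RHS]h23; ring.
rewrite e23 in fr.
have : (\row_(k < 3) [:: - b01; 1; 0]`_k : 'rV[K]_3) = 0.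
  apply: fr; rewrite /s3 comb_sys3 !mxE inordK //= /A scale0r addr0.
  do ?rewrite !alt4Z; rewrite !alt4D -alt4_0; by congr alt4; ring.
by move/rowP/(_ 1); rewrite !mxE /= => /eqP; rewrite oner_eq0.
Qed.

Lemma nf43_iso A B C : A^T = - A -> B^T = - B -> C^T = - C ->
  pfp A A = 0 -> pfp A B = 0 -> pfp A C = 0 -> pfp B C = 0 -> pfp B B = 0 -> pfp C C = 0 ->
  tfree (s3 A B C) -> teq (s3 A B C) N43_1 \/ teq (s3 A B C) N43_2.
Proof.
move=> aA aB aC AA AB AC BC BB CC fr.
have [r [r4 [P uP eP]]] := skew_nf K2 aA.
have [d hd] := pfp_cong K2 P.
have t1 := teq3_cgr uP eP (erefl (P *m B *m P^T)) (erefl (P *m C *m P^T)).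
have fr1 := teq_free t1 fr; have := tfree_neq0 0 fr1; rewrite /s3 /sys /=.
have hA : pfp (Jn K 4 r) (Jn K 4 r) = 0 by rewrite -eP hd // AA mulr0.
have hB : pfp (Jn K 4 r) (P *m B *m P^T) = 0 by rewrite -eP hd // AB mulr0.
have hC : pfp (Jn K 4 r) (P *m C *m P^T) = 0 by rewrite -eP hd // AC mulr0.
case: r r4 {eP} t1 fr1 hA hB hC => [|[|[|r]]] // _ t1 fr1 hA hB hC; first by rewrite Jn0 eqxx.
- move=> _; rewrite Jn_4_1 in t1 fr1 hA hB hC.
  suff [h|h] : teq (s3 (alt4 1 0 0 0 0 0) (P *m B *m P^T) (P *m C *m P^T)) N43_1 \/
    teq (s3 (alt4 1 0 0 0 0 0) (P *m B *m P^T) (P *m C *m P^T)) N43_2.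
  + by left; apply: teq_trans h.
  + by right; apply: teq_trans h.
  apply: nf43_iso01 => //.
  + exact: anti_cgr.
  + exact: anti_cgr.
  + by rewrite hd // BC mulr0.
  + by rewrite hd // BB mulr0.
  by rewrite hd // CC mulr0.
(* Rank four is impossible because [J4] is not isotropic. *)
by rewrite Jn_4_2 pfp_J4J4 in hA; have := K2; rewrite hA eqxx.
Qed.

(** Taking [e_2] to [e_3] and [e_3] to minus [e_2] fixes 01+23 and carries 03-b12 to 02+b13. *)
Lemma N43_U_swap b : teq (N43_U 0 b) (N43_U b 0).
Proof.
apply: (@teq_trans _ _ _ _ (s3 J4 (alt4 0 0 1 (- b) 0 0) (phi4 0))).
  apply: (@teqI _ _ _ _ _ 1%:M (mxl 3 [:: [:: 1; 0; 0]; [:: 0; 0; 1]; [:: 0; 1; 0]])).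
  - exact: unitmx1.
  - by apply: (unit_mxl (c := -1)); rewrite ?oppr_eq0 ?oner_eq0 // /ldet /=; ring.
  move=> -[[|[|[|k]]] lk] //=; rewrite /s3 comb_sys3 !mxE inordK //= trmx1 mul1mx mulmx1;
  by rewrite !scale0r scale1r ?add0r ?addr0.
apply: (@teq3I _ _ _ _ _ _ _ _ (mx4 [:: 1; 0; 0; 0] [:: 0; 1; 0; 0] [:: 0; 0; 0; 1] [:: 0; 0; -1; 0])
  1 0 1 0 0 (-1)).
- by apply: (unit_mxl (c := 1)); rewrite ?oner_eq0 // /ldet /=; ring.
- by rewrite !mul1r oppr_eq0 oner_eq0.
- by rewrite /J4; alt4ring; ring.
- by rewrite /phi4; alt4ring; ring.
by rewrite /phi4; alt4ring; ring.
Qed.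

Lemma teq3_swap01 p (A B C : 'M[K]_p) : teq (s3 A B C) (s3 B A C).
Proof.
apply: (@teqI _ _ _ _ _ 1%:M (mxl 3 [:: [:: 0; 1; 0]; [:: 1; 0; 0]; [:: 0; 0; 1]])).
- exact: unitmx1.
- by apply: (unit_mxl (c := -1)); rewrite ?oppr_eq0 ?oner_eq0 // /ldet /=; ring.
move=> -[[|[|[|k]]] lk] //=; rewrite /s3 comb_sys3 !mxE inordK //= trmx1 mul1mx mulmx1;
by rewrite !scale0r scale1r ?add0r ?addr0.
Qed.

Lemma teq3_swap02 p (A B C : 'M[K]_p) : teq (s3 A B C) (s3 C B A).
Proof.
apply: (@teqI _ _ _ _ _ 1%:M (mxl 3 [:: [:: 0; 0; 1]; [:: 0; 1; 0]; [:: 1; 0; 0]])).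
- exact: unitmx1.
- by apply: (unit_mxl (c := -1)); rewrite ?oppr_eq0 ?oner_eq0 // /ldet /=; ring.
move=> -[[|[|[|k]]] lk] //=; rewrite /s3 comb_sys3 !mxE inordK //= trmx1 mul1mx mulmx1;
by rewrite !scale0r scale1r ?add0r ?addr0.
Qed.

Lemma nf43_abd A B C : A^T = - A -> B^T = - B -> C^T = - C -> pfp A A != 0 ->
  pfp A B = 0 -> pfp A C = 0 -> pfp B C = 0 -> tfree (s3 A B C) ->
  exists a b, teq (s3 A B C) (N43_U a b).
Proof.
move=> aA aB aC c0 AB AC BC fr.
exists (- pfp B B / pfp A A), (- pfp C C / pfp A A).
by apply: (nf43_ab aA aB aC c0) => //; rewrite mulNr mulrN opprK mulrC mulfVK.
Qed.

Lemma teq_basis p q (M : 'I_q -> 'M[K]_p) (h : 'M_q) : h \in unitmx ->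
  teq M (fun k => comb M (row k h)).
Proof.
move=> uh; apply/teq_sym/(@teqI _ _ _ _ _ 1%:M h) => //; first exact: unitmx1.
by move=> k; rewrite trmx1 mul1mx mulmx1.
Qed.

Lemma nf43_raw (M : 'I_3 -> 'M[K]_4) : anti M -> tfree M ->
  [\/ teq M N43_1, teq M N43_2 | exists a b, teq M (N43_U a b)].
Proof.
move=> aM fM.
have sG : (gram M)^T = gram M by apply/matrixP=> k l; rewrite !mxE pfp_sym.
have [d [h uh hd]] := sym_diag K2 sG.
have t0 := teq_basis M uh; move: t0; set M' := fun k => _ => t0.
have gM' : gram M' = diag_mx d.
  rewrite -hd -[LHS]scale1r; apply: (@gram_cong _ _ _ _ 1%:M).
    by move=> k l; rewrite trmx1 !mul1mx !mulmx1 mul1r.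
  move=> w; rewrite trmx1 mul1mx mulmx1 (mulmx_sum_row w h) linear_sum.
  by apply: eq_bigr => k _; rewrite linearZ.
have aM' k : (M' k)^T = - M' k by apply: comb_anti.
have pM' k l : pfp (M' k) (M' l) = d 0 k *+ (k == l).
  by have := congr1 (fun X : 'M_3 => X k l) gM'; rewrite !mxE.
have t1 := teq_trans t0 (sys3E M'); have fr := teq_free t1 fM.
have p01 := pM' 0 1; have p02 := pM' 0 (inord 2); have p12 := pM' 1 (inord 2).
have n2 : (0 == inord 2 :> 'I_3) = false by rewrite -val_eqE /= inordK.
have n12 : (1 == inord 2 :> 'I_3) = false by rewrite -val_eqE /= inordK.
rewrite n2 in p02; rewrite n12 in p12.
(* A nonzero diagonal entry is moved to the first place; if there is none, [U] is totally
   isotropic. *)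
have [z0|z0] := eqVneq (pfp (M' 0) (M' 0)) 0; last first.
  have [a [b h1]] := nf43_abd (aM' _) (aM' _) (aM' _) z0 p01 p02 p12 fr.
  by constructor 3; exists a, b; apply: teq_trans h1.
have [z1|z1] := eqVneq (pfp (M' 1) (M' 1)) 0; last first.
  have t2 := teq_trans t1 (teq3_swap01 _ _ _).
  have [|a [b h1]] := nf43_abd (aM' _) (aM' _) (aM' _) z1 _ p12 p02 (teq_free t2 fM).
    by rewrite pfp_sym.
  by constructor 3; exists a, b; apply: teq_trans h1.
have [z2|z2] := eqVneq (pfp (M' (inord 2)) (M' (inord 2))) 0; last first.
  have t2 := teq_trans t1 (teq3_swap02 _ _ _).
  have [|||a [b h1]] := nf43_abd (aM' _) (aM' _) (aM' _) z2 _ _ _ (teq_free t2 fM); rewrite 1?pfp_sym //.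
  by constructor 3; exists a, b; apply: teq_trans h1.
have [h1|h1] := nf43_iso (aM' _) (aM' _) (aM' _) z0 p01 p02 p12 z1 z2 fr.
  by constructor 1; apply: teq_trans h1.
by constructor 2; apply: teq_trans h1.
Qed.

Theorem nf43 (M : 'I_3 -> 'M[K]_4) : anti M -> tfree M ->
  [\/ teq M N43_1, teq M N43_2 | teq M (N43_U 0 0)] \/
  ((exists2 a, a != 0 & teq M (N43_U a 0)) \/
  exists a b, [/\ a != 0, b != 0 & teq M (N43_U a b)]).
Proof.
move=> aM fM; have [h|h|[a [b h]]] := nf43_raw aM fM.
- by left; constructor 1.
- by left; constructor 2.
have [a0|a0] := eqVneq a 0; have [b0|b0] := eqVneq b 0.
- by left; constructor 3; rewrite a0 b0 in h.
- by right; left; exists b => //; apply: teq_trans (N43_U_swap b); rewrite -a0.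
- by right; left; exists a => //; rewrite -b0.
by right; right; exists a, b.
Qed.

Definition N61 r : 'I_1 -> 'M[K]_6 := fun=> Jn K 6 r.

Theorem nf61 (M : 'I_1 -> 'M[K]_6) : anti M -> tfree M ->
  [\/ teq M (N61 1), teq M (N61 2) | teq M (N61 3)].
Proof.
move=> aM fM; have [r [r6 [P uP eP]]] := skew_nf K2 (aM 0).
have t1 : teq M (N61 r).
  apply: teq_trans (teq_cgr M uP) _; apply: teq_ext => k.
  by rewrite (ord1 k) eP.
have := tfree_neq0 0 (teq_free t1 fM); rewrite /N61.
case: r r6 t1 {eP} => [|[|[|[|r]]]] // _ t1; first by rewrite Jn0 eqxx.
- by constructor 1.
- by constructor 2.
by constructor 3.
Qed.

End NF43.

(** * Invariants of systems *)

Section Invariants.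
Variable K : fieldType.

Lemma s2_anti p (A B : 'M[K]_p) : A^T = - A -> B^T = - B -> anti (s2 A B).
Proof. by move=> aA aB [[|[|k]] lk]. Qed.

Lemma s3_anti p (A B C : 'M[K]_p) : A^T = - A -> B^T = - B -> C^T = - C -> anti (s3 A B C).
Proof. by move=> aA aB aC [[|[|[|k]]] lk]. Qed.

Lemma en_comb2 p (A B : 'M[K]_p.+1) w i j :
  en (comb (s2 A B) w) i j = w 0 0 * en A i j + w 0 1 * en B i j.
Proof. by rewrite /s2 comb_sys2 /en !mxE. Qed.

Lemma en_comb3 p (A B C : 'M[K]_p.+1) w i j :
  en (comb (s3 A B C) w) i j = w 0 0 * en A i j + w 0 1 * en B i j + w 0 (inord 2) * en C i j.
Proof. by rewrite /s3 comb_sys3 /en !mxE. Qed.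

Lemma en0 p i j : en (0 : 'M[K]_p.+1) i j = 0. Proof. by rewrite /en mxE. Qed.

Lemma tfree2 p (A B : 'M[K]_p.+1) i j k l :
  en A i j = 1 -> en B i j = 0 -> en A k l = 0 -> en B k l = 1 -> tfree (s2 A B).
Proof.
move=> A1 B0 A0 B1 w w0.
have := congr1 (fun X => en X i j) w0; rewrite en_comb2 A1 B0 en0 mulr0 addr0 mulr1 => e0.
have := congr1 (fun X => en X k l) w0; rewrite en_comb2 A0 B1 en0 mulr0 add0r mulr1 => e1.
by apply/rowP=> -[[|[|n]] ln] //; rewrite mxE; [rewrite -[RHS]e0|rewrite -[RHS]e1];
  congr (w _ _); apply: val_inj.
Qed.

Lemma tfree3 p (A B C : 'M[K]_p.+1) i j k l m o :
  en A i j = 1 -> en B i j = 0 -> en C i j = 0 ->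
  en A k l = 0 -> en B k l = 1 -> en C k l = 0 ->
  en A m o = 0 -> en B m o = 0 -> en C m o = 1 -> tfree (s3 A B C).
Proof.
move=> A1 B0 C0 A0' B1 C0' A0'' B0'' C1 w w0.
have := congr1 (fun X => en X i j) w0; rewrite en_comb3 A1 B0 C0 en0 !mulr0 !addr0 mulr1 => e0.
have := congr1 (fun X => en X k l) w0; rewrite en_comb3 A0' B1 C0' en0 !mulr0 add0r addr0 mulr1 => e1.
have := congr1 (fun X => en X m o) w0; rewrite en_comb3 A0'' B0'' C1 en0 !mulr0 !add0r mulr1 => e2.
by apply/rowP=> -[[|[|[|n]]] ln] //; rewrite mxE; [rewrite -[RHS]e0|rewrite -[RHS]e1|rewrite -[RHS]e2];
  congr (w _ _); apply: val_inj => /=; rewrite ?inordK.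
Qed.

Lemma N52_1_ok : anti (N52_1 K) /\ tfree (N52_1 K).
Proof. by split; [apply: s2_anti; apply: alt5_anti | apply: (@tfree2 _ _ _ 0 1 0 2); rewrite en_mxl]. Qed.
Lemma N52_2_ok : anti (N52_2 K) /\ tfree (N52_2 K).
Proof. by split; [apply: s2_anti; apply: alt5_anti | apply: (@tfree2 _ _ _ 0 1 0 2); rewrite en_mxl]. Qed.
Lemma N52_3_ok : anti (N52_3 K) /\ tfree (N52_3 K).
Proof. by split; [apply: s2_anti; apply: alt5_anti | apply: (@tfree2 _ _ _ 0 1 0 4); rewrite en_mxl]. Qed.
Lemma N52_4_ok : anti (N52_4 K) /\ tfree (N52_4 K).
Proof. by split; [apply: s2_anti; apply: alt5_anti | apply: (@tfree2 _ _ _ 0 1 0 4); rewrite en_mxl]. Qed.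
Lemma N52_F_ok (a : K) : anti (N52_F a) /\ tfree (N52_F a).
Proof. by split; [apply: s2_anti; apply: alt5_anti | apply: (@tfree2 _ _ _ 0 1 0 2); rewrite en_mxl]. Qed.
Lemma N43_1_ok : anti (N43_1 K) /\ tfree (N43_1 K).
Proof. by split; [apply: s3_anti; apply: alt4_anti | apply: (@tfree3 _ _ _ _ 0 1 0 2 0 3); rewrite en_mxl]. Qed.
Lemma N43_2_ok : anti (N43_2 K) /\ tfree (N43_2 K).
Proof. by split; [apply: s3_anti; apply: alt4_anti | apply: (@tfree3 _ _ _ _ 0 1 0 2 1 2); rewrite en_mxl]. Qed.
Lemma N43_U_ok (a b : K) : anti (N43_U a b) /\ tfree (N43_U a b).
Proof. by split; [apply: s3_anti; apply: alt4_anti | apply: (@tfree3 _ _ _ _ 0 1 0 2 0 3); rewrite en_mxl]. Qed.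

Lemma Jn_anti p r : (Jn K p r)^T = - Jn K p r.
Proof.
apply/matrixP=> i j; rewrite !mxE; do 2 case: ifP => //; rewrite ?opprK ?oppr0 //.
by move=> /and3P[/eqP-> _ _] /and3P[]; rewrite -[X in X == _]addn0 -addn2 eqn_add2l.
Qed.

Lemma N61_ok r : (0 < r)%N -> anti (N61 K r) /\ tfree (N61 K r).
Proof.
move=> r0; split=> [k|w]; first exact: Jn_anti.
rewrite /comb big_ord1 => /(congr1 (fun X => en X 0 1)); rewrite /en !mxE !inordK //=.
rewrite (_ : (1 < r.*2)%N) ?mulr1 => [e|]; last by case: r r0 => // r _; rewrite doubleS.
by apply/rowP=> k; rewrite ord1 mxE.
Qed.

Definition radical p q (M : 'I_q -> 'M[K]_p) := exists2 x : 'rV[K]_p, x != 0 & forall k, x *m M k = 0.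

Lemma radical_teq p q (M N : 'I_q -> 'M[K]_p) : teq M N -> radical M -> radical N.
Proof.
move=> [P [h [uP uh PM]]] [x x0 xM]; exists (x *m invmx P).
  by apply: contra_neq x0 => xP; rewrite -(mulmxKV uP x) xP mul0mx.
move=> k; rewrite -(comb_delta N) -[delta_mx 0 k](mulmxKV uh) -PM !mulmxA mulmxKV //.
by rewrite /comb mulmx_sumr big1 ?mul0mx // => l _; rewrite -scalemxAr xM scaler0.
Qed.

(** The matrices of products of two one-forms. *)
Definition decomposable p (X : 'M[K]_p) := exists u v : 'rV[K]_p, X = u^T *m v - v^T *m u.

Lemma decomposable_cgr p (P X : 'M[K]_p) : decomposable X -> decomposable (P *m X *m P^T).
Proof.
move=> [u [v ->]]; exists (u *m P^T), (v *m P^T).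
by rewrite mulmxBr mulmxBl !trmx_mul !trmxK !mulmxA.
Qed.

Lemma plucker p (X : 'M[K]_p.+1) i j k l : decomposable X ->
  en X i j * en X k l - en X i k * en X j l + en X i l * en X j k = 0.
Proof.
move=> [u [v ->]]; rewrite /en !mxE !big_ord1 !mxE; ring.
Qed.

Lemma alldec_teq p q (M N : 'I_q -> 'M[K]_p) : teq M N ->
  (forall w, decomposable (comb M w)) -> forall w, decomposable (comb N w).
Proof.
move=> [P [h [uP uh PM]]] dM w; rewrite -[w](mulmxKV uh) -PM; exact: decomposable_cgr.
Qed.

Lemma hasdec_teq p q (M N : 'I_q -> 'M[K]_p) : teq M N ->
  (exists2 w, w != 0 & decomposable (comb M w)) -> exists2 w, w != 0 & decomposable (comb N w).
Proof.
move=> [P [h [uP uh PM]]] [w w0 dw]; exists (w *m h).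
  by apply: contra_neq w0 => wh; rewrite -(mulmxK uh w) wh mul0mx.
by rewrite -PM; apply: decomposable_cgr.
Qed.

Lemma dec_elem p (i j : 'I_p) (c : K) : decomposable (c *: (delta_mx i j - delta_mx j i)).
Proof.
exists (c *: delta_mx 0 i), (delta_mx 0 j).
by rewrite linearZ /= !trmx_delta -scalemxAl -scalemxAr !mul_delta_mx scalerBr.
Qed.

Lemma Jn1_dec c : decomposable (c *: Jn K 6 1).
Proof.
suff -> : Jn K 6 1 = delta_mx (inord 0) (inord 1) - delta_mx (inord 1) (inord 0) by apply: dec_elem.
apply/matrixP=> -[i li] [j lj]; rewrite !mxE -!val_eqE /= !inordK //.
by move: i j li lj => [|[|[|[|[|[|i]]]]]] [|[|[|[|[|[|j]]]]]] //= _ _; rewrite ?subr0 ?sub0r ?oppr0.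
Qed.

Lemma alt5_01_dec : decomposable (alt5 1 0 0 0 0 0 0 0 0 0 : 'M[K]_5).
Proof.
suff -> : alt5 1 0 0 0 0 0 0 0 0 0 = 1 *: (delta_mx (inord 0) (inord 1) - delta_mx (inord 1) (inord 0)) :> 'M[K]_5
  by apply: dec_elem.
rewrite scale1r; apply/matrixP=> -[i li] [j lj]; rewrite !mxE -!val_eqE /= !inordK //.
by move: i j li lj => [|[|[|[|[|i]]]]] [|[|[|[|[|j]]]]] //= _ _; rewrite ?subr0 ?sub0r ?oppr0.
Qed.

Lemma comb_N61 r w : comb (N61 K r) w = w 0 0 *: Jn K 6 r.
Proof. by rewrite /comb big_ord1. Qed.

(** A rank two form spans decomposable elements only, whereas for larger rank the Pluecker relation
    on the indices 0, 1, 2, 3 fails. *)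
Lemma N61_1_not r : (1 < r)%N -> ~ teq (N61 K 1) (N61 K r).
Proof.
move=> r1 /alldec_teq h.
have d1 w : decomposable (comb (N61 K 1) w) by rewrite comb_N61; apply: Jn1_dec.
have := plucker 0 1 2 3 (h d1 (const_mx 1)).
rewrite comb_N61 mxE scale1r /en !mxE !inordK //= !(mul0r, addr0, subr0).
case: r r1 {h} => [|[|r]] // _; rewrite !doubleS /= mulr1 => /eqP.
by rewrite oner_eq0.
Qed.

Lemma Jn_unit r : Jn K r.*2 r \in unitmx.
Proof.
elim: r => [|r IHr]; first by rewrite unitmxE det_mx00 unitr1.
have := JnS K r.*2 r => e; rewrite doubleS.
suff : Jn K (2 + r.*2) r.+1 \in unitmx by [].
by rewrite e unitmxE det_ublock unitrM -!unitmxE IHr J2_unit.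
Qed.

(** The rank four form kills [e_5]; the rank six form is nondegenerate. *)
Lemma N61_23_not : ~ teq (N61 K 2) (N61 K 3).
Proof.
move=> /radical_teq h; case: h.
  exists (delta_mx 0 (inord 5)) => [|k].
    by apply/matrix0Pn; exists 0, (inord 5); rewrite mxE !eqxx oner_neq0.
  rewrite -rowE; apply/rowP=> -[j lj]; rewrite !mxE /= inordK //=.
  by move: j lj => [|[|[|[|[|[|j]]]]]].
move=> x x0 /(_ 0) xJ; case/eqP: x0.
by rewrite -(mulmxK (Jn_unit 3) x) [x *m _]xJ mul0mx.
Qed.

Lemma delta_row_neq0 p (i : 'I_p) : delta_mx 0 i != 0 :> 'rV[K]_p.
Proof. by apply/matrix0Pn; exists 0, i; rewrite mxE !eqxx oner_neq0. Qed.

Lemma alt5_rad4 (a01 a02 a03 a12 a13 a23 : K) :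
  delta_mx 0 (inord 4) *m alt5 a01 a02 a03 0 a12 a13 0 a23 0 0 = 0 :> 'rV[K]_5.
Proof.
rewrite -rowE; apply/rowP=> -[j lj]; rewrite !mxE /= inordK //=.
by move: j lj => [|[|[|[|[|j]]]]] //= _; rewrite oppr0.
Qed.

Lemma radical_N52_F (a : K) : radical (N52_F a).
Proof. by exists (delta_mx 0 (inord 4)) => [|[[|[|k]] lk]] //; rewrite ?delta_row_neq0 // alt5_rad4. Qed.
Lemma radical_N52_1 : radical (N52_1 K).
Proof. by exists (delta_mx 0 (inord 4)) => [|[[|[|k]] lk]] //; rewrite ?delta_row_neq0 // alt5_rad4. Qed.
Lemma radical_N52_2 : radical (N52_2 K).
Proof. by exists (delta_mx 0 (inord 4)) => [|[[|[|k]] lk]] //; rewrite ?delta_row_neq0 // alt5_rad4. Qed.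

Lemma mulmx_alt5 (x : 'rV[K]_5) (a01 a02 a03 a04 a12 a13 a14 a23 a24 a34 : K) :
  x *m alt5 a01 a02 a03 a04 a12 a13 a14 a23 a24 a34 = 0 ->
  let y i := x 0 (inord i) in
  [/\ - (y 1%N * a01) - y 2%N * a02 - y 3%N * a03 - y 4%N * a04 = 0,
      y 0%N * a01 - y 2%N * a12 - y 3%N * a13 - y 4%N * a14 = 0,
      y 0%N * a02 + y 1%N * a12 - y 3%N * a23 - y 4%N * a24 = 0,
      y 0%N * a03 + y 1%N * a13 + y 2%N * a23 - y 4%N * a34 = 0 &
      y 0%N * a04 + y 1%N * a14 + y 2%N * a24 + y 3%N * a34 = 0].
Proof.
move=> /rowP h y.
pose F j k := y k * nth 0 (nth [::] [:: [:: 0; a01; a02; a03; a04]; [:: - a01; 0; a12; a13; a14];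
            [:: - a02; - a12; 0; a23; a24]; [:: - a03; - a13; - a23; 0; a34];
            [:: - a04; - a14; - a24; - a34; 0]] k) j.
have E j : (j < 5)%N -> F j 0%N + (F j 1%N + (F j 2%N + (F j 3%N + F j 4%N))) = 0.
  move=> lj; have := h (Ordinal lj); rewrite !mxE => e.
  transitivity (\sum_(k < 5) F j k); first by rewrite !big_ord_recl big_ord0 addr0.
  by rewrite -[RHS]e; apply: eq_bigr => k _; rewrite mxE /F /y inord_val.
by split; [rewrite -[RHS](E 0%N isT) | rewrite -[RHS](E 1%N isT) | rewrite -[RHS](E 2%N isT) |
  rewrite -[RHS](E 3%N isT) | rewrite -[RHS](E 4%N isT)]; rewrite /F /=; ring.
Qed.

Lemma row5_0 (x : 'rV[K]_5) : (forall i, (i < 5)%N -> x 0 (inord i) = 0) -> x = 0.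
Proof. by move=> h; apply/rowP=> j; rewrite mxE -[j]inord_val h. Qed.

Lemma not_radical_N52_3 : ~ radical (N52_3 K).
Proof.
move=> [x /eqP x0 xM]; apply: x0.
have := mulmx_alt5 (xM 0); have := mulmx_alt5 (xM 1); move=> /= [f0 _ f2 f3 f4] [e0 e1 _ _ _].
apply: row5_0 => -[|[|[|[|[|i]]]]] // _.
- by rewrite -[RHS]e1; ring.
- by apply: oppr_inj; rewrite oppr0 -[RHS]e0; ring.
- by rewrite -[RHS]f3; ring.
- by apply: oppr_inj; rewrite oppr0 -[RHS]f2; ring.
by apply: oppr_inj; rewrite oppr0 -[RHS]f0; ring.
Qed.

Lemma not_radical_N52_4 : ~ radical (N52_4 K).
Proof.
move=> [x /eqP x0 xM]; apply: x0.
have := mulmx_alt5 (xM 0); have := mulmx_alt5 (xM 1); move=> /= [f0 _ _ _ _] [e0 e1 e2 e3 _].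
have x2 : x 0 (inord 2) = 0 by rewrite -[RHS]e3; ring.
have x1 : x 0 (inord 1) = 0 by apply: oppr_inj; rewrite oppr0 -[RHS]e0; ring.
have x3 : x 0 (inord 3) = 0 by apply: oppr_inj; rewrite oppr0 -[RHS]e2; ring.
have x4 : x 0 (inord 4) = 0 by apply: oppr_inj; rewrite oppr0 -[RHS]f0 ?x2 ?x1 ?x3; ring.
have x00 : x 0 (inord 0) = 0 by rewrite -[RHS]e1; ring.
by apply: row5_0 => -[|[|[|[|[|i]]]]].
Qed.

(** [N52_3] contains the decomposable 01. On [N52_4] the Pluecker relations for 0123 and 0124 are
    the squares of the two coordinates. *)
Lemma N52_34_not : ~ teq (N52_3 K) (N52_4 K).
Proof.
move=> /hasdec_teq h; case: h.
  exists (delta_mx 0 0); first exact: delta_row_neq0.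
  by rewrite comb_delta; apply: alt5_01_dec.
move=> w /eqP w0 dw; apply: w0.
have : w 0 0 * w 0 0 = 0 by rewrite -[RHS](plucker 0 1 2 3 dw) !en_comb2 !en_mxl //=; ring.
have : w 0 1 * w 0 1 = 0 by rewrite -[RHS](plucker 0 1 2 4 dw) !en_comb2 !en_mxl //=; ring.
move=> /eqP; rewrite mulf_eq0 orbb => /eqP w1 /eqP; rewrite mulf_eq0 orbb => /eqP w0.
by apply/rowP=> -[[|[|k]] lk] //; rewrite mxE; [rewrite -[RHS]w0|rewrite -[RHS]w1]; congr (w _ _); apply: val_inj.
Qed.

End Invariants.

(** * Gram matrices as invariants of pencils and nets *)

Section GramInvariants.
Variable K : fieldType.
Hypothesis K2 : (2%:R : K) != 0.
Notation mx5 a b c d e := (mxl 5 [:: a; b; c; d; e]).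

(* Only the upper-left blocks of [N] and of the base change matter, so [N] need not be supported
   on the first four coordinates and [d] may vanish. *)
Lemma gram_block q (M N : 'I_q -> 'M[K]_(4 + 1)) (M4 : 'I_q -> 'M[K]_4) :
    (forall k, M k = block_mx (M4 k) 0 0 0) -> anti M4 -> teq M N ->
  exists d h, h \in unitmx /\ d *: gram M4 = h *m gram (fun k => ulsubmx (N k)) *m h^T.
Proof.
move=> eM aM [P [h [uP uh PM]]]; have [d hd] := pfp_cong K2 (ulsubmx P).
exists d, h; split=> //; apply: (@gram_cong _ _ _ _ (ulsubmx P)) => [k l|w]; first exact: hd.
have -> : comb (fun k => ulsubmx (N k)) (w *m h) = ulsubmx (comb N (w *m h)).
  by rewrite /comb; apply/matrixP=> i j; rewrite !mxE !summxE; apply: eq_bigr => k _; rewrite !mxE.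
rewrite -PM.
have -> : comb M w = block_mx (comb M4 w) 0 0 0.
  rewrite /comb; apply: (big_rec2 (fun x y => x = block_mx y 0 0 0)); first by rewrite block_mx0.
  by move=> k x y _ ->; rewrite eM scale_block_mx add_block_mx !scaler0 !addr0.
rewrite -[P in RHS]submxK tr_block_mx !mulmx_block.
by rewrite block_mxKul !(mulmx0, mul0mx, addr0, add0r).
Qed.

Lemma gram_s2 (A B : 'M[K]_4) :
  gram (s2 A B) = mxl 2 [:: [:: pfp A A; pfp A B]; [:: pfp B A; pfp B B]].
Proof. by apply/matrixP=> -[[|[|i]] li] [[|[|j]] lj] //; rewrite !mxE. Qed.

Lemma gram_s3 (A B C : 'M[K]_4) : gram (s3 A B C) =
  mxl 3 [:: [:: pfp A A; pfp A B; pfp A C]; [:: pfp B A; pfp B B; pfp B C];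
            [:: pfp C A; pfp C B; pfp C C]].
Proof. by apply/matrixP=> -[[|[|[|i]]] li] [[|[|[|j]]] lj] //; rewrite !mxE. Qed.

Lemma gram_ul q (N : 'I_q -> 'M[K]_(4 + 1)) N4 : (forall k, ulsubmx (N k) = N4 k) ->
  gram (fun k => ulsubmx (N k)) = gram N4.
Proof. by move=> e; apply/matrixP=> k l; rewrite !mxE !e. Qed.

Lemma s2_ul (A B : 'M[K]_(4 + 1)) k : ulsubmx (s2 A B k) = s2 (ulsubmx A) (ulsubmx B) k.
Proof. by case: k => [[|[|k]] lk]. Qed.

Lemma s2_block (A B : 'M[K]_(4 + 1)) A4 B4 :
  A = block_mx A4 0 0 0 -> B = block_mx B4 0 0 0 -> forall k, s2 A B k = block_mx (s2 A4 B4 k) 0 0 0.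
Proof. by move=> -> -> [[|[|k]] lk]. Qed.

Lemma gram52 (a01 a02 a03 a12 a13 a23 b01 b02 b03 b12 b13 b23 : K)
    (c01 c02 c03 c12 c13 c23 e01 e02 e03 e12 e13 e23 : K) :
  teq (s2 (alt5 a01 a02 a03 0 a12 a13 0 a23 0 0) (alt5 b01 b02 b03 0 b12 b13 0 b23 0 0))
      (s2 (alt5 c01 c02 c03 0 c12 c13 0 c23 0 0) (alt5 e01 e02 e03 0 e12 e13 0 e23 0 0)) ->
  exists d h, h \in unitmx /\
  d *: gram (s2 (alt4 a01 a02 a03 a12 a13 a23) (alt4 b01 b02 b03 b12 b13 b23)) =
  h *m gram (s2 (alt4 c01 c02 c03 c12 c13 c23) (alt4 e01 e02 e03 e12 e13 e23)) *m h^T.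
Proof.
move=> t.
have [|d [h [uh e]]] := @gram_block 2 _ _ _ (@s2_block _ _ _ _ (alt5_block _ _ _ _ _ _) (alt5_block _ _ _ _ _ _)) _ t.
  by apply: s2_anti; apply: alt4_anti.
exists d, h; split=> //; rewrite e; congr (_ *m _ *m _); apply: gram_ul => k.
by rewrite s2_ul !alt5_block; case: k => [[|[|k]] lk] //=; rewrite /s2 /sys /= block_mxKul.
Qed.

Lemma cgr_eq0 q (h G : 'M[K]_q) : h \in unitmx -> h *m G *m h^T = 0 -> G = 0.
Proof.
move=> uh e; rewrite -[G](mulKmx uh) -[h *m G](mulmxK (_ : h^T \in unitmx)) ?unitmx_tr //.
by rewrite e mul0mx mulmx0.
Qed.

Lemma gramF (a : K) : gram (s2 (alt4 1 0 0 0 0 1) (alt4 0 1 0 0 a 0)) =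
  mxl 2 [:: [:: 2%:R; 0]; [:: 0; - (2%:R * a)]].
Proof. by rewrite gram_s2 !pfp_alt4; congr mxl; congr [:: [:: _; _]; [:: _; _]]; ring. Qed.

Lemma gram1 : gram (s2 (alt4 1 0 0 0 0 0) (alt4 0 1 0 0 0 0)) = 0 :> 'M[K]_2.
Proof.
rewrite gram_s2 !pfp_alt4; apply/matrixP=> -[[|[|i]] li] [[|[|j]] lj] //; rewrite !mxE /=; ring.
Qed.

Lemma gram2 : gram (s2 (alt4 1 0 0 0 0 0) (alt4 0 1 0 0 1 0)) =
  mxl 2 [:: [:: 0; 0]; [:: 0; - 2%:R]] :> 'M[K]_2.
Proof. by rewrite gram_s2 !pfp_alt4; congr mxl; congr [:: [:: _; _]; [:: _; _]]; ring. Qed.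

Lemma N52_12_not : ~ teq (N52_1 K) (N52_2 K).
Proof.
move=> /gram52[d [h [uh]]]; rewrite gram1 gram2 scaler0 => /esym/(cgr_eq0 uh)/matrixP/(_ 1 1).
by rewrite !mxE /= => /eqP; rewrite oppr_eq0 (negPf K2).
Qed.

Lemma N52_1F_not (a : K) : ~ teq (N52_1 K) (N52_F a).
Proof.
move=> /gram52[d [h [uh]]]; rewrite gram1 gramF scaler0 => /esym/(cgr_eq0 uh)/matrixP/(_ 0 0).
by rewrite !mxE /= => /eqP; rewrite (negPf K2).
Qed.

(** The Pfaffian is degenerate on [N52_2] and nondegenerate on [N52_F a]; determinants detect
    this. *)
Lemma N52_2F_not (a : K) : a != 0 -> ~ teq (N52_2 K) (N52_F a).
Proof.
move=> a0 /gram52[d [h [uh]]]; rewrite gramF gram2 => /(congr1 determinant).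
rewrite detZ !det_mulmx det_tr !det_mxl /ldet /= => e.
have : 2%:R * 2%:R * a * (\det h * \det h) = 0.
  transitivity (- (\det h * (2%:R * - (2%:R * a)) * \det h)); first by ring.
  apply: oppr_inj; rewrite opprK oppr0; transitivity (d ^+ 2 * 0 : K); last by rewrite mulr0.
  by apply: etrans (etrans (esym e) _); ring.
move/eqP; rewrite !mulf_eq0 (negPf K2) (negPf a0) /= orbb.
by move: uh; rewrite unitmxE unitfE => /negPf->.
Qed.

(** Scaling a binary form by [d] multiplies its determinant by [d ^+ 2], so [a] survives up to
    squares. *)
Lemma N52_FF (a a' : K) : a != 0 -> a' != 0 -> teq (N52_F a) (N52_F a') -> exists c, c != 0 /\ a = c ^+ 2 * a'.
Proof.
move=> a0 a0' /gram52[d [h [uh]]]; rewrite !gramF => /(congr1 determinant).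
rewrite detZ !det_mulmx det_tr !det_mxl /ldet /= => e.
move: uh; rewrite unitmxE unitfE => uh.
have e' : d ^+ 2 * a = \det h ^+ 2 * a'.
  apply: (mulfI K2); apply: (mulfI K2); apply: oppr_inj.
  transitivity (d ^+ 2 * (2%:R * - (2%:R * a))); first by ring.
  transitivity (\det h * (2%:R * - (2%:R * a')) * \det h); last by ring.
  by apply: etrans (etrans e _); ring.
(* [gram_block] allows [d = 0]; here the other side of [e'] is nonzero. *)
have d0 : d != 0.
  apply: contraTneq isT => d0; have /eqP := e'; rewrite d0 expr2 !mul0r eq_sym.
  by rewrite mulf_eq0 (negPf a0') orbF expf_eq0 (negPf uh).
exists (\det h / d); split; first by rewrite mulf_neq0 ?invr_eq0.
by apply: (mulfI (expf_neq0 2 d0)); rewrite e'; field.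
Qed.

Lemma N52_FF_teq (a a' c : K) : c != 0 -> a = c ^+ 2 * a' -> teq (N52_F a) (N52_F a').
Proof.
move=> c0 ->.
apply: (@teq2I _ 5 _ _ _ _ (mx5 [:: 1; 0; 0; 0; 0] [:: 0; 1; 0; 0; 0] [:: 0; 0; c; 0; 0]
    [:: 0; 0; 0; c^-1; 0] [:: 0; 0; 0; 0; 1]) 1 0 0 c).
- by apply: (unit_mxl (c := 1)); rewrite ?oner_eq0 // /ldet /=; field.
- by rewrite mul1r mul0r subr0.
- by rewrite cong5 !alt5Z alt5D /ev5; congr alt5; field.
by rewrite cong5 !alt5Z alt5D /ev5; congr alt5; field.
Qed.

Definition D3 (a b : K) : 'M[K]_3 := mxl 3 [:: [:: 1; 0; 0]; [:: 0; - a; 0]; [:: 0; 0; - b]].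

Definition sim3 (a b a' b' : K) :=
  exists d h, [/\ d != 0, h \in unitmx & d *: D3 a b = h *m D3 a' b' *m h^T].

Lemma gramU a b : gram (N43_U a b) = 2%:R *: D3 a b.
Proof.
rewrite gram_s3 !pfp_alt4; apply/matrixP=> -[[|[|[|i]]] li] [[|[|[|j]]] lj] //; rewrite !mxE /=; ring.
Qed.

Lemma teq_gram q (M N : 'I_q -> 'M[K]_4) : anti M -> teq M N ->
  exists d h, [/\ d != 0, h \in unitmx & d *: gram M = h *m gram N *m h^T].
Proof.
move=> aM [P [h [uP uh PM]]]; have [d hd] := pfp_cong K2 P.
exists d, h; split=> //; first exact: pfp_cong_unit hd.
by apply: gram_cong PM => k l; apply: hd.
Qed.

(** A similarity gives a basis of the span of [N43_U a' b'] whose Gram matrix is a nonzero multiple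
    of [D3 a b], and [nf43_ab] recognises such a system. *)
Lemma N43_U_teqP a b a' b' : teq (N43_U a b) (N43_U a' b') <-> sim3 a b a' b'.
Proof.
split.
  move=> /(teq_gram (proj1 (N43_U_ok a b)))[d [h [d0 uh e]]]; exists d, h; split=> //.
  apply: (scalerI K2); move: e; rewrite !gramU -scalemxAr -scalemxAl => <-.
  by rewrite !scalerA mulrC.
move=> [d [h [d0 uh e]]]; apply: teq_sym.
have t0 := teq_basis (N43_U a' b') uh; move: t0; set M' := fun k => _ => t0.
have [aU fU] := N43_U_ok a' b'.
have aM' k : (M' k)^T = - M' k by apply: comb_anti.
have gM' : gram M' = (2%:R * d) *: D3 a b.
  rewrite -scalerA e scalemxAl scalemxAr -gramU -[LHS]scale1r; apply: (@gram_cong _ _ _ _ 1%:M).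
    by move=> k l; rewrite trmx1 !mul1mx !mulmx1 mul1r.
  move=> w; rewrite trmx1 mul1mx mulmx1 (mulmx_sum_row w h) linear_sum.
  by apply: eq_bigr => k _; rewrite linearZ.
have pM' k l : pfp (M' k) (M' l) = 2%:R * d * D3 a b k l.
  by have := congr1 (fun X : 'M_3 => X k l) gM'; rewrite !mxE.
have t1 := teq_trans t0 (sys3E M'); apply: (teq_trans t1).
apply: (@nf43_ab _ K2 a b (2%:R * d)) => //; rewrite ?mulf_neq0 ?pM' ?mxE ?inordK //=; try by ring.
exact: teq_free t1 fU.
Qed.

(** The rows of [h] are an orthogonal basis for the form [D3 a' b']; the final inequality is the
    determinant of [h]. *)
Lemma sim3_entries a b a' b' : sim3 a b a' b' ->
  exists d x0 y0 z0 x1 y1 z1 x2 y2 z2, [/\ d != 0,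
    x0 * x0 - a' * y0 * y0 - b' * z0 * z0 = d,
    x1 * x1 - a' * y1 * y1 - b' * z1 * z1 = - (d * a) &
    x2 * x2 - a' * y2 * y2 - b' * z2 * z2 = - (d * b)] /\
  [/\ x0 * x1 - a' * y0 * y1 - b' * z0 * z1 = 0,
      x0 * x2 - a' * y0 * y2 - b' * z0 * z2 = 0,
      x1 * x2 - a' * y1 * y2 - b' * z1 * z2 = 0 &
      x0 * (y1 * z2 - z1 * y2) - y0 * (x1 * z2 - z1 * x2) + z0 * (x1 * y2 - y1 * x2) != 0].
Proof.
move=> [d [h [d0 uh e]]].
have eh : h = mxl 3 [:: [:: en h 0 0; en h 0 1; en h 0 2]; [:: en h 1 0; en h 1 1; en h 1 2];
   [:: en h 2 0; en h 2 1; en h 2 2]].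
  apply/matrixP=> i j; rewrite enE mxE; case: i j => [i li] [j lj] /=.
  by move: i j li lj => [|[|[|i]]] [|[|[|j]]].
move: uh e; rewrite eh unitmxE det_mxl unitfE /D3 trmxl !mxlM /mkseq /=.
move: (en h 0 0) (en h 0 1) (en h 0 2) (en h 1 0) (en h 1 1) (en h 1 2) (en h 2 0) (en h 2 1) (en h 2 2).
move=> x0 y0 z0 x1 y1 z1 x2 y2 z2 uh e {eh h}.
have E i j := congr1 (fun X : 'M_3 => en X i j) e.
have := E 0%N 0%N; have := E 1%N 1%N; have := E 2%N 2%N; have := E 0%N 1%N; have := E 0%N 2%N; have := E 1%N 2%N.
rewrite {E e} !en_mxl //= /en !mxE !inordK //= => e12 e02 e01 e22 e11 e00.
exists d, x0, y0, z0, x1, y1, z1, x2, y2, z2; split; split=> //.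
- by transitivity (d * 1); [rewrite e00; ring | ring].
- by transitivity (d * - a); [rewrite e11; ring | ring].
- by transitivity (d * - b); [rewrite e22; ring | ring].
- by transitivity (d * 0); [rewrite e01; ring | ring].
- by transitivity (d * 0); [rewrite e02; ring | ring].
- by transitivity (d * 0); [rewrite e12; ring | ring].
by apply: contra_neq uh => uh; rewrite -[RHS]uh; ring.
Qed.

(** The rows are independent because [D3 a b] has nonzero determinant. *)
Lemma entries_sim3 a b a' b' d x0 y0 z0 x1 y1 z1 x2 y2 z2 : d != 0 ->
    x0 * x0 - a' * y0 * y0 - b' * z0 * z0 = d ->
    x1 * x1 - a' * y1 * y1 - b' * z1 * z1 = - (d * a) ->
    x2 * x2 - a' * y2 * y2 - b' * z2 * z2 = - (d * b) ->
    x0 * x1 - a' * y0 * y1 - b' * z0 * z1 = 0 ->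
    x0 * x2 - a' * y0 * y2 - b' * z0 * z2 = 0 ->
    x1 * x2 - a' * y1 * y2 - b' * z1 * z2 = 0 ->
    a != 0 -> b != 0 -> sim3 a b a' b'.
Proof.
move=> d0 e00 e11 e22 e01 e02 e12 a0 b0.
set h := mxl 3 [:: [:: x0; y0; z0]; [:: x1; y1; z1]; [:: x2; y2; z2]].
suff e : d *: D3 a b = h *m D3 a' b' *m h^T.
  exists d, h; split=> //; move/(congr1 determinant): e; rewrite detZ !det_mulmx !unitmxE unitfE => e.
  have : d ^+ 3 * \det (D3 a b) != 0.
    rewrite mulf_neq0 ?expf_neq0 // det_mxl /ldet /=; apply: contra_neq (mulf_neq0 a0 b0) => z.
    by rewrite -[RHS]z; ring.
  by rewrite e; apply: contra_neq => ->; rewrite !mul0r.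
rewrite /D3 trmxl !mxlM /mkseq /=; apply/matrixP=> -[[|[|[|i]]] li] [[|[|[|j]]] lj] //; rewrite !mxE /=.
- by transitivity d; [ring | rewrite -[LHS]e00; ring].
- by transitivity (0 : K); [ring | rewrite -[LHS]e01; ring].
- by transitivity (0 : K); [ring | rewrite -[LHS]e02; ring].
- by transitivity (0 : K); [ring | rewrite -[LHS]e01; ring].
- by transitivity (- (d * a)); [ring | rewrite -[LHS]e11; ring].
- by transitivity (0 : K); [ring | rewrite -[LHS]e12; ring].
- by transitivity (0 : K); [ring | rewrite -[LHS]e02; ring].
- by transitivity (0 : K); [ring | rewrite -[LHS]e12; ring].
by transitivity (- (d * b)); [ring | rewrite -[LHS]e22; ring].
Qed.

Lemma sim3_det a b a' b' : sim3 a b a' b' -> a * b != 0 -> a' * b' != 0.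
Proof.
move=> [d [h [d0 uh /(congr1 determinant)]]]; rewrite detZ !det_mulmx det_tr !det_mxl /ldet /= => e ab.
have e' : d ^+ 3 * (a * b) = \det h * (a' * b') * \det h.
  transitivity (d ^+ 3 * (1 * (- a * - b))); first by ring.
  by apply: etrans (etrans e _); ring.
by apply: contra_neq (mulf_neq0 (expf_neq0 3 d0) ab) => z; rewrite e' z mulr0 mul0r.
Qed.

Lemma sim3_sym a b a' b' : sim3 a b a' b' -> sim3 a' b' a b.
Proof. by move=> /N43_U_teqP/teq_sym/N43_U_teqP. Qed.

Lemma sim3_a0 a a' : a != 0 -> sim3 a 0 a' 0 -> exists c, c != 0 /\ a = c ^+ 2 * a'.
Proof.
move=> a0 /sim3_entries[d [x0 [y0 [z0 [x1 [y1 [z1 [x2 [y2 [z2 [[d0 e00 e11 _] [e01 _ _ _]]]]]]]]]]]].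
(* With the last coefficient zero the form lives on two coordinates. The Gram determinant of the
   first two rows is [- (d ^+ 2 * a)] and also [- (m ^+ 2 * a')]. *)
pose m := x0 * y1 - x1 * y0.
have e : d ^+ 2 * a = m ^+ 2 * a'.
  apply: oppr_inj; rewrite !(mul0r, subr0) in e00 e11 e01.
  transitivity (d * - (d * a) - 0 ^+ 2); first by ring.
  by rewrite -e11 -e01 -{1}e00 /m; ring.
have m0 : m != 0.
  by apply: contra_neq (mulf_neq0 (expf_neq0 2 d0) a0) => z; rewrite e z expr2 !mul0r.
exists (m / d); split; first by rewrite mulf_neq0 ?invr_eq0.
by apply: (mulfI (expf_neq0 2 d0)); rewrite e; field.
Qed.

End GramInvariants.

(** * Quaternion algebras and ternary forms *)

Section Quaternions.
Variable K : fieldType.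
Hypothesis K2 : (2%:R : K) != 0.

(** The scalar part of a product of two pure quaternions of (a,b); on the diagonal it is the square
    map. *)
Definition pureq (a b x1 x2 x3 y1 y2 y3 : K) : K := a * x1 * y1 + b * x2 * y2 - a * b * x3 * y3.

(** Candidate images of the generators: anticommuting pure quaternions with squares [a] and [b]. *)
Definition pure_pair (a b a' b' : K) := exists u1 u2 u3 v1 v2 v3,
  [/\ pureq a' b' u1 u2 u3 u1 u2 u3 = a, pureq a' b' v1 v2 v3 v1 v2 v3 = b &
      pureq a' b' u1 u2 u3 v1 v2 v3 = 0].

Lemma quat_iso_pure a b a' b' : quat_iso a b a' b' -> pure_pair a b a' b'.
Proof.
move=> [f [fL bij_f f1 fM]].
have f0 : f (Quat 0 0 0 0) = Quat 0 0 0 0.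
  have := fL (-1) (Quat 0 0 0 0) (Quat 0 0 0 0).
  rewrite /qadd /qscale /= !mulr0 !addr0 => e; rewrite {1}e; case: (f _) => x0 x1 x2 x3 /=.
  by congr Quat; ring.
have fZ c : f (Quat c 0 0 0) = Quat c 0 0 0.
  have := fL c (qone K) (Quat 0 0 0 0); rewrite f1 f0 /qadd /qscale /= !mulr0 !addr0 !mulr1.
  by [].
(* A nonscalar element with scalar square has a pure image: the cross terms give [2 * p0 * pi = 0],
   and [p0] nonzero would make the image, hence the element, scalar. *)
have pure x c : qmul a b x x = Quat c 0 0 0 -> (forall t, x <> Quat t 0 0 0) ->
    exists p1 p2 p3, f x = Quat 0 p1 p2 p3 /\ pureq a' b' p1 p2 p3 p1 p2 p3 = c.
  move=> xx nx; have := fM x x; rewrite xx fZ; case e: (f x) => [p0 p1 p2 p3].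
  rewrite /qmul /= => -[h0 h1 h2 h3].
  have z p : 0 = 2%:R * (p0 * p) -> (p0 == 0) || (p == 0).
    by move/esym/eqP; rewrite !mulf_eq0 (negPf K2).
  have [p00|p00] := eqVneq p0 0.
    by exists p1, p2, p3; split; [rewrite -p00 | rewrite h0 p00 /pureq; ring].
  have {}z p : 0 = 2%:R * (p0 * p) -> p = 0 by move/z; rewrite (negPf p00) => /eqP.
  have z1 : p1 = 0 by apply: z; rewrite h1; ring.
  have z2 : p2 = 0 by apply: z; rewrite h2; ring.
  have z3 : p3 = 0 by apply: z; rewrite h3; ring.
  by case: (nx p0); apply: (bij_inj bij_f); rewrite e fZ z1 z2 z3.
have [|t|p1 [p2 [p3 [fi Qi]]]] := pure (Quat 0 1 0 0) a.
- by rewrite /qmul /=; congr Quat; ring.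
- by case=> _ /eqP; rewrite oner_eq0.
have [|t|r1 [r2 [r3 [fj Qj]]]] := pure (Quat 0 0 1 0) b.
- by rewrite /qmul /=; congr Quat; ring.
- by case=> _ /eqP; rewrite oner_eq0.
exists p1, p2, p3, r1, r2, r3; split=> //.
(* The relation ij + ji = 0 is carried by [f] to orthogonality. *)
have := fL 1 (qmul a b (Quat 0 1 0 0) (Quat 0 0 1 0)) (qmul a b (Quat 0 0 1 0) (Quat 0 1 0 0)).
rewrite !fM fi fj.
have -> : qadd (qscale 1 (qmul a b (Quat 0 1 0 0) (Quat 0 0 1 0))) (qmul a b (Quat 0 0 1 0) (Quat 0 1 0 0))
   = Quat 0 0 0 0 by rewrite /qadd /qscale /qmul /=; congr Quat; ring.
rewrite f0 => -[h _ _ _]; apply: (mulfI K2); rewrite mulr0 h /pureq; ring.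
Qed.

Lemma pure_quat_iso a b a' b' : a != 0 -> b != 0 -> pure_pair a b a' b' -> quat_iso a b a' b'.
Proof.
move=> a0 b0 [u1 [u2 [u3 [v1 [v2 [v3 [Qu Qv Buv]]]]]]].
(* [w] is the vector part of the product of [u] and [v], the future image of [ij]. *)
pose w1 := - b' * (u2 * v3 - u3 * v2); pose w2 := a' * (u1 * v3 - u3 * v1); pose w3 := u1 * v2 - u2 * v1.
pose f (x : quat K) := Quat (q0 x) (q1 x * u1 + q2 x * v1 + q3 x * w1)
  (q1 x * u2 + q2 x * v2 + q3 x * w2) (q1 x * u3 + q2 x * v3 + q3 x * w3).
have Qw : pureq a' b' w1 w2 w3 w1 w2 w3 = - (a * b).
  transitivity ((pureq a' b' u1 u2 u3 v1 v2 v3) ^+ 2 - a * b); last by rewrite Buv; ring.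
  rewrite -Qu -Qv /pureq /w1 /w2 /w3; ring.
have Buw : pureq a' b' u1 u2 u3 w1 w2 w3 = 0 by rewrite /pureq /w1 /w2 /w3; ring.
have Bvw : pureq a' b' v1 v2 v3 w1 w2 w3 = 0 by rewrite /pureq /w1 /w2 /w3; ring.
exists f; split.
- by move=> c x y; rewrite /f /qadd /qscale /=; congr Quat; ring.
(* [u], [v], [w] are orthogonal, so coordinates in this basis are pairings divided by squares. *)
- pose g (x : quat K) := Quat (q0 x) (pureq a' b' u1 u2 u3 (q1 x) (q2 x) (q3 x) / a)
    (pureq a' b' v1 v2 v3 (q1 x) (q2 x) (q3 x) / b)
    (- pureq a' b' w1 w2 w3 (q1 x) (q2 x) (q3 x) / (a * b)).
  pose Tm := mxl 3 [:: [:: u1; u2; u3]; [:: v1; v2; v3]; [:: w1; w2; w3]].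
  pose Sm := mxl 3 [:: [:: a' * u1 / a; a' * v1 / b; - (a' * w1) / (a * b)];
                       [:: b' * u2 / a; b' * v2 / b; - (b' * w2) / (a * b)];
                       [:: - (a' * b' * u3) / a; - (a' * b' * v3) / b; a' * b' * w3 / (a * b)]].
  have TS : Tm *m Sm = 1%:M.
    rewrite mxlM /mkseq /=; apply/matrixP=> -[[|[|[|i]]] li] [[|[|[|j]]] lj] //; rewrite !mxE /=.
    + by transitivity (pureq a' b' u1 u2 u3 u1 u2 u3 / a); [rewrite /pureq; ring | rewrite Qu mulfV].
    + by transitivity (pureq a' b' u1 u2 u3 v1 v2 v3 / b); [rewrite /pureq; ring | rewrite Buv mul0r].
    + by transitivity (- pureq a' b' u1 u2 u3 w1 w2 w3 / (a * b)); [rewrite /pureq; ring | rewrite Buw oppr0 mul0r].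
    + by transitivity (pureq a' b' u1 u2 u3 v1 v2 v3 / a); [rewrite /pureq; ring | rewrite Buv mul0r].
    + by transitivity (pureq a' b' v1 v2 v3 v1 v2 v3 / b); [rewrite /pureq; ring | rewrite Qv mulfV].
    + by transitivity (- pureq a' b' v1 v2 v3 w1 w2 w3 / (a * b)); [rewrite /pureq; ring | rewrite Bvw oppr0 mul0r].
    + by transitivity (pureq a' b' u1 u2 u3 w1 w2 w3 / a); [rewrite /pureq; ring | rewrite Buw mul0r].
    + by transitivity (pureq a' b' v1 v2 v3 w1 w2 w3 / b); [rewrite /pureq; ring | rewrite Bvw mul0r].
    by transitivity (- pureq a' b' w1 w2 w3 w1 w2 w3 / (a * b));
      [rewrite /pureq; ring | rewrite Qw opprK mulfV // mulf_neq0].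
  have ST := mulmx1C TS.
  have rowE (x : quat K) : (\row_(j < 3) [:: q1 x; q2 x; q3 x]`_j) *m Tm =
      \row_(j < 3) [:: q1 (f x); q2 (f x); q3 (f x)]`_j.
    by apply/rowP=> -[[|[|[|j]]] lj] //; rewrite !mxE !big_ord_recl big_ord0 !mxE /=; ring.
  have rowE' (x : quat K) : (\row_(j < 3) [:: q1 x; q2 x; q3 x]`_j) *m Sm =
      \row_(j < 3) [:: q1 (g x); q2 (g x); q3 (g x)]`_j.
    by apply/rowP=> -[[|[|[|j]]] lj] //; rewrite !mxE !big_ord_recl big_ord0 !mxE /= /pureq; ring.
  have ext3 (x y : quat K) : q0 x = q0 y -> \row_(j < 3) [:: q1 x; q2 x; q3 x]`_j =
      \row_(j < 3) [:: q1 y; q2 y; q3 y]`_j -> x = y.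
    case: x y => [x0 x1 x2 x3] [y0 y1 y2 y3] /= -> /rowP h; congr Quat.
    + by have := h 0; rewrite !mxE.
    + by have := h 1; rewrite !mxE.
    by have := h (inord 2); rewrite !mxE inordK.
  exists g => x; apply: ext3 => //.
    by rewrite -rowE' -rowE -mulmxA TS mulmx1.
  by rewrite -rowE -rowE' -mulmxA ST mulmx1.
- by rewrite /f /qone /=; congr Quat; ring.
move=> x y.
pose c := pureq a' b' u1 u2 u3 v1 v2 v3.
have c0 t : c * t = 0 by rewrite /c Buv mul0r.
(* Each component of [f x * f y - f (x * y)] is a multiple of the scalar part [c] of [u v]. *)
case: x y => [x0 x1 x2 x3] [y0 y1 y2 y3]; rewrite /f /qmul /=; apply/esym; congr Quat;
rewrite -[RHS]addr0.
- rewrite -[X in _ = _ + X](c0 (x1 * y2 + x2 * y1 + c * x3 * y3)).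
  by rewrite -Qu -Qv /c /pureq /w1 /w2 /w3; ring.
- rewrite -[X in _ = _ + X](c0 ((x3 * y1 - x1 * y3) * u1 + (x2 * y3 - x3 * y2) * v1)).
  by rewrite -Qu -Qv /c /pureq /w1 /w2 /w3; ring.
- rewrite -[X in _ = _ + X](c0 ((x3 * y1 - x1 * y3) * u2 + (x2 * y3 - x3 * y2) * v2)).
  by rewrite -Qu -Qv /c /pureq /w1 /w2 /w3; ring.
rewrite -[X in _ = _ + X](c0 ((x3 * y1 - x1 * y3) * u3 + (x2 * y3 - x3 * y2) * v3)).
by rewrite -Qu -Qv /c /pureq /w1 /w2 /w3; ring.
Qed.

(* [(x, y, z) |-> x i j + y a' j + z b' i] turns the square map on pure quaternions into
   [- a' b' (x^2 - a' y^2 - b' z^2)]; [v], [u] and the vector part of [u v] give the orthogonal rows. *)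
Lemma pure_sim3 a b a' b' : a != 0 -> b != 0 -> a' != 0 -> b' != 0 ->
  pure_pair a b a' b' -> sim3 a b a' b'.
Proof.
move=> a0 b0 a0' b0' [u1 [u2 [u3 [v1 [v2 [v3 [Qu Qv Buv]]]]]]].
pose w1 := - b' * (u2 * v3 - u3 * v2); pose w2 := a' * (u1 * v3 - u3 * v1); pose w3 := u1 * v2 - u2 * v1.
have Qw : pureq a' b' w1 w2 w3 w1 w2 w3 = - (a * b).
  transitivity ((pureq a' b' u1 u2 u3 v1 v2 v3) ^+ 2 - a * b); last by rewrite Buv; ring.
  rewrite -Qu -Qv /pureq /w1 /w2 /w3; ring.
have Buw : pureq a' b' u1 u2 u3 w1 w2 w3 = 0 by rewrite /pureq /w1 /w2 /w3; ring.
have Bvw : pureq a' b' v1 v2 v3 w1 w2 w3 = 0 by rewrite /pureq /w1 /w2 /w3; ring.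
have d0 : a * b / (a' * b') != 0 by rewrite !mulf_neq0 ?invr_eq0 ?mulf_neq0.
have qE x1 x2 x3 y1 y2 y3 : x3 * y3 - a' * (x2 / a') * (y2 / a') - b' * (x1 / b') * (y1 / b') =
    - pureq a' b' x1 x2 x3 y1 y2 y3 / (a' * b') by rewrite /pureq; field; rewrite a0' b0'.
apply: (@entries_sim3 _ a b a' b' (a * b / (a' * b')) w3 (w2 / a') (w1 / b')
   (a * v3) (a * v2 / a') (a * v1 / b') (b * u3) (b * u2 / a') (b * u1 / b')) => //.
- by rewrite qE Qw opprK.
- by rewrite qE (_ : pureq _ _ _ _ _ _ _ _ = a ^+ 2 * b); [field; rewrite a0' b0' | rewrite -Qv /pureq; ring].
- by rewrite qE (_ : pureq _ _ _ _ _ _ _ _ = b ^+ 2 * a); [field; rewrite a0' b0' | rewrite -Qu /pureq; ring].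
- rewrite qE (_ : pureq _ _ _ _ _ _ _ _ = a * pureq a' b' v1 v2 v3 w1 w2 w3); last by rewrite /pureq; ring.
  by rewrite Bvw mulr0 oppr0 mul0r.
- rewrite qE (_ : pureq _ _ _ _ _ _ _ _ = b * pureq a' b' u1 u2 u3 w1 w2 w3); last by rewrite /pureq; ring.
  by rewrite Buw mulr0 oppr0 mul0r.
- rewrite qE (_ : pureq _ _ _ _ _ _ _ _ = a * b * pureq a' b' u1 u2 u3 v1 v2 v3); last by rewrite /pureq; ring.
  by rewrite Buv mulr0 oppr0 mul0r.
Qed.

Lemma sim3_pure a b a' b' : a != 0 -> b != 0 -> a' != 0 -> b' != 0 ->
  sim3 a b a' b' -> pure_pair a b a' b'.
Proof.
move=> a0 b0 a0' b0' /sim3_entries[d [x0 [y0 [z0 [x1 [y1 [z1 [x2 [y2 [z2 [[d0 e00 e11 e22] [e01 e02 e12 m0]]]]]]]]]]]].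
move: m0; set m := (X in X != 0) => m0.
(* The Gram determinant of the three rows, computed once from its entries and once as [m ^+ 2] times
   the determinant of the form. *)
have em : d ^+ 3 * (a * b) = m ^+ 2 * (a' * b').
  pose q X1 X2 X3 Y1 Y2 Y3 := X1 * Y1 - a' * X2 * Y2 - b' * X3 * Y3.
  have : q x0 y0 z0 x0 y0 z0 * q x1 y1 z1 x1 y1 z1 * q x2 y2 z2 x2 y2 z2
    + 2%:R * q x0 y0 z0 x1 y1 z1 * q x0 y0 z0 x2 y2 z2 * q x1 y1 z1 x2 y2 z2
    - q x0 y0 z0 x0 y0 z0 * q x1 y1 z1 x2 y2 z2 ^+ 2 - q x1 y1 z1 x1 y1 z1 * q x0 y0 z0 x2 y2 z2 ^+ 2
    - q x2 y2 z2 x2 y2 z2 * q x0 y0 z0 x1 y1 z1 ^+ 2 = m ^+ 2 * (a' * b').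
    by rewrite /q /m; ring.
  by rewrite /q e00 e11 e22 e01 e02 e12 => <-; ring.
(* Under the map of [pE] row 2 becomes [u] and row 1 becomes [v]; by [em] these scalings make their
   squares [a] and [b]. *)
pose l := m / (d ^+ 2 * b); pose k := m / (d ^+ 2 * a).
have pE X1 X2 X3 Y1 Y2 Y3 s t : pureq a' b' (s * (b' * X3)) (s * (a' * X2)) (s * X1) (t * (b' * Y3)) (t * (a' * Y2)) (t * Y1)
  = - (s * t) * (a' * b') * (X1 * Y1 - a' * X2 * Y2 - b' * X3 * Y3) by rewrite /pureq; ring.
exists (l * (b' * z2)), (l * (a' * y2)), (l * x2), (k * (b' * z1)), (k * (a' * y1)), (k * x1).
rewrite !pE e22 e11; split.
- transitivity ((m ^+ 2 * (a' * b')) / (d ^+ 3 * b)); first by rewrite /l; field; rewrite d0 b0.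
  by rewrite -em; field; rewrite d0 b0.
- transitivity ((m ^+ 2 * (a' * b')) / (d ^+ 3 * a)); first by rewrite /k; field; rewrite d0 a0.
  by rewrite -em; field; rewrite d0 a0.
by rewrite (_ : x2 * x1 - _ - _ = 0) ?mulr0 // -[RHS]e12; ring.
Qed.

Lemma quat_sim3P (a b a' b' : K) : a != 0 -> b != 0 -> a' != 0 -> b' != 0 ->
  quat_iso a b a' b' <-> sim3 a b a' b'.
Proof.
move=> a0 b0 a0' b0'; split=> [/quat_iso_pure|/(sim3_pure a0 b0 a0' b0')].
  exact: pure_sim3.
exact: pure_quat_iso.
Qed.

End Quaternions.

(** * Classification and counting *)

Section Assembly.
Variable K : fieldType.
Hypothesis K2 : (2%:R : K) != 0.

Lemma cdga_iso_trans n (D1 D2 D3 : ext K n -> ext K n) :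
  cdga_iso D1 D2 -> cdga_iso D2 D3 -> cdga_iso D1 D3.
Proof.
move=> [f [lf [bf f1] Mf hf Df]] [g [lg [bg g1] Mg hg Dg]]; exists (g \o f); split=> /=.
- by move=> c x y; rewrite lf lg.
- by split; [apply: bij_comp | rewrite f1 g1].
- by move=> x y; rewrite Mf Mg.
- by move=> p x /hf/hg.
by move=> x; rewrite Df Dg.
Qed.

(** The entries at the positions [s] embed the span into a space of dimension [size s]. *)
Lemma tfree_dim p q (M : 'I_q -> 'M[K]_p.+1) (s : seq (nat * nat)) : tfree M ->
  (forall w, (forall l, (l < size s)%N ->
      en (comb M w) (nth (0, 0)%N s l).1 (nth (0, 0)%N s l).2 = 0) -> comb M w = 0) ->
  (q <= size s)%N.
Proof.
move=> fM sM.
pose T : 'M[K]_(q, size s) := \matrix_(k, l) en (M k) (nth (0, 0)%N s l).1 (nth (0, 0)%N s l).2.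
suff /eqP <- : row_free T by apply: rank_leq_col.
apply: inj_row_free => w wT; apply/fM/sM => l ls.
have := congr1 (fun X : 'rV_(size s) => X 0 (Ordinal ls)) wT; rewrite !mxE => e; rewrite -[RHS]e.
by rewrite /en /comb summxE; apply: eq_bigr => k _; rewrite !mxE.
Qed.

(** The three entries above the diagonal determine the matrix. So [p <= 3] would give
    [p + q <= 6]. *)
Lemma skew_dim p q (M : 'I_q -> 'M[K]_p) : anti M -> tfree M -> (p <= 3)%N -> (q <= 3)%N.
Proof.
case: p M => [|p] M aM fM p3.
  case: q M aM fM => // q M aM fM; have := tfree_neq0 ord0 fM; by rewrite [M _]flatmx0 eqxx.
apply: (@tfree_dim p q M [:: (0, 1); (0, 2); (1, 2)]%N) => // w h.
have h01 := h 0%N isT; have h02 := h 1%N isT; have h12 := h 2%N isT; rewrite /= in h01 h02 h12.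
have aX := comb_anti w aM; move: (comb M w) aX h01 h02 h12 => X aX h01 h02 h12.
apply/matrixP=> i j; rewrite enE mxE; case: i j => [i li] [j lj] /=.
have {li} : (i < 3)%N by apply: leq_trans li _.
have {lj} : (j < 3)%N by apply: leq_trans lj _.
by move: i j => [|[|[|i]]] [|[|[|j]]] //= _ _; rewrite ?en_diag ?(en_anti 0 1 aX) ?(en_anti 0 2 aX)
  ?(en_anti 1 2 aX) ?h01 ?h02 ?h12 ?oppr0.
Qed.

Lemma std_reduction_iso p q (D : ealg K (p + q) -> ealg K (p + q)) (M : 'I_q -> 'M[K]_p) (g : 'M[K]_(p + q)) :
    is_cdga_diff D -> anti M -> row_free g ->
    (forall v, diffmxv D (v *m g) = g^T *m block_mx (comb M (rsubmx v)) 0 0 0 *m g) ->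
  cdga_iso D (stdD M).
Proof.
rewrite row_free_unit => cD aM ug hg; apply/(cdga_iso_mxP K2 cD (stdD_cdga K2 aM)).
exists (invmx g) => [|v]; first by rewrite unitmx_inv.
rewrite diffmxv_stdD // -{1}[v](mulmxKV ug) hg !mulmxA -trmx_mul mulmxV // trmx1 mul1mx.
by rewrite -mulmxA mulmxV // mulmx1.
Qed.

(** One constructor per shape keeps [p] and [q] numerals, so that in [sysD] each sum is convertible
    to 7. *)
Inductive system : Type :=
  | Sys61 of 'I_1 -> 'M[K]_6 | Sys52 of 'I_2 -> 'M[K]_5 | Sys43 of 'I_3 -> 'M[K]_4.

Definition sysok (x : system) : Prop := match x with
  | Sys61 M => anti M /\ tfree M | Sys52 M => anti M /\ tfree M | Sys43 M => anti M /\ tfree M end.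

Definition sysD (x : system) : ext K 7 -> ext K 7 := match x with
  | Sys61 M => @stdD K 6 1 M | Sys52 M => @stdD K 5 2 M | Sys43 M => @stdD K 4 3 M end.

Definition sysrel (x y : system) : Prop := match x, y with
  | Sys61 M, Sys61 N => teq M N | Sys52 M, Sys52 N => teq M N | Sys43 M, Sys43 N => teq M N
  | _, _ => False end.

Lemma stdD_ok p q (M : 'I_q.+1 -> 'M[K]_p) : anti M /\ tfree M ->
  [/\ is_cdga_diff (stdD M), is_minimal (stdD M) & filt_length2 (stdD M)].
Proof.
move=> [aM fM]; split; [exact: stdD_cdga | exact: stdD_minimal | apply: stdD_length2 => //].
by exists 0; apply: tfree_neq0.
Qed.

Lemma sysD_ok x : sysok x ->
  [/\ is_cdga_diff (sysD x), is_minimal (sysD x) & filt_length2 (sysD x)].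
Proof. by case: x => M; apply: stdD_ok. Qed.

Definition syskdim (x : system) : nat := match x with Sys61 _ => 6 | Sys52 _ => 5 | Sys43 _ => 4 end.

Lemma sysD_ker x : sysok x -> \rank (diffker (sysD x)) = syskdim x.
Proof. by case: x => M [aM fM]; apply: (diffker_stdD K2 aM fM). Qed.

(** The rank of [W_0] separates the shapes; within a shape [teq_iso] and [iso_teq] apply. *)
Lemma sysD_iso x y : sysok x -> sysok y -> cdga_iso (sysD x) (sysD y) <-> sysrel x y.
Proof.
move=> ox oy; split.
  move=> i; have [cx _ _] := sysD_ok ox; have [cy _ _] := sysD_ok oy.
  have := iso_diffker K2 cx cy i; rewrite !sysD_ker //.
  by case: x y ox oy i {cx cy} => M [N|N|N] //= [aM fM] [aN fN] i _; apply: (iso_teq K2).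
by case: x y ox oy => M [N|N|N] //= [aM fM] [aN fN] t; apply: (teq_iso K2 aM aN t).
Qed.

Lemma sysD_surj (D : ext K 7 -> ext K 7) : is_cdga_diff D -> filt_length2 D ->
  exists2 x, sysok x & cdga_iso D (sysD x).
Proof.
move=> cD lD; have [p [q [M [g [pq fg aM fM hg]]]]] := std_reduction K2 cD lD.
have [p3|p3] := leqP p 3; first by have := skew_dim aM fM p3; lia.
case: p M g pq fg aM fM hg p3 => [|[|[|[|[|[|[|[|p]]]]]]]] // M g pq fg aM fM hg _.
- have e : q = 3%N by lia.
  subst q; exists (Sys43 M); first by [].
  exact: (@std_reduction_iso 4 3 D M g).
- have e : q = 2%N by lia.
  subst q; exists (Sys52 M); first by [].
  exact: (@std_reduction_iso 5 2 D M g).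
- have e : q = 1%N by lia.
  subst q; exists (Sys61 M); first by [].
  exact: (@std_reduction_iso 6 1 D M g).
(* Without matrices the differential would vanish on [V]. *)
- have e : q = 0%N by lia.
  subst q; case: lD => [[v [hv Dv]] _]; case: Dv.
  rewrite -(linvecK hv) (diff_linvec K2 cD).
  have ug : (g : 'M_(7 + 0)) \in unitmx by rewrite -row_free_unit.
  suff -> : diffmxv D (coordv (v : ealg K 7)) = 0 by rewrite linear0.
  have := hg ((coordv (v : ealg K 7) : 'rV_(7 + 0)) *m invmx g).
  rewrite mulmxKV // => ->; rewrite (_ : comb _ _ = 0) ?block_mx0 ?mulmx0 ?mul0mx //.
  by rewrite /comb big_ord0.
Qed.

Definition sys10 : seq system := [:: Sys61 (N61 K 1); Sys61 (N61 K 2); Sys61 (N61 K 3);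
  Sys52 (N52_1 K); Sys52 (N52_2 K); Sys52 (N52_3 K); Sys52 (N52_4 K);
  Sys43 (N43_1 K); Sys43 (N43_2 K); Sys43 (N43_U 0 0)].

Definition idxsys (b : ('I_10 + (kstar K + kstar K)) + qparam K) : system := match b with
  | inl (inl i) => nth (Sys61 (N61 K 1)) sys10 i
  | inl (inr (inl a)) => Sys52 (N52_F (proj1_sig a))
  | inl (inr (inr a)) => Sys43 (N43_U (proj1_sig a) 0)
  | inr ab => Sys43 (N43_U (proj1_sig ab).1 (proj1_sig ab).2)
  end.

Lemma idxsys_ok b : sysok (idxsys b).
Proof.
case: b => [[[i li]|[a|a]]|ab] /=; try exact: N52_F_ok; try exact: N43_U_ok.
by move: i li => [|[|[|[|[|[|[|[|[|[|i]]]]]]]]]] //= _; [apply: N61_ok | apply: N61_ok | apply: N61_ok |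
  apply: N52_1_ok | apply: N52_2_ok | apply: N52_3_ok | apply: N52_4_ok | apply: N43_1_ok |
  apply: N43_2_ok | apply: N43_U_ok].
Qed.

Lemma sysrel_sym x y : sysrel x y -> sysrel y x.
Proof. by case: x y => M [N|N|N] //=; apply: teq_sym. Qed.

Lemma mulmx_mxl4 (x : 'rV[K]_4) s j : x *m mxl 4 s = 0 -> (j < 4)%N ->
  let F k := x 0 (inord k) * nth 0 (nth [::] s k) j in
  F 0%N + (F 1%N + (F 2%N + F 3%N)) = 0.
Proof.
move=> /rowP h lj F; have := h (Ordinal lj); rewrite !mxE => e.
transitivity (\sum_(k < 4) F k); first by rewrite !big_ord_recl big_ord0 addr0.
by rewrite -[RHS]e; apply: eq_bigr => k _; rewrite mxE /F inord_val.
Qed.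

(** The forms 01, 02, 12 all kill [e_3], while 01, 02, 03 have no common kernel vector. *)
Lemma N43_12_not : ~ teq (N43_2 K) (N43_1 K).
Proof.
move=> /radical_teq h; case: h.
  exists (delta_mx 0 (inord 3)); first exact: delta_row_neq0.
  move=> k; rewrite -rowE; apply/rowP=> -[j lj]; rewrite !mxE.
  by move: k j lj => [[|[|[|k]]] lk] [|[|[|[|j]]]] //= lj; rewrite /s3 /sys /= !mxE inordK //= ?oppr0.
move=> x /eqP x0 xM; apply: x0.
have e01 := mulmx_mxl4 (xM 0) (isT : 1 < 4)%N.
have e00 := mulmx_mxl4 (xM 0) (isT : 0 < 4)%N.
have e10 := mulmx_mxl4 (xM 1) (isT : 0 < 4)%N.
have e20 := mulmx_mxl4 (xM (Ordinal (isT : 2 < 3)%N)) (isT : 0 < 4)%N.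
rewrite /= in e01 e00 e10 e20.
apply/rowP=> j; rewrite mxE -[j]inord_val; case: j => [[|[|[|[|j]]]] lj] //=.
- by rewrite -[RHS]e01; ring.
- by apply: oppr_inj; rewrite oppr0 -[RHS]e00; ring.
- by apply: oppr_inj; rewrite oppr0 -[RHS]e10; ring.
by apply: oppr_inj; rewrite oppr0 -[RHS]e20; ring.
Qed.

Lemma gramI1 : gram (N43_1 K) = 0.
Proof.
rewrite gram_s3 !pfp_alt4; apply/matrixP=> -[[|[|[|i]]] li] [[|[|[|j]]] lj] //; rewrite !mxE /=; ring.
Qed.
Lemma gramI2 : gram (N43_2 K) = 0.
Proof.
rewrite gram_s3 !pfp_alt4; apply/matrixP=> -[[|[|[|i]]] li] [[|[|[|j]]] lj] //; rewrite !mxE /=; ring.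
Qed.

Lemma N43_IU_not (M : 'I_3 -> 'M[K]_4) a b : anti M -> gram M = 0 -> ~ teq M (N43_U a b).
Proof.
move=> aM gM /(teq_gram K2 aM)[d [h [d0 uh]]]; rewrite gM scaler0 gramU => /esym/(cgr_eq0 uh).
move/matrixP/(_ 0 0); rewrite !mxE /= mulr1 => /eqP; by rewrite (negPf K2).
Qed.


Lemma not_radical_teq p q (M N : 'I_q -> 'M[K]_p) : radical M -> ~ radical N -> ~ teq M N.
Proof. by move=> rM rN /radical_teq/(_ rM). Qed.

Lemma N52_FFP (a a' : kstar K) :
  teq (N52_F (proj1_sig a)) (N52_F (proj1_sig a')) <-> sqclass_rel a a'.
Proof.
case: a a' => [a a0] [a' a0'] /=; split; first exact: N52_FF.
by move=> [c [c0 e]]; apply: N52_FF_teq c0 e.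
Qed.

Lemma N43_U0P (a a' : kstar K) :
  teq (N43_U (proj1_sig a) 0) (N43_U (proj1_sig a') 0) <-> sqclass_rel a a'.
Proof.
case: a a' => [a a0] [a' a0'] /=; split; first by move/(N43_U_teqP K2); apply: sim3_a0.
move=> [c [c0 /= e]]; apply/(N43_U_teqP K2).
exists 1, (mxl 3 [:: [:: 1; 0; 0]; [:: 0; c; 0]; [:: 0; 0; 1]]); rewrite oner_neq0; split=> //.
  by apply: unit_mxl c0; rewrite /ldet /=; ring.
rewrite scale1r /D3 trmxl !mxlM /mkseq /= e; congr mxl.
by congr [:: [:: _; _; _]; [:: _; _; _]; [:: _; _; _]]; ring.
Qed.

Lemma N43_UUP (x y : qparam K) :
  teq (N43_U (proj1_sig x).1 (proj1_sig x).2) (N43_U (proj1_sig y).1 (proj1_sig y).2) <-> quat_rel x y.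
Proof.
case: x y => [[a b] /= ab] [[a' b'] /= ab']; have [/= a0 b0] := andP ab; have [/= a0' b0'] := andP ab'.
rewrite /quat_rel /=; split=> [/(N43_U_teqP K2)/(quat_sim3P K2 a0 b0 a0' b0')//|].
by move/(quat_sim3P K2 a0 b0 a0' b0')/(N43_U_teqP K2).
Qed.

Lemma N43_Ua0_U00 (a : K) : a != 0 -> ~ teq (N43_U a 0) (N43_U 0 0).
Proof.
move=> a0 /(N43_U_teqP K2)/(sim3_a0 a0)[c [_ e]].
by move: a0; rewrite e mulr0 eqxx.
Qed.

Lemma N43_Uab_U0 (a b a' : K) : a != 0 -> b != 0 -> ~ teq (N43_U a b) (N43_U a' 0).
Proof.
move=> a0 b0 /(N43_U_teqP K2)/sim3_det; rewrite mulf_neq0 // mulr0 eqxx => h.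
by have := h isT.
Qed.

Lemma sysrel_refl x : sysrel x x.
Proof. by case: x => M; apply: teq_refl. Qed.

Lemma sys10_lt i j : (i < j)%N -> (j < 10)%N ->
  ~ sysrel (nth (Sys61 (N61 K 1)) sys10 i) (nth (Sys61 (N61 K 1)) sys10 j).
Proof.
have r1 := radical_N52_1 K; have r2 := radical_N52_2 K.
have r3 := @not_radical_N52_3 K; have r4 := @not_radical_N52_4 K.
have g1 := N43_IU_not (proj1 (N43_1_ok K)) gramI1; have g2 := N43_IU_not (proj1 (N43_2_ok K)) gramI2.
move: i j => [|[|[|[|[|[|[|[|[|[|i]]]]]]]]]] [|[|[|[|[|[|[|[|[|[|j]]]]]]]]]] // _ _ /=; try exact: id.
- exact: N61_1_not.
- exact: N61_1_not.
- exact: N61_23_not.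
- exact: N52_12_not.
- exact: not_radical_teq r1 r3.
- exact: not_radical_teq r1 r4.
- exact: not_radical_teq r2 r3.
- exact: not_radical_teq r2 r4.
- exact: N52_34_not.
by move=> /teq_sym; apply: N43_12_not.
Qed.

Lemma sys10P (i j : 'I_10) :
  sysrel (nth (Sys61 (N61 K 1)) sys10 i) (nth (Sys61 (N61 K 1)) sys10 j) -> i = j.
Proof.
move=> h; apply: val_inj => /=; case: (ltngtP i j) => // lt.
  by case: (sys10_lt lt (ltn_ord j) h).
by case: (sys10_lt lt (ltn_ord i) (sysrel_sym h)).
Qed.

Lemma sys10_F_not (i : 'I_10) (a : kstar K) :
  ~ sysrel (nth (Sys61 (N61 K 1)) sys10 i) (Sys52 (N52_F (proj1_sig a))).
Proof.
have rF := radical_N52_F (proj1_sig a).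
have r3 := @not_radical_N52_3 K; have r4 := @not_radical_N52_4 K.
case: i => [[|[|[|[|[|[|[|[|[|[|i]]]]]]]]]] li] //=; try exact: id.
- exact: N52_1F_not.
- exact: N52_2F_not (proj2_sig a).
- by move=> /teq_sym; apply: not_radical_teq rF r3.
by move=> /teq_sym; apply: not_radical_teq rF r4.
Qed.

Lemma sys10_U_not (i : 'I_10) (a b : K) : ~ teq (N43_U a b) (N43_U 0 0) ->
  ~ sysrel (nth (Sys61 (N61 K 1)) sys10 i) (Sys43 (N43_U a b)).
Proof.
move=> u0; case: i => [[|[|[|[|[|[|[|[|[|[|i]]]]]]]]]] li] //=; try exact: id.
- exact: N43_IU_not (proj1 (N43_1_ok K)) gramI1.
- exact: N43_IU_not (proj1 (N43_2_ok K)) gramI2.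
by move=> /teq_sym.
Qed.

Lemma idxsysP b b' : sysrel (idxsys b) (idxsys b') <-> index_rel b b'.
Proof.
have u0 (a : kstar K) := N43_Ua0_U00 (proj2_sig a).
have uq (x : qparam K) a' : ~ teq (N43_U (proj1_sig x).1 (proj1_sig x).2) (N43_U a' 0).
  by case: x => [[x1 x2] /= x12]; have [/= x10 x20] := andP x12; apply: N43_Uab_U0.
have nn (A : Prop) : ~ A -> (A <-> False) by [].
rewrite /index_rel; case: b b' => [[i|[a|a]]|x] [[j|[a'|a']]|y].
- split; first exact: sys10P.
  by move=> e; change (i = j) in e; rewrite e; apply: sysrel_refl.
- by apply: nn; apply: sys10_F_not.
- by apply: nn; apply: sys10_U_not; apply: u0.
- by apply: nn; apply: sys10_U_not; apply: uq.
- by apply: nn => /sysrel_sym; apply: sys10_F_not.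
- exact: N52_FFP.
- by apply: nn.
- by apply: nn.
- by apply: nn => /sysrel_sym; apply: sys10_U_not; apply: u0.
- by apply: nn.
- exact: N43_U0P.
- by apply: nn => /teq_sym; apply: uq.
- by apply: nn => /sysrel_sym; apply: sys10_U_not; apply: uq.
- by apply: nn.
- by apply: nn => h; apply: uq h.
exact: N43_UUP.
Qed.


Lemma idxsys_surj x : sysok x -> exists b, sysrel x (idxsys b).
Proof.
case: x => M [aM fM].
- have [h|h|h] := nf61 K2 aM fM.
  + by exists (inl (inl (Ordinal (isT : 0 < 10)%N))).
  + by exists (inl (inl (Ordinal (isT : 1 < 10)%N))).
  by exists (inl (inl (Ordinal (isT : 2 < 10)%N))).
- have [[h|h|h|h]|[a a0 h]] := nf52 K2 aM fM.
  + by exists (inl (inl (Ordinal (isT : 3 < 10)%N))).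
  + by exists (inl (inl (Ordinal (isT : 4 < 10)%N))).
  + by exists (inl (inl (Ordinal (isT : 5 < 10)%N))).
  + by exists (inl (inl (Ordinal (isT : 6 < 10)%N))).
  by exists (inl (inr (inl (exist _ a a0)))).
have [[h|h|h]|[[a a0 h]|[a [b [a0 b0 h]]]]] := nf43 K2 aM fM.
- by exists (inl (inl (Ordinal (isT : 7 < 10)%N))).
- by exists (inl (inl (Ordinal (isT : 8 < 10)%N))).
- by exists (inl (inl (Ordinal (isT : 9 < 10)%N))).
- by exists (inl (inr (inr (exist _ a a0)))).
have ab : (((a, b) : K * K).1 != 0) && (((a, b) : K * K).2 != 0) by rewrite /= a0 b0.
by exists (inr (exist _ (a, b) ab)).
Qed.

Theorem minalg_count : same_class_count (@minalg_iso K 7) (@index_rel K).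
Proof.
exists (fun b => exist _ (sysD (idxsys b)) (sysD_ok (idxsys_ok b))); split.
  by move=> b b'; rewrite /minalg_iso /= sysD_iso ?idxsysP //; apply: idxsys_ok.
move=> [D [cD mD lD]]; have [x ox ix] := sysD_surj cD lD.
have [b xb] := idxsys_surj ox; exists b; rewrite /minalg_iso /=.
by apply: cdga_iso_trans ix _; apply/sysD_iso => //; apply: idxsys_ok.
Qed.

End Assembly.

(** * Counting classes over closed and real fields *)

Section Counting.

Lemma scc_trans (A B C : Type) (R : A -> A -> Prop) (S : B -> B -> Prop) (T : C -> C -> Prop) :
  (forall x y z, R x y -> R y z -> R x z) ->
  same_class_count R S -> same_class_count S T -> same_class_count R T.
Proof.
move=> tR [F [F1 F2]] [G [G1 G2]]; exists (F \o G); split=> [c c'|a] /=.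
  by rewrite F1 G1.
have [b ab] := F2 a; have [c bc] := G2 b; exists c.
by apply: tR ab _; apply/F1.
Qed.

Lemma scc_sum (A A' B B' : Type) (R : A -> A -> Prop) (R' : A' -> A' -> Prop)
    (S : B -> B -> Prop) (S' : B' -> B' -> Prop) :
  same_class_count R R' -> same_class_count S S' ->
  same_class_count (sum_rel R S) (sum_rel R' S').
Proof.
move=> [F [F1 F2]] [G [G1 G2]].
exists (fun x => match x with inl a => inl (F a) | inr b => inr (G b) end); split.
  by move=> [a|b] [a'|b'] //=.
move=> [a|b] /=; first by have [x] := F2 a; exists (inl x).
by have [x] := G2 b; exists (inr x).
Qed.

Lemma scc_refl (A : Type) : same_class_count (@eq A) (@eq A).
Proof. by exists id; split=> // a; exists a. Qed.

(** The map in [same_class_count] runs from the second type to the first, hence [split]. *)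
Lemma scc_ord m n : same_class_count (sum_rel (@eq 'I_m) (@eq 'I_n)) (@eq 'I_(m + n)).
Proof.
exists (@split m n); split=> [b b'|a].
  split=> [h|->]; last by case: (split b') => /=.
  apply: (can_inj (@splitK m n)); move: h.
  by case: (split b) => x; case: (split b') => y //= ->.
by exists (unsplit a); rewrite unsplitK; case: a.
Qed.

Lemma scc_index (K : fieldType) r s (K2 : (2%:R : K) != 0) :
  same_class_count (@sqclass_rel K) (@eq 'I_r) -> same_class_count (@quat_rel K) (@eq 'I_s) ->
  same_class_count (@minalg_iso K 7) (@eq 'I_(10 + (r + r) + s)).
Proof.
move=> hr hs; have tI (x y z : MinAlgL2 K 7) : minalg_iso x y -> minalg_iso y z -> minalg_iso x z.
  exact: cdga_iso_trans.
have h1 : same_class_count (@index_rel K)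
   (sum_rel (sum_rel (@eq 'I_10) (sum_rel (@eq 'I_r) (@eq 'I_r))) (@eq 'I_s)).
  by apply: scc_sum hs; apply: scc_sum (scc_refl _) _; apply: scc_sum.
have h2 := scc_sum (scc_sum (scc_refl 'I_10) (scc_ord r r)) (scc_refl 'I_s).
have h3 := scc_sum (scc_ord 10 (r + r)) (scc_refl 'I_s).
apply: (scc_trans tI) (scc_ord _ _); apply: (scc_trans tI) h3.
by apply: (scc_trans tI) h2; apply: (scc_trans tI) h1; apply: minalg_count.
Qed.

Lemma closed_sqrt (K : closedFieldType) (a : K) : exists x, x ^+ 2 = a.
Proof.
have /closed_rootP[x] : size ('X^2 - a%:P : {poly K}) != 1%N by rewrite size_XnsubC.
by rewrite rootE !hornerE subr_eq0 => /eqP; exists x.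
Qed.

Lemma sqclass_closed (K : closedFieldType) : same_class_count (@sqclass_rel K) (@eq 'I_1).
Proof.
exists (fun=> exist _ 1 (oner_neq0 K)); split=> [b b'|[a a0]].
  rewrite [b]ord1 [b']ord1; split=> // _; exists 1; rewrite oner_neq0; split=> //.
  by rewrite expr1n mul1r.
exists 0; have [x xa] := closed_sqrt a; exists x; rewrite /= mulr1 xa; split=> //.
by apply: contra_neq a0 => x0; rewrite -xa x0 expr2 mul0r.
Qed.

Lemma quat_refl (K : fieldType) (x : qparam K) : quat_rel x x.
Proof. by exists id; split=> //; exists id. Qed.

Definition qpar (K : fieldType) (a b : K) (a0 : a != 0) (b0 : b != 0) : qparam K :=
  exist _ (a, b) (introT andP (conj a0 b0)).

(** In (1,1), multiples of the generators by square roots of [a] and [b] have squares [a] and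
    [b]. *)
Lemma quat_closed (K : closedFieldType) : same_class_count (@quat_rel K) (@eq 'I_1).
Proof.
exists (fun=> qpar (oner_neq0 K) (oner_neq0 K)); split=> [b b'|[[a b] ab]].
  by rewrite [b]ord1 [b']ord1; split=> // _; apply: quat_refl.
have [/= a0 b0] := andP ab; exists 0; apply: pure_quat_iso => //=.
have [x <-] := closed_sqrt a; have [y <-] := closed_sqrt b.
by exists x, 0, 0, 0, y, 0; rewrite /pureq; split; ring.
Qed.

Section RealCase.
Variable R : realType.

Lemma real2 : (2%:R : R) != 0. Proof. by rewrite pnatr_eq0. Qed.
Lemma N1_neq0 : (-1 : R) != 0. Proof. by rewrite oppr_eq0 oner_eq0. Qed.

Lemma sqclass_real : same_class_count (@sqclass_rel R) (@eq 'I_2).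
Proof.
exists (fun i : 'I_2 => if i == 0 then exist _ 1 (oner_neq0 R) else exist _ (-1) N1_neq0); split.
  have n1 : ~ sqclass_rel (exist _ 1 (oner_neq0 R)) (exist _ (-1 : R) N1_neq0).
    by move=> [c [c0 /= e]]; have := sqr_ge0 c; lra.
  have n2 : ~ sqclass_rel (exist _ (-1 : R) N1_neq0) (exist _ 1 (oner_neq0 R)).
    by move=> [c [c0 /= e]]; have := sqr_ge0 c; lra.
  have rf (x : kstar R) : sqclass_rel x x.
    by exists 1; rewrite oner_neq0 expr1n mul1r.
  move=> [[|[|i]] li] [[|[|j]] lj] //=; split=> // _; try exact: rf; exact: val_inj.
move=> [a a0]; have [ap|an] := ltP 0 a.
  exists 0, (Num.sqrt a) => /=; rewrite sqr_sqrtr ?ltW // mulr1; split=> //.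
  by rewrite gt_eqF // sqrtr_gt0.
have na : 0 < - a by rewrite oppr_gt0 lt_neqAle a0.
exists 1, (Num.sqrt (- a)) => /=; rewrite sqr_sqrtr ?ltW // mulrN1 opprK; split=> //.
by rewrite gt_eqF // sqrtr_gt0.
Qed.

(** The representatives are the split algebra (1,1) and the Hamilton quaternions (-1,-1), in which
    the square of a pure quaternion is never 1. *)
Lemma quat_real : same_class_count (@quat_rel R) (@eq 'I_2).
Proof.
exists (fun i : 'I_2 => if i == 0 then qpar (oner_neq0 R) (oner_neq0 R) else qpar N1_neq0 N1_neq0); split.
  have n1 : ~ quat_iso (1 : R) 1 (-1) (-1).
    by move=> /(quat_iso_pure real2)[u1 [u2 [u3 [v1 [v2 [v3 [+ _ _]]]]]]]; rewrite /pureq; nra.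
  have n2 : ~ quat_iso (-1 : R) (-1) 1 1.
    move=> /(quat_sim3P real2 N1_neq0 N1_neq0 (oner_neq0 R) (oner_neq0 R))/(sim3_sym real2).
    by move/(quat_sim3P real2 (oner_neq0 R) (oner_neq0 R) N1_neq0 N1_neq0).
  move=> [[|[|i]] li] [[|[|j]] lj] //=; split=> // _; try exact: quat_refl; exact: val_inj.
move=> [[a b] ab]; have [/= a0 b0] := andP ab.
have sq x : 0 < x -> exists y : R, y ^+ 2 = x by move=> x0; exists (Num.sqrt x); rewrite sqr_sqrtr ?ltW.
have sqn x : x != 0 -> x <= 0 -> exists y : R, y ^+ 2 = - x.
  by move=> x0 xn; apply: sq; rewrite oppr_gt0 lt_neqAle x0.
have [ap|an] := ltP 0 a; have [bp|bn] := ltP 0 b.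
- exists 0; apply: pure_quat_iso => //=; have [x ex] := sq _ ap; have [y ey] := sq _ bp.
  by exists x, 0, 0, 0, y, 0; rewrite -ex -ey /pureq; split; ring.
(* The third basis element of (1,1) has square -1 and realises the negative parameter. *)
- exists 0; apply: pure_quat_iso => //=; have [x ex] := sq _ ap; have [y ey] := sqn _ b0 bn.
  by exists x, 0, 0, 0, 0, y; rewrite -[b]opprK -ex -ey /pureq; split; ring.
- exists 0; apply: pure_quat_iso => //=; have [x ex] := sqn _ a0 an; have [y ey] := sq _ bp.
  by exists 0, 0, x, y, 0, 0; rewrite -[a]opprK -ex -ey /pureq; split; ring.
exists 1; apply: pure_quat_iso => //=; have [x ex] := sqn _ a0 an; have [y ey] := sqn _ b0 bn.
by exists x, 0, 0, 0, y, 0; rewrite -[a]opprK -[b]opprK -ex -ey /pureq; split; ring.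
Qed.

End RealCase.

End Counting.

Theorem theorem1p1 :
  (forall K : fieldType, (2%:R : K) != 0 ->
     same_class_count (@minalg_iso K 7) (@index_rel K)) /\
  (forall K : closedFieldType, (2%:R : K) != 0 ->
     [/\ same_class_count (@sqclass_rel K) (@eq 'I_1),
         same_class_count (@quat_rel K) (@eq 'I_1) &
         same_class_count (@minalg_iso K 7) (@eq 'I_13)]) /\
  (forall R : realType,
     [/\ same_class_count (@sqclass_rel R) (@eq 'I_2),
         same_class_count (@quat_rel R) (@eq 'I_2) &
         same_class_count (@minalg_iso R 7) (@eq 'I_16)]).
Proof.
split; first exact: minalg_count.
split=> [K K2|R]; split.
- exact: sqclass_closed.
- exact: quat_closed.
(* [10 + (1 + 1) + 1] computes to 13. *)
- exact: (scc_index K2 (sqclass_closed K) (quat_closed K)).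
- exact: sqclass_real.
- exact: quat_real.
exact: (scc_index (real2 R) (sqclass_real R) (quat_real R)).
Qed.
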